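(* Let $f(w)=w+w^2+O(w^3)$ be a holomorphic germ at the origin of $\mathbb{C}$. For integers $n\ge1$ and $0\le k\le n-1$ let $\varepsilon_{k,n},\sigma_{k,n}\in\mathbb{C}$ satisfy $$\varepsilon_{k,n}=\frac{\pi}{n}+\frac{\pi}{n^2}\sigma_{k,n}+O\Big(\frac{1}{n^{2+\alpha}}\Big)$$ for some $0<\alpha<1$ (with the $O$ uniform in $k$), with the $\sigma_{k,n}$ uniformly bounded. For $w_0\in\mathcal{B}_f$ set $w_0^{(n)}=w_0$ and $w_{k+1}^{(n)}=f(w_k^{(n)})+\varepsilon_{k,n}^2$ for $0\le k\le n-1$. Assume that $$\sigma_{k,n}+\sigma_{n-2-k,n}=O\Big(\frac1n\Big)\qquad\text{for every } n\in\mathbb{N}\text{ and } 0\le k\le n-2$$ (uniformly in $k$). Then $w_n^{(n)}=L_0(w_0)+o(1)$ as $n\to\infty$.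
   Context: Write $f(w)=w+w^2+aw^3+O(w^4)$. For sufficiently small $r>0$ let $P^\iota=\{|w+r|<r\}$ (attracting petal) and $P^o=\{|w-r|<r\}$ (repelling petal). $P^\iota$ is forward invariant under $f$ and $f^m(w)\to0$ for $w\in P^\iota$. The parabolic basin is $\mathcal{B}_f=\bigcup_{m\ge0}f^{-m}(P^\iota)$. Let $\log$ be the principal branch. The attracting and repelling Fatou coordinates are the (univalent, for $r$ small) holomorphic maps $\phi^\iota:P^\iota\to\mathbb{C}$, $\phi^o:P^o\to\mathbb{C}$ with $\phi^\iota(f(w))=\phi^\iota(w)+1$ and $\phi^o(f(w))=\phi^o(w)+1$ (the latter when $w,f(w)\in P^o$), normalized by $\phi^\iota(w)=-\frac1w+(1-a)\log(-w)+o(1)$ and $\phi^o(w)=-\frac1w+(1-a)\log w+o(1)$ as $w\to0$ in the respective petal. The map $\phi^\iota$ is extended to $\mathcal{B}_f$ by $\phi^\iota(w)=\phi^\iota(f^m(w))-m$ ($m$ large). The inverse $(\phi^o)^{-1}$, defined on a left half-plane, is extended to $\mathbb{C}$ by $(\phi^o)^{-1}(\zeta)=f^m\big((\phi^o)^{-1}(\zeta-m)\big)$ ($m$ large). The Lavaurs map of phase $0$ is $L_0=(\phi^o)^{-1}\circ\phi^\iota$ on $\mathcal{B}_f$. Convention: $f$ is understood to be defined on a domain for which these extensions make sense (as is automatic, for instance, if $f$ is entire). *)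

(* Defs.v *)
From Stdlib Require Export Reals ClassicalEpsilon.
From Coquelicot Require Export Coquelicot.

Open Scope R_scope.

(** Principal argument, with values in (-PI, PI] for z <> 0. *)
Definition Carg (z : C) : R :=
  if Rle_dec 0 (snd z) then acos (fst z / Cmod z) else - acos (fst z / Cmod z).

Definition Clog (z : C) : C := (ln (Cmod z), Carg z).

Definition holomorphic_on (D : C -> Prop) (g : C -> C) : Prop :=
  forall z : C, D z -> ex_derive (K := C_AbsRing) (V := C_NormedModule) g z.

(** f(w) = w + w^2 + a w^3 + O(w^4) as w -> 0. *)
Definition parabolic_expansion (f : C -> C) (a : C) : Prop :=
  exists K delta : R, 0 < delta /\
    forall w : C, Cmod w < delta ->
      Cmod (f w - (w + w ^ 2 + a * w ^ 3))%C <= K * Cmod w ^ 4.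

Definition attracting_petal (r : R) (w : C) : Prop := Cmod (w + r)%C < r.
Definition repelling_petal (r : R) (w : C) : Prop := Cmod (w - r)%C < r.

Definition iterate (f : C -> C) (m : nat) (w : C) : C := Nat.iter m f w.

(** Throughout, the germ is represented by a total function [f : C -> C] of which
    only the restriction to an open domain [U] is meaningful. [iterable f U m w]
    says that the m-th iterate of this restriction is defined at w. *)
Definition iterable (f : C -> C) (U : C -> Prop) (m : nat) (w : C) : Prop :=
  forall j : nat, (j < m)%nat -> U (iterate f j w).

Definition parabolic_basin (f : C -> C) (U : C -> Prop) (r : R) (w : C) : Prop :=
  exists m : nat, iterable f U m w /\ attracting_petal r (iterate f m w).

Definition univalent_on (D : C -> Prop) (g : C -> C) : Prop :=
  holomorphic_on D g /\ forall w z : C, D w -> D z -> g w = g z -> w = z.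

(** Only the values of [phi] on the petal are constrained. *)
Definition attracting_Fatou_coordinate
    (f : C -> C) (a : C) (r : R) (phi : C -> C) : Prop :=
  univalent_on (attracting_petal r) phi /\
  (forall w : C, attracting_petal r w -> phi (f w) = (phi w + 1)%C) /\
  filterlim (fun w : C => (phi w - (- / w + (1 - a) * Clog (- w)))%C)
    (within (attracting_petal r) (locally (RtoC 0))) (locally (RtoC 0)).

Definition repelling_Fatou_coordinate
    (f : C -> C) (a : C) (r : R) (phi : C -> C) : Prop :=
  univalent_on (repelling_petal r) phi /\
  (forall w : C, repelling_petal r w -> repelling_petal r (f w) ->
     phi (f w) = (phi w + 1)%C) /\
  filterlim (fun w : C => (phi w - (- / w + (1 - a) * Clog w))%C)
    (within (repelling_petal r) (locally (RtoC 0))) (locally (RtoC 0)).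

(** The common value of phi (f^m w) - m for all large m. *)
Definition extended_attracting_coordinate (f phi : C -> C) (w : C) : C :=
  epsilon (inhabits (RtoC 0)) (fun v : C =>
    eventually (fun m : nat => v = (phi (iterate f m w) - INR m)%C)).

(** The common value of f^m (phi^{-1} (zeta - m)) for all large m, where phi^{-1}
    takes values in the repelling petal. That petal is a fixed disc, and its image
    under phi need not contain a left half-plane (when Re (1 - a) > 0); it does
    contain zeta - m for every zeta and all m large. *)
Definition extended_repelling_inverse
    (f : C -> C) (r : R) (phi : C -> C) (zeta : C) : C :=
  epsilon (inhabits (RtoC 0)) (fun v : C =>
    eventually (fun m : nat => exists u : C,
      repelling_petal r u /\ phi u = (zeta - INR m)%C /\ v = iterate f m u)).

(** The orbits used to extend phi^{-1} to all of C do not leave the domain of f;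
    this is automatic when U is the whole plane. *)
Definition repelling_inverse_extends
    (f : C -> C) (U : C -> Prop) (r : R) (phi : C -> C) : Prop :=
  forall zeta : C, eventually (fun m : nat => forall u : C,
    repelling_petal r u -> phi u = (zeta - INR m)%C -> iterable f U m u).

Definition Lavaurs0 (f : C -> C) (r : R) (phi_i phi_o : C -> C) (w : C) : C :=
  extended_repelling_inverse f r phi_o (extended_attracting_coordinate f phi_i w).

(** [perturbed_orbit f eps n w0 k] is w_k^{(n)}, with [eps k n] for
    epsilon_{k,n}. *)
Fixpoint perturbed_orbit
    (f : C -> C) (eps : nat -> nat -> C) (n : nat) (w0 : C) (k : nat) : C :=
  match k with
  | O => w0
  | S j => (f (perturbed_orbit f eps n w0 j) + eps j n ^ 2)%C
  end.

(* Main.v *)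
Require Import Defs.
From Stdlib Require Import Lia Lra Bool Classical.

(** Put eps = PI/n. The time-one map of w' = w^2 + eps^2 is a Moebius map with the real orbit
    c_k = - eps cot(eps k), 0 < k < n, and u = (w - c_k)/(w c_k + eps^2) is a coordinate that
    this map leaves invariant. For the perturbed dynamics, with x_k = eps / sin(eps k) and
    kappa_k = eps_{k,n}^2 - eps^2,
      u_{k+1} - u_k = (a-1) c_k - a c_k sin^2(eps k) + kappa_k / x_k^2 + O((1 + |u_k|) x_k^2).
    The first two terms are increments of (a-1) ln x_k + (a/2) sin^2(eps k), which takes the same
    value at k = m and k = n - m. The kappa terms sum to about
    (2/n) sum_k sigma_{k,n} sin^2(eps k), which tends to 0 under the pairing k <-> n-2-k. The
    errors sum to O(m^(-1/2)). Hence u_{n-m} = u_m + O(m^(-1/2)) when n -> infinity with m fixed.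

    For n -> infinity, u_m becomes -1/w - m at the entrance and u_{n-m} becomes m - 1/w at the
    exit, and the asymptotics of the Fatou coordinates turn the conservation of u into
    phi^o(w_{n-m}) = phi^iota(w_0) - m + o(1) as m -> infinity. The Abel equation carries this to
    a fixed M in place of m, exactly in the limit n -> infinity, and the last M steps follow from
    the continuity of f^M.

    That phi^o attains the value zeta - m for m large needs no complex analysis: in the variable
    Z = -1/w, phi^o differs from a translation by less than 1 on a box of half-side 1, so the
    Poincare-Miranda theorem applies. *)

(** * Continuity, compactness and the planar Poincare-Miranda theorem *)

(** The reference orbit has poles at k = 0 and k = n, so [u] is only used for m <= k <= n - m, and
    the estimates are made in terms of the distance j = min(k, n - k) to the nearer end, where x_k =
    O(1/j). Logarithms occur twice, in the drift of -1/w_k - k along the unperturbed orbit and in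
    the potential. Both are bounded crudely by square roots: then |u_k| = O(sqrt j), the error per
    step is O(j^(-3/2)), and its sum over the passage is O(m^(-1/2)).

    This bound is uniform in n but small only for large m, whereas the first and last m steps are
    controlled by continuity, for m fixed. The limits are therefore taken in the order n ->
    infinity, then m -> infinity. That alone would not end the proof, since the continuity of f^m is
    not uniform in m; this is why the comparison is brought back to a fixed M by the Abel equation.

    The normalizations of the two Fatou coordinates both contribute -(1 - a) ln m, one at w_m and
    the other at w_{n-m}, and the two terms cancel. *)

Lemma locally_Cmod (z : C) (P : C -> Prop) :
  locally (T := C_UniformSpace) z P <->
  exists d : R, 0 < d /\ forall y : C, Cmod (y - z)%C < d -> P y.
Proof.
  rewrite locally_C. split.
  - intros [d Hd]. exists d. split; [apply cond_pos|]. intros y Hy. apply Hd, Hy.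
  - intros [d [Hd H]]. exists (mkposreal d Hd). intros y Hy. apply H, Hy.
Qed.

Definition Ccont (g : C -> C) (z : C) : Prop :=
  forall e : R, 0 < e -> exists d : R, 0 < d /\
    forall y : C, Cmod (y - z)%C < d -> Cmod (g y - g z)%C < e.

Lemma ex_derive_Ccont (g : C -> C) (z : C) :
  ex_derive (K := C_AbsRing) (V := C_NormedModule) g z -> Ccont g z.
Proof.
  intros H e He.
  apply ex_derive_continuous in H.
  assert (HP : locally (T := C_UniformSpace) (g z) (fun y => Cmod (y - g z)%C < e)).
  { apply locally_Cmod. exists e. auto. }
  specialize (H _ HP).
  apply (locally_C z (fun y => Cmod (g y - g z)%C < e)) in H.
  now apply locally_Cmod in H.
Qed.

Lemma Cmod_minus_sym (z w : C) : Cmod (z - w)%C = Cmod (w - z)%C.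
Proof. rewrite <- Cmod_opp. f_equal. ring. Qed.

Lemma Cmod_triangle3 (x y z : C) : Cmod (x - z)%C <= Cmod (x - y)%C + Cmod (y - z)%C.
Proof. replace (x - z)%C with ((x - y) + (y - z))%C by ring. apply Cmod_triangle. Qed.

Lemma Cmod_sub_ge (x y : C) : Cmod x - Cmod y <= Cmod (x - y)%C.
Proof.
  assert (H := Cmod_triangle (x - y) y). replace (x - y + y)%C with x in H by ring. lra.
Qed.

Lemma Cmod_add_ge (x y : C) : Cmod x - Cmod y <= Cmod (x + y)%C.
Proof.
  assert (H := Cmod_sub_ge x (- y)). rewrite Cmod_opp in H.
  now replace (x - - y)%C with (x + y)%C in H by ring.
Qed.

Lemma Cmod_sub_le (x y : C) : Cmod (x - y)%C <= Cmod x + Cmod y.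
Proof. rewrite <- (Cmod_opp y). apply Cmod_triangle. Qed.

Lemma Rabs_fst_le (z : C) : Rabs (fst z) <= Cmod z.
Proof. eapply Rle_trans; [apply Rmax_l|apply Rmax_Cmod]. Qed.

Lemma Rabs_snd_le (z : C) : Rabs (snd z) <= Cmod z.
Proof. eapply Rle_trans; [apply Rmax_r|apply Rmax_Cmod]. Qed.

Lemma Cmod_le_sum (z : C) : Cmod z <= Rabs (fst z) + Rabs (snd z).
Proof.
  replace z with (RtoC (fst z) + RtoC (snd z) * Ci)%C at 1.
  2: { destruct z; unfold RtoC, Ci, Cplus, Cmult; simpl; f_equal; ring. }
  eapply Rle_trans; [apply Cmod_triangle|].
  rewrite Cmod_mult, !Cmod_R, Cmod_Ci. lra.
Qed.

(** Compactness of the rectangle, in the form of a Lebesgue number; [P y h] is to be read as: the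
    radius [h] works at [y]. It makes the continuity arguments on boxes uniform. *)
Lemma box_uniform (a b a' b' : R) (P : C -> R -> Prop) :
  (forall y h h', h' <= h -> P y h -> P y h') ->
  (forall u v, a <= u <= b -> a' <= v <= b' ->
     exists h, 0 < h /\ forall y : C, Cmod (y - (u, v))%C < h -> P y h) ->
  exists h, 0 < h /\
    forall u v, a <= u <= b -> a' <= v <= b' -> P (u, v) h.
Proof.
  intros Pmono Hloc.
  (* The gauge is half the given radius, because compactness controls the two coordinates separately
     and [Cmod] is at most the sum of their absolute values. *)
  assert (Hd : forall u v, exists d : posreal, a <= u <= b -> a' <= v <= b' ->
    forall y : C, Cmod (y - (u, v))%C < 2 * d -> P y (2 * d)).
  { intros u v. destruct (classic (a <= u <= b /\ a' <= v <= b')) as [[Hu Hv]|Hn].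
    - destruct (Hloc u v Hu Hv) as [h [Hh H]].
      assert (h2 : 0 < h / 2) by lra. exists (mkposreal _ h2). intros _ _ y. simpl.
      replace (2 * (h / 2)) with h by field. apply H.
    - exists (mkposreal 1 Rlt_0_1). tauto. }
  set (delta := fun u v => proj1_sig (constructive_indefinite_description _ (Hd u v))).
  assert (Hdelta : forall u v, a <= u <= b -> a' <= v <= b' ->
    forall y : C, Cmod (y - (u, v))%C < 2 * delta u v -> P y (2 * delta u v)).
  { intros u v. unfold delta.
    destruct (constructive_indefinite_description _ (Hd u v)) as [d H]. exact H. }
  destruct (compactness_value_2d a b a' b' delta) as [d Hdd].
  exists d. split; [apply cond_pos|]. intros x y Hx Hy.
  (* [compactness_value_2d] yields only a doubly negated existence, hence the classical step. *)
  apply NNPP. intros Hn. apply (Hdd x y Hx Hy). intros (u & v & Hu & Hv & H1 & H2 & H3).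
  apply Hn. apply Pmono with (2 * delta u v).
  { assert (H := cond_pos d). lra. }
  apply Hdelta; auto.
  eapply Rle_lt_trans; [apply Cmod_le_sum|]. simpl. unfold Rminus in *. lra.
Qed.

(* Vertices carry three colours: [p], [~p /\ q] and [~p /\ ~q]; this counts edges joining
   the first two. *)
Definition colour_edge (x y x' y' : bool) : bool := xorb (x && negb x' && y') (x' && negb x && y).

Fixpoint row_count (p q : nat -> nat -> bool) (j i : nat) : bool :=
  match i with
  | O => false
  | S i' => xorb (row_count p q j i') (colour_edge (p i' j) (q i' j) (p i j) (q i j))
  end.

(** Sperner's parity argument on squares instead of triangles. Around a cell that misses a colour,
    the edges between the first two colours are even in number. Without a tricoloured cell all rows
    then have the same parity: the left side has only the first colour and the right side lacks it,
    so neither contributes. But the top row lacks the second colour, so its count is 0, and the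
    bottom row lacks the third and runs from the first colour to the second, so its count is odd. *)
Lemma grid_tricoloured_cell (N : nat) (p q : nat -> nat -> bool) :
  (forall j, (j <= N)%nat -> p 0%nat j = true) ->
  (forall j, (j <= N)%nat -> p N j = false) ->
  (forall i, (i <= N)%nat -> q i 0%nat = true) ->
  (forall i, (i <= N)%nat -> q i N = false) ->
  exists i j, (i < N)%nat /\ (j < N)%nat /\
  (exists i' j', (i <= i' <= S i)%nat /\ (j <= j' <= S j)%nat /\ p i' j' = true) /\
  (exists i' j', (i <= i' <= S i)%nat /\ (j <= j' <= S j)%nat /\
     p i' j' = false /\ q i' j' = true) /\
  (exists i' j', (i <= i' <= S i)%nat /\ (j <= j' <= S j)%nat /\
     p i' j' = false /\ q i' j' = false).
Proof.
  intros left_side right_side bottom_side top_side. apply NNPP. intros Hno.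
  assert (cell : forall i j, (i < N)%nat -> (j < N)%nat ->
    xorb (xorb (colour_edge (p i j) (q i j) (p (S i) j) (q (S i) j))
               (colour_edge (p i (S j)) (q i (S j)) (p (S i) (S j)) (q (S i) (S j))))
         (xorb (colour_edge (p i j) (q i j) (p i (S j)) (q i (S j)))
               (colour_edge (p (S i) j) (q (S i) j) (p (S i) (S j)) (q (S i) (S j)))) = false).
  { intros i j Hi Hj. apply not_true_is_false. intros Hx. apply Hno.
    exists i, j. split; [exact Hi|]. split; [exact Hj|].
    repeat split;
    destruct (p i j) eqn:E1, (q i j) eqn:E2, (p (S i) j) eqn:E3, (q (S i) j) eqn:E4,
      (p i (S j)) eqn:E5, (q i (S j)) eqn:E6, (p (S i) (S j)) eqn:E7, (q (S i) (S j)) eqn:E8;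
    cbv in Hx; try discriminate Hx;
    first [ exists i, j; repeat split; solve [lia | assumption]
          | exists (S i), j; repeat split; solve [lia | assumption]
          | exists i, (S j); repeat split; solve [lia | assumption]
          | exists (S i), (S j); repeat split; solve [lia | assumption] ]. }
  assert (strip : forall j, (j < N)%nat -> forall i, (i <= N)%nat ->
    xorb (row_count p q j i) (row_count p q (S j) i) =
    xorb (colour_edge (p 0%nat j) (q 0%nat j) (p 0%nat (S j)) (q 0%nat (S j)))
         (colour_edge (p i j) (q i j) (p i (S j)) (q i (S j)))).
  { intros j Hj. induction i as [|i IH]; intros Hi.
    - simpl. rewrite xorb_nilpotent. reflexivity.
    - assert (H := cell i j ltac:(lia) Hj). specialize (IH ltac:(lia)). simpl.
      revert H IH. generalize (colour_edge (p i j) (q i j) (p (S i) j) (q (S i) j))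
        (colour_edge (p i (S j)) (q i (S j)) (p (S i) (S j)) (q (S i) (S j)))
        (colour_edge (p i j) (q i j) (p i (S j)) (q i (S j)))
        (colour_edge (p (S i) j) (q (S i) j) (p (S i) (S j)) (q (S i) (S j)))
        (colour_edge (p 0%nat j) (q 0%nat j) (p 0%nat (S j)) (q 0%nat (S j)))
        (row_count p q j i) (row_count p q (S j) i).
      intros [] [] [] [] [] [] []; simpl; congruence. }
  assert (rows : forall j, (j <= N)%nat -> row_count p q j N = row_count p q 0 N).
  { induction j as [|j IH]; intros Hj; [reflexivity|].
    rewrite <- IH by lia. assert (H := strip j ltac:(lia) N ltac:(lia)).
    rewrite (left_side j), (left_side (S j)), (right_side j), (right_side (S j)) in H by lia.
    cbv [colour_edge] in H. simpl in H. apply xorb_eq. rewrite xorb_comm. exact H. }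
  assert (top : forall i, (i <= N)%nat -> row_count p q N i = false).
  { induction i as [|i IH]; intros Hi; [reflexivity|]. simpl. rewrite IH by lia.
    unfold colour_edge. rewrite (top_side i), (top_side (S i)) by lia.
    rewrite !andb_false_r. reflexivity. }
  assert (bottom : forall i, (i <= N)%nat -> row_count p q 0 i = negb (p i 0%nat)).
  { induction i as [|i IH]; intros Hi.
    - simpl. rewrite left_side by lia. reflexivity.
    - simpl. rewrite IH by lia.
      unfold colour_edge. rewrite (bottom_side i), (bottom_side (S i)) by lia.
      destruct (p i 0%nat), (p (S i) 0%nat); reflexivity. }
  assert (H := rows N ltac:(lia)).
  rewrite top, bottom, right_side in H by lia. discriminate H.
Qed.

(** If [G] had no zero, one of its coordinates would keep its sign near each point, so no small set
    could show the three sign patterns [fst < 0], [fst >= 0 > snd] and [fst, snd >= 0]. A fine grid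
    coloured by these patterns has a cell that shows them all. *)
Lemma Poincare_Miranda (G : C -> C) (x0 y0 h : R) : 0 < h ->
  (forall x y, Rabs (x - x0) <= h -> Rabs (y - y0) <= h -> Ccont G (x, y)) ->
  (forall y, Rabs (y - y0) <= h -> fst (G (x0 - h, y)) < 0) ->
  (forall y, Rabs (y - y0) <= h -> 0 < fst (G (x0 + h, y))) ->
  (forall x, Rabs (x - x0) <= h -> snd (G (x, y0 - h)) < 0) ->
  (forall x, Rabs (x - x0) <= h -> 0 < snd (G (x, y0 + h))) ->
  exists x y, Rabs (x - x0) <= h /\ Rabs (y - y0) <= h /\ G (x, y) = RtoC 0.
Proof.
  intros Hh Gcont Hl Hr Hb Ht. apply NNPP. intros Hno.
  set (P := fun (y : C) (d : R) => forall A B D : C,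
    Cmod (A - y)%C < d -> Cmod (B - y)%C < d -> Cmod (D - y)%C < d ->
    fst (G A) < 0 -> (0 <= fst (G B) /\ snd (G B) < 0) ->
    (0 <= fst (G D) /\ 0 <= snd (G D)) -> False).
  destruct (box_uniform (x0 - h) (x0 + h) (y0 - h) (y0 + h) P) as [d [Hd HP]].
  { intros y d d' Hdd H A B D HA HB HD. apply H; lra. }
  { intros u v Hu Hv.
    assert (Hc : Ccont G (u, v)) by (apply Gcont; apply Rabs_le; lra).
    assert (Hnz : G (u, v) <> RtoC 0).
    { intros E. apply Hno. exists u, v. repeat split; auto; apply Rabs_le; lra. }
    assert (Hor : fst (G (u, v)) <> 0 \/ snd (G (u, v)) <> 0).
    { apply NNPP. intros Hn. apply not_or_and in Hn. destruct Hn as [H1 H2].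
      apply NNPP in H1. apply NNPP in H2. apply Hnz.
      destruct (G (u, v)); simpl in *; subst; reflexivity. }
    assert (Hpos : 0 < Rmax (Rabs (fst (G (u, v)))) (Rabs (snd (G (u, v))))).
    { destruct Hor as [H|H]; apply Rabs_pos_lt in H.
      - eapply Rlt_le_trans; [exact H|apply Rmax_l].
      - eapply Rlt_le_trans; [exact H|apply Rmax_r]. }
    destruct (Hc _ Hpos) as [d [Hd H]]. exists (d / 2). split; [lra|].
    intros y Hy A B D HA HB HD HA' [HB1 HB2] [HD1 HD2].
    assert (near : forall z, Cmod (z - y)%C < d / 2 -> Cmod (z - (u, v))%C < d).
    { intros z Hz. eapply Rle_lt_trans; [apply (Cmod_triangle3 z y)|]. lra. }
    apply near, H in HA. apply near, H in HB. apply near, H in HD.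
    (* The tolerance is the larger of the two absolute values. If it is that of [fst], the patterns
       of [A] and [B] exclude each other; if it is that of [snd], those of [B] and [D] do. *)
    revert HA HB HD. apply Rmax_case.
    - intros HA HB HD.
      assert (XA := Rle_lt_trans _ _ _ (Rabs_fst_le _) HA).
      assert (XB := Rle_lt_trans _ _ _ (Rabs_fst_le _) HB).
      simpl in XA, XB. apply Rabs_def2 in XA. apply Rabs_def2 in XB.
      revert XA XB. unfold Rabs. destruct (Rcase_abs _); intros; lra.
    - intros HA HB HD.
      assert (XB := Rle_lt_trans _ _ _ (Rabs_snd_le _) HB).
      assert (XD := Rle_lt_trans _ _ _ (Rabs_snd_le _) HD).
      simpl in XB, XD. apply Rabs_def2 in XB. apply Rabs_def2 in XD.
      revert XB XD. unfold Rabs. destruct (Rcase_abs _); intros; lra. }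
  destruct (archimed_cor1 (d / (8 * h))) as [N [HN HN0]].
  { apply Rdiv_lt_0_compat; lra. }
  assert (HNp : 0 < INR N) by now apply lt_0_INR.
  set (s := 2 * h / INR N).
  assert (Hs : 0 < s) by (apply Rdiv_lt_0_compat; lra).
  assert (Hs4 : 4 * s < d).
  { unfold s. apply Rmult_lt_compat_l with (r := 8 * h) in HN; [|lra].
    replace (8 * h * (d / (8 * h))) with d in HN by (field; lra).
    replace (4 * (2 * h / INR N)) with (8 * h * / INR N) by (field; lra). exact HN. }
  assert (HsN : s * INR N = 2 * h) by (unfold s; field; lra).
  set (pt := fun i j : nat => (x0 - h + s * INR i, y0 - h + s * INR j)).
  assert (Hin : forall i, (i <= N)%nat -> 0 <= s * INR i <= 2 * h).
  { intros i Hi. apply le_INR in Hi. assert (Hp := pos_INR i). split.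
    - apply Rmult_le_pos; lra.
    - rewrite <- HsN. apply Rmult_le_compat_l; lra. }
  set (p := fun i j => if Rlt_dec (fst (G (pt i j))) 0 then true else false).
  set (q := fun i j => if Rlt_dec (snd (G (pt i j))) 0 then true else false).
  destruct (grid_tricoloured_cell N p q) as (i & j & Hi & Hj & (i1 & j1 & HA1 & HA2 & HA3)
    & (i2 & j2 & HB1 & HB2 & HB3 & HB4) & (i3 & j3 & HC1 & HC2 & HC3 & HC4)).
  { intros j Hj. unfold p. destruct (Rlt_dec _ _) as [|n]; [reflexivity|]. exfalso. apply n.
    unfold pt. simpl INR. replace (x0 - h + s * 0) with (x0 - h) by ring.
    apply Hl. specialize (Hin j Hj). apply Rabs_le; lra. }
  { intros j Hj. unfold p. destruct (Rlt_dec _ _) as [n|]; [|reflexivity]. exfalso. revert n.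
    unfold pt. rewrite HsN. replace (x0 - h + 2 * h) with (x0 + h) by ring.
    apply Rle_not_lt, Rlt_le, Hr. specialize (Hin j Hj). apply Rabs_le; lra. }
  { intros j Hj. unfold q. destruct (Rlt_dec _ _) as [|n]; [reflexivity|]. exfalso. apply n.
    unfold pt. simpl INR. replace (y0 - h + s * 0) with (y0 - h) by ring.
    apply Hb. specialize (Hin j Hj). apply Rabs_le; lra. }
  { intros j Hj. unfold q. destruct (Rlt_dec _ _) as [n|]; [|reflexivity]. exfalso. revert n.
    unfold pt. rewrite HsN. replace (y0 - h + 2 * h) with (y0 + h) by ring.
    apply Rle_not_lt, Rlt_le, Ht. specialize (Hin j Hj). apply Rabs_le; lra. }
  assert (near : forall i' j', (i <= i' <= S i)%nat -> (j <= j' <= S j)%nat ->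
    Cmod (pt i' j' - pt i j)%C < d).
  { intros i' j' [A1 A2] [B1 B2].
    eapply Rle_lt_trans; [apply Cmod_le_sum|]. unfold pt. simpl.
    apply le_INR in A1, A2, B1, B2. rewrite S_INR in A2, B2.
    assert (T : forall x y : R, y <= x <= y + 1 -> forall b, Rabs (b + s * x + - (b + s * y)) <= s).
    { intros x y Hxy b. apply Rabs_le. split; nra. }
    assert (T1 := T _ _ (conj A1 A2) (x0 - h)). assert (T2 := T _ _ (conj B1 B2) (y0 - h)).
    lra. }
  apply (HP (x0 - h + s * INR i) (y0 - h + s * INR j))
    with (A := pt i1 j1) (B := pt i2 j2) (D := pt i3 j3).
  { assert (T := Hin i ltac:(lia)). lra. }
  { assert (T := Hin j ltac:(lia)). lra. }
  1-3: now apply near.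
  { unfold p in HA3. destruct (Rlt_dec (fst (G (pt i1 j1))) 0); [assumption|discriminate]. }
  { unfold p in HB3. destruct (Rlt_dec (fst (G (pt i2 j2))) 0); [discriminate|].
    unfold q in HB4. destruct (Rlt_dec (snd (G (pt i2 j2))) 0); [|discriminate]. lra. }
  { unfold p in HC3. destruct (Rlt_dec (fst (G (pt i3 j3))) 0); [discriminate|].
    unfold q in HC4. destruct (Rlt_dec (snd (G (pt i3 j3))) 0); [discriminate|]. lra. }
Qed.

(** * Logarithm, petals and the coordinate Z = -1/w *)

Lemma Cmod_add_le (x y : C) (a b : R) : Cmod x <= a -> Cmod y <= b -> Cmod (x + y)%C <= a + b.
Proof. intros. eapply Rle_trans; [apply Cmod_triangle|lra]. Qed.

Lemma Cmod_minus_le (x y : C) (a b : R) : Cmod x <= a -> Cmod y <= b -> Cmod (x - y)%C <= a + b.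
Proof. intros. eapply Rle_trans; [apply Cmod_sub_le|lra]. Qed.

Lemma Cmod_mult_le (x y : C) (a b : R) : Cmod x <= a -> Cmod y <= b -> Cmod (x * y)%C <= a * b.
Proof. intros. rewrite Cmod_mult. apply Rmult_le_compat; auto using Cmod_ge_0. Qed.

Lemma Cmod_pow_le (x : C) (a : R) (n : nat) : Cmod x <= a -> Cmod (x ^ n)%C <= a ^ n.
Proof. intros. rewrite Cmod_pow. apply pow_incr. split; auto using Cmod_ge_0. Qed.

Lemma Cmod_opp_le (x : C) (a : R) : Cmod x <= a -> Cmod (- x)%C <= a.
Proof. intros. now rewrite Cmod_opp. Qed.

(** Bounds the modulus of a polynomial expression by the corresponding expression in bounds of its
    parts. A bound found in the context takes precedence at every node, so a compound term with a
    known bound is used whole; an atom without one keeps its modulus. The right-hand side is usually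
    an existential variable that this fills in. *)
Ltac cbound :=
  lazymatch goal with
  | |- Cmod (Cplus _ _) <= _ => first [eassumption | eapply Cmod_add_le; cbound]
  | |- Cmod (Cminus _ _) <= _ => first [eassumption | eapply Cmod_minus_le; cbound]
  | |- Cmod (Cmult _ _) <= _ => first [eassumption | eapply Cmod_mult_le; cbound]
  | |- Cmod (Cpow _ _) <= _ => first [eassumption | eapply Cmod_pow_le; cbound]
  | |- Cmod (Copp _) <= _ => first [eassumption | eapply Cmod_opp_le; cbound]
  | |- _ => first [eassumption | apply Rle_refl]
  end.

Lemma Cmod_div_le (x y : C) (a b : R) :
  0 < b -> Cmod x <= a -> b <= Cmod y -> Cmod (x / y)%C <= a / b.
Proof.
  intros Hb Hx Hy. assert (Hy0 : y <> RtoC 0) by (apply Cmod_gt_0; lra).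
  rewrite Cmod_div by assumption. unfold Rdiv. apply Rmult_le_compat; auto using Cmod_ge_0.
  - apply Rlt_le, Rinv_0_lt_compat; lra.
  - apply Rinv_le_contravar; lra.
Qed.

Lemma ln_1p_approx (y : R) : Rabs y <= 1 / 2 -> Rabs (ln (1 + y) - y) <= 2 * y ^ 2.
Proof.
  intros Hy. apply Rabs_le_between in Hy.
  assert (H1 : ln (1 + y) <= y).
  { rewrite <- (ln_exp y) at 2. apply ln_le; [lra|].
    destruct (Req_dec y 0) as [->|]; [rewrite exp_0; lra|]. apply Rlt_le, exp_ineq1; lra. }
  assert (Hi : 0 < / (1 + y)) by (apply Rinv_0_lt_compat; lra).
  assert (H2 : ln (/ (1 + y)) <= / (1 + y) - 1).
  { rewrite <- (ln_exp (/ (1 + y) - 1)). apply ln_le; [lra|].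
    destruct (Req_dec (/ (1 + y) - 1) 0) as [E|Hne]; [rewrite E, exp_0; lra|].
    assert (He := exp_ineq1 (/ (1 + y) - 1) Hne). lra. }
  rewrite ln_Rinv in H2 by lra.
  assert (H3 : / (1 + y) - 1 <= - y + 2 * y ^ 2).
  { apply Rmult_le_reg_r with (1 + y); [lra|].
    replace ((/ (1 + y) - 1) * (1 + y)) with (- y) by (field; lra). nra. }
  apply Rabs_le. assert (Hy2 := pow2_ge_0 y). lra.
Qed.

Lemma Clog_near_1 (e : R) : 0 < e -> exists d : R, 0 < d /\
  forall z : C, Cmod (z - 1)%C < d -> Cmod (Clog z) < e.
Proof.
  intros He. set (t := Rmin (e / 4) 1).
  assert (Ht : 0 < t <= 1) by (unfold t; split; [apply Rmin_glb_lt; lra|apply Rmin_r]).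
  assert (Hte : t <= e / 4) by apply Rmin_l.
  assert (HPI := PI2_3_2).
  assert (Hc : cos t < 1).
  { rewrite <- cos_0. apply cos_decreasing_1; lra. }
  assert (Hc' := COS_bound t).
  (* The first bound puts the cosine of the argument above [cos t], hence the argument below [t];
     the other two serve the estimate of [ln (Cmod z)]. *)
  set (d := Rmin ((1 - cos t) / 4) (Rmin (1 / 2) (e / 8))).
  assert (Hd : 0 < d) by (unfold d; repeat apply Rmin_glb_lt; lra).
  assert (Hd1 : d <= (1 - cos t) / 4) by apply Rmin_l.
  assert (Hd2 : d <= 1 / 2) by (unfold d; eapply Rle_trans; [apply Rmin_r|apply Rmin_l]).
  assert (Hd3 : d <= e / 8) by (unfold d; eapply Rle_trans; [apply Rmin_r|apply Rmin_r]).
  exists d. split; [exact Hd|]. intros z Hz.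
  assert (Hre := Rle_lt_trans _ _ _ (Rabs_fst_le _) Hz). simpl in Hre.
  apply Rabs_def2 in Hre.
  assert (M1 : Cmod z < 1 + d).
  { assert (H := Cmod_triangle (z - 1) 1). rewrite Cmod_1 in H.
    replace (z - 1 + 1)%C with z in H by ring. lra. }
  assert (M2 : 1 - d < Cmod z).
  { assert (H := Cmod_sub_ge 1 (1 - z)). rewrite Cmod_1, (Cmod_minus_sym 1 z) in H.
    replace (1 - (1 - z))%C with z in H by ring. lra. }
  eapply Rle_lt_trans; [apply Cmod_le_sum|]. unfold Clog. simpl.
  assert (L : Rabs (ln (Cmod z)) <= e / 2 - e / 8).
  { assert (H := ln_1p_approx (Cmod z - 1)).
    replace (1 + (Cmod z - 1)) with (Cmod z) in H by ring.
    assert (Hab : Rabs (Cmod z - 1) <= d) by (apply Rabs_le; lra).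
    specialize (H ltac:(lra)).
    assert (Hsq : (Cmod z - 1) ^ 2 <= d / 2).
    { rewrite <- pow2_abs. assert (Hq := Rabs_pos (Cmod z - 1)). nra. }
    assert (T := Rabs_triang (ln (Cmod z) - (Cmod z - 1)) (Cmod z - 1)).
    replace (ln (Cmod z) - (Cmod z - 1) + (Cmod z - 1)) with (ln (Cmod z)) in T by ring. lra. }
  assert (A : 0 <= acos (fst z / Cmod z) < t).
  { set (y := fst z / Cmod z).
    assert (Hy : cos t < y).
    { unfold y. apply Rmult_lt_reg_r with (Cmod z); [lra|].
      replace (fst z / Cmod z * Cmod z) with (fst z) by (field; lra). nra. }
    assert (Hy1 : -1 <= y <= 1).
    { assert (H := Rabs_fst_le z). apply Rabs_le_between in H. unfold y. split.
      - apply Rmult_le_reg_r with (Cmod z); [lra|].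
        replace (fst z / Cmod z * Cmod z) with (fst z) by (field; lra). lra.
      - apply Rmult_le_reg_r with (Cmod z); [lra|].
        replace (fst z / Cmod z * Cmod z) with (fst z) by (field; lra). lra. }
    assert (B := acos_bound y). split; [lra|].
    apply Rnot_le_lt. intros Hge.
    assert (H := cos_decr_1 t (acos y) ltac:(lra) ltac:(lra) ltac:(lra) ltac:(lra) Hge).
    rewrite cos_acos in H by assumption. lra. }
  assert (B : Rabs (Carg z) <= t).
  { unfold Carg. destruct (Rle_dec 0 (snd z)); apply Rabs_le; lra. }
  lra.
Qed.

Lemma Clog_scale (l : R) (z : C) : 0 < l -> z <> RtoC 0 -> Clog (l * z)%C = (Clog z + ln l)%C.
Proof.
  intros Hl Hz. assert (Hm : 0 < Cmod z) by now apply Cmod_gt_0.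
  assert (E : Cmod (l * z)%C = l * Cmod z).
  { rewrite Cmod_mult, Cmod_R, Rabs_right by lra. reflexivity. }
  unfold Clog. rewrite E, ln_mult by lra.
  unfold Carg. rewrite E. destruct z as [x y]. unfold Cplus, RtoC in *. simpl.
  replace ((l * x - 0 * y) / (l * Cmod (x, y))) with (x / Cmod (x, y)) by (field; lra).
  f_equal; [ring|].
  destruct (Rle_dec 0 (l * y + 0 * x)), (Rle_dec 0 y); try ring; exfalso; nra.
Qed.

(** [m / Z] is close to 1 and the positive factor [m] splits off exactly, so continuity of [Clog] at
    1 suffices and the branch cut is never met. *)
Lemma Clog_inv_near (e : R) : 0 < e -> exists d : R, 0 < d /\
  forall (m : R) (Z : C), 0 < m -> Cmod (Z - m)%C <= d * m -> Cmod (Clog (/ Z) + ln m)%C < e.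
Proof.
  intros He. destruct (Clog_near_1 e He) as [d [Hd H]].
  set (d' := Rmin (1 / 2) (d / 4)).
  assert (Hd' : 0 < d') by (apply Rmin_glb_lt; lra).
  assert (D1 : d' <= 1 / 2) by apply Rmin_l. assert (D2 : d' <= d / 4) by apply Rmin_r.
  exists d'. split; [exact Hd'|]. intros m Z Hm HZ.
  assert (Hm0 : RtoC m <> RtoC 0) by (intros E; injection E; lra).
  assert (MZ : m / 2 <= Cmod Z).
  { assert (T := Cmod_sub_ge m (m - Z)). rewrite Cmod_R, (Cmod_minus_sym m Z), Rabs_right in T by lra.
    replace (m - (m - Z))%C with Z in T by ring. nra. }
  assert (HZ0 : Z <> RtoC 0) by (apply Cmod_gt_0; lra).
  assert (Hw : (m / Z)%C <> RtoC 0).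
  { intros E. apply Hm0. replace (RtoC m) with (m / Z * Z)%C by (field; auto). rewrite E. ring. }
  replace (Clog (/ Z) + ln m)%C with (Clog (m / Z)).
  { apply H. replace (m / Z - 1)%C with ((m - Z) / Z)%C by (field; auto).
    eapply Rle_lt_trans; [apply Cmod_div_le with (b := m / 2); [lra| |exact MZ]|].
    - rewrite Cmod_minus_sym. exact HZ.
    - replace (d' * m / (m / 2)) with (2 * d') by (field; lra). lra. }
  unfold Cdiv. apply Clog_scale; auto. intros E. apply Hw. unfold Cdiv. rewrite E. ring.
Qed.

Lemma Cmod_sqr (z : C) : Cmod z ^ 2 = fst z ^ 2 + snd z ^ 2.
Proof. exact (Cmod2_alt z). Qed.

Lemma Cmod_lt_iff_sqr (z w : C) : Cmod z < Cmod w <-> Cmod z ^ 2 < Cmod w ^ 2.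
Proof.
  assert (H1 := Cmod_ge_0 z). assert (H2 := Cmod_ge_0 w). split; intros H; [nra|].
  apply Rnot_le_lt. intros Hn. nra.
Qed.

Lemma opp_inv_invol (w : C) : w <> RtoC 0 -> (- / - / w)%C = w.
Proof. intros H. field. exact H. Qed.

Lemma opp_inv_neq0 (w : C) : w <> RtoC 0 -> (- / w)%C <> RtoC 0.
Proof.
  intros H E. assert (X : (- / w * w)%C = (- (1))%C) by (field; exact H).
  rewrite E in X. replace (0 * w)%C with (RtoC 0) in X by ring.
  injection X. intros. lra.
Qed.

Lemma Cmod_opp_inv (w : C) : w <> RtoC 0 -> Cmod (- / w)%C = / Cmod w.
Proof. intros H. rewrite Cmod_opp. now apply Cmod_inv. Qed.

(** After multiplication by [Cmod Z], the condition says that [r * Z] is closer to 1 than to 0,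
    which describes a half-plane. *)
Lemma attracting_petal_inv (r : R) (Z : C) : 0 < r -> Z <> RtoC 0 ->
  (attracting_petal r (- / Z)%C <-> / (2 * r) < fst Z).
Proof.
  intros Hr HZ. assert (Hm : 0 < Cmod Z) by now apply Cmod_gt_0. unfold attracting_petal.
  replace (- / Z + r)%C with ((r * Z - 1) / Z)%C by (field; auto).
  rewrite Cmod_div by assumption.
  transitivity (Cmod (r * Z - 1)%C < Cmod (r * Z)%C).
  { rewrite (Cmod_mult r Z), Cmod_R, Rabs_right by lra. split; intros H.
    - apply Rmult_lt_compat_r with (r := Cmod Z) in H; [|assumption].
      now replace (Cmod (r * Z - 1)%C / Cmod Z * Cmod Z) with (Cmod (r * Z - 1)%C) in H
        by (field; lra).
    - apply Rmult_lt_reg_r with (Cmod Z); [assumption|].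
      now replace (Cmod (r * Z - 1)%C / Cmod Z * Cmod Z) with (Cmod (r * Z - 1)%C)
        by (field; lra). }
  rewrite Cmod_lt_iff_sqr, !Cmod_sqr. destruct Z as [x y]. simpl.
  split; intros H.
  - apply Rmult_lt_reg_r with (2 * r); [lra|]. rewrite Rinv_l by lra. nra.
  - apply Rmult_lt_compat_r with (r := 2 * r) in H; [|lra]. rewrite Rinv_l in H by lra. nra.
Qed.

Lemma repelling_petal_inv (r : R) (Z : C) : 0 < r -> Z <> RtoC 0 ->
  (repelling_petal r (- / Z)%C <-> fst Z < - / (2 * r)).
Proof.
  intros Hr HZ.
  assert (HZ' : (- Z)%C <> RtoC 0).
  { intros E. apply HZ. replace Z with (- - Z)%C by ring. rewrite E. ring. }
  assert (H := attracting_petal_inv r (- Z) Hr HZ').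
  unfold attracting_petal in H. unfold repelling_petal.
  replace (- / Z - r)%C with (- (- / - Z + r))%C by (field; auto).
  rewrite Cmod_opp, H. destruct Z; simpl. split; lra.
Qed.

Lemma attracting_petal_neq0 (r : R) (w : C) : attracting_petal r w -> w <> RtoC 0.
Proof.
  unfold attracting_petal. intros H ->. rewrite Cplus_0_l, Cmod_R in H.
  assert (T := Rle_abs r). lra.
Qed.

(** With [w = -1/Z] the difference equals [(f w - w - w * f w) / (w * f w)]. The terms of order two
    cancel in the numerator, while the denominator has order two. *)
Lemma inv_coordinate_step (f : C -> C) (a : C) : parabolic_expansion f a ->
  exists K rho : R, 0 <= K /\ 0 < rho /\ forall Z : C, rho < Cmod Z ->
    f (- / Z)%C <> RtoC 0 /\ Cmod (- / f (- / Z) - (Z + 1))%C <= K / Cmod Z.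
Proof.
  intros (K0 & d & Hd & H).
  set (L := Rabs K0). set (A := Cmod a).
  assert (HL : 0 <= L) by apply Rabs_pos. assert (HA : 0 <= A) by apply Cmod_ge_0.
  (* The radius makes [|w| (1 + A + L) < 1/2] for [w = -1/Z], hence [|f w| >= |w| / 2]; this is the
     origin of the factor 2 in the constant. *)
  exists (2 * (A + 1 + 2 * L + A)), (/ d + 2 * (1 + A + L)).
  assert (Hdi : 0 < / d) by now apply Rinv_0_lt_compat.
  split; [lra|]. split; [lra|]. intros Z HZ.
  assert (HZ0 : Z <> RtoC 0) by (apply Cmod_gt_0; lra).
  set (w := (- / Z)%C).
  assert (Hw0 : w <> RtoC 0) by now apply opp_inv_neq0.
  assert (EZ : Z = (- / w)%C) by (symmetry; now apply opp_inv_invol).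
  set (t := Cmod w). assert (Ht0 : 0 < t) by now apply Cmod_gt_0.
  assert (Et : Cmod Z = / t) by (rewrite EZ; now apply Cmod_opp_inv).
  assert (Ht1 : t * (/ d + 2 * (1 + A + L)) < 1).
  { rewrite Et in HZ. apply Rmult_lt_compat_l with (r := t) in HZ; [|lra].
    rewrite Rinv_r in HZ by lra. exact HZ. }
  assert (Htd : t < d).
  { apply Rmult_lt_reg_r with (/ d); [assumption|]. rewrite (Rinv_r d) by lra. nra. }
  assert (Ht2 : t * (1 + A + L) < 1 / 2) by nra.
  assert (Ht3 : t <= 1 / 2) by nra.
  specialize (H w Htd). fold t in H.
  set (E := (f w - (w + w ^ 2 + a * w ^ 3))%C) in H.
  assert (HE : Cmod E <= L * t ^ 4).
  { eapply Rle_trans; [exact H|]. apply Rmult_le_compat_r; [apply pow_le; lra|apply Rle_abs]. }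
  assert (Ef : f w = (w + w ^ 2 + a * w ^ 3 + E)%C) by (unfold E; ring).
  assert (Bw : Cmod w <= t) by apply Rle_refl.
  assert (Ba : Cmod a <= A) by apply Rle_refl.
  assert (Hf : t / 2 <= Cmod (f w)).
  { assert (T := Cmod_add_ge w (w ^ 2 + a * w ^ 3 + E)). fold t in T.
    assert (T2 : Cmod (w ^ 2 + a * w ^ 3 + E)%C <= t ^ 2 + A * t ^ 3 + L * t ^ 4) by cbound.
    replace (w + (w ^ 2 + a * w ^ 3 + E))%C with (f w) in T by (rewrite Ef; ring).
    assert (t ^ 2 + A * t ^ 3 + L * t ^ 4 <= t * (t * (1 + A + L))).
    { replace (t ^ 2 + A * t ^ 3 + L * t ^ 4) with (t * (t * (1 + A * t + L * t ^ 2))) by ring.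
      do 2 (apply Rmult_le_compat_l; [lra|]). assert (t ^ 2 <= 1) by nra. nra. }
    nra. }
  assert (Hf0 : f w <> RtoC 0) by (apply Cmod_gt_0; lra).
  split; [exact Hf0|].
  replace (- / f w - (Z + 1))%C with (((a - 1) * w ^ 3 + E - a * w ^ 4 - w * E) / (w * f w))%C.
  2: { replace ((a - 1) * w ^ 3 + E - a * w ^ 4 - w * E)%C with (f w - w - w * f w)%C
         by (rewrite Ef; ring).
       rewrite EZ. field. split; assumption. }
  eapply Rle_trans.
  { apply Cmod_div_le with (b := t * (t / 2)).
    - nra.
    - assert (B1 : Cmod (RtoC 1) <= 1) by (rewrite Cmod_1; lra). cbound.
    - rewrite Cmod_mult. fold t. nra. }
  rewrite Et. unfold Rdiv. rewrite Rinv_inv.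
  apply Rmult_le_reg_r with (t * (t * / 2)); [nra|].
  rewrite Rmult_assoc, Rinv_l by nra. rewrite Rmult_1_r.
  replace (2 * (A + 1 + 2 * L + A) * t * (t * (t * / 2))) with (t ^ 3 * (A + 1 + 2 * L + A)) by field.
  replace ((A + 1) * t ^ 3 + L * t ^ 4 + A * t ^ 4 + t * (L * t ^ 4)) with
    (t ^ 3 * (A + 1 + L * t + A * t + L * t ^ 2)) by ring.
  apply Rmult_le_compat_l; [apply pow_le; lra|].
  assert (t ^ 2 <= 1) by nra. nra.
Qed.

(** * One perturbed step in the Moebius coordinate *)

Lemma one_minus_ge (z : C) (b : R) : Cmod z <= b -> 1 - b <= Cmod (1 - z)%C.
Proof. intros H. assert (T := Cmod_sub_ge 1 z). rewrite Cmod_1 in T. lra. Qed.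

Lemma Cneq0_of_ge (z : C) (b : R) : 0 < b -> b <= Cmod z -> z <> RtoC 0.
Proof. intros. apply Cmod_gt_0. lra. Qed.

(** The addition theorem of the tangent: if [c = e tan(theta)] and [e u = tan(delta)], this is
    [e tan(theta + delta)]. It inverts [u = (w - c) / (w c + e^2)]. The flow of [w' = w^2 + e^2]
    advances the angles of [w] and [c] equally and so leaves [delta] fixed. *)
Definition mobius (c e u : C) : C := ((c + e ^ 2 * u) / (1 - c * u))%C.

(** Everything follows from [mobius c e u - c = u x^2 / (1 - c u)]. *)
Lemma mobius_bounds (c e u : C) (x : R) :
  0 < x -> Cmod c <= x -> (c ^ 2 + e ^ 2)%C = (RtoC x ^ 2)%C -> (1 + Cmod u) * x <= 1 / 8 ->
  1 / 2 <= Cmod (1 - c * u)%C /\ Cmod (mobius c e u - c)%C <= 2 * (1 + Cmod u) * x ^ 2 /\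
  Cmod (mobius c e u) <= 2 * x.
Proof.
  intros Hx Hc Hq Ht. assert (Hu := Cmod_ge_0 u).
  assert (Bu : Cmod u <= Cmod u) by apply Rle_refl.
  assert (Bcu : Cmod (c * u)%C <= x * Cmod u) by cbound.
  assert (H1 : 1 / 2 <= Cmod (1 - c * u)%C).
  { eapply Rle_trans; [|apply one_minus_ge, Bcu]. nra. }
  assert (N1 : (1 - c * u)%C <> RtoC 0) by (eapply Cneq0_of_ge; [|exact H1]; lra).
  assert (H2 : Cmod (mobius c e u - c)%C <= 2 * (1 + Cmod u) * x ^ 2).
  { replace (mobius c e u - c)%C with (u * (RtoC x ^ 2) / (1 - c * u))%C.
    - assert (Bx : Cmod (RtoC x) <= x) by (rewrite Cmod_R, Rabs_right; lra).
      eapply Rle_trans; [apply Cmod_div_le with (b := 1 / 2); [lra|cbound|exact H1]|].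
      assert (0 <= x ^ 2) by nra. unfold Rdiv. nra.
    - rewrite <- Hq. unfold mobius. field. exact N1. }
  split; [exact H1|]. split; [exact H2|].
  replace (mobius c e u) with (mobius c e u - c + c)%C by ring.
  eapply Rle_trans; [apply Cmod_add_le; [exact H2|exact Hc]|]. nra.
Qed.

(** The map [w -> (w + e^2 tau) / (1 - w tau)] takes [c] to [c'] and [mobius c e u] to
    [mobius c' e u], since the maps of this family commute. The true image differs from the latter
    by some [g] of order [x^3], and moving a point by [g] moves its coordinate by about [g / x^2],
    because [mobius c e] has derivative [c^2 + e^2 = x^2] at 0. *)
Lemma mobius_step (a : C) (Kf B : R) : 0 <= Kf -> 0 <= B ->
  exists K delta : R, 0 <= K /\ 0 < delta <= 1 / 8 /\
  forall (c e tau c' u rho kappa : C) (x : R),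
    0 < x -> Cmod c <= x -> Cmod e <= x -> (c ^ 2 + e ^ 2)%C = (RtoC x ^ 2)%C ->
    Cmod (1 - tau)%C <= x ^ 2 -> (c' * (1 - c * tau))%C = (c + e ^ 2 * tau)%C ->
    (1 + Cmod u) * x <= delta ->
    let w := mobius c e u in
    Cmod rho <= Kf * Cmod w ^ 4 -> Cmod kappa <= B * x ^ 3 ->
    exists u' : C, (w + w ^ 2 + a * w ^ 3 + rho + e ^ 2 + kappa)%C = mobius c' e u' /\
      Cmod (u' - u - ((a - 1) * c - a * c * (e ^ 2 / RtoC x ^ 2) + kappa / RtoC x ^ 2))%C
        <= K * (1 + Cmod u) * x ^ 2.
Proof.
  intros HKf HB. set (A := Cmod a). assert (HA : 0 <= A) by apply Cmod_ge_0.
  set (Kn := 25 + 40 * A).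
  set (Kg := 8 * Kn + 31 + 46 * A + 16 * Kf).
  set (K0 := A + 2 + B). set (K1 := K0 + Kg).
  assert (HKn : 0 <= Kn) by (unfold Kn; lra).
  assert (HKg : 0 <= Kg) by (unfold Kg; lra).
  assert (HK0 : 0 <= K0) by (unfold K0; lra).
  assert (HK1 : 0 <= K1) by (unfold K1; lra).
  (* The first constant comes from splitting the error as [(g - g0) * D + g0 * (D - 1/x^2)], with
     [|D| <= 8 / x^2] and [|D - 1/x^2| <= 2 (72 + 8 K1) t / x]. The second makes
     [(48 + 8 K1) x <= 1/2], which keeps the denominator [den] above [x^2 / 2]. *)
  exists (Kg * 8 + K0 * (2 * (72 + 8 * K1))), (/ (2 * (48 + 8 * K1))).
  split.
  { apply Rplus_le_le_0_compat; [lra|]. apply Rmult_le_pos; lra. }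
  assert (Hdel : 0 < / (2 * (48 + 8 * K1))) by (apply Rinv_0_lt_compat; lra).
  assert (Hdel' : / (2 * (48 + 8 * K1)) <= / 96) by (apply Rinv_le_contravar; lra).
  split; [split; lra|].
  intros c e tau c' u rho kappa x Hx Bc Be Hq Btau Hc' Ht w Brho Bkappa.
  set (t := 1 + Cmod u). fold t in Ht. assert (Hu := Cmod_ge_0 u).
  assert (Ht1 : 1 <= t) by (unfold t; lra).
  assert (Htx : t * x <= / 96) by lra.
  assert (Hxd : x <= / (2 * (48 + 8 * K1))) by nra.
  assert (Hx1 : x <= / 96) by lra.
  assert (Hden0 : (48 + 8 * K1) * x <= 1 / 2).
  { apply Rmult_le_compat_l with (r := 2 * (48 + 8 * K1)) in Hxd; [|lra].
    rewrite Rinv_r in Hxd by lra. lra. }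
  destruct (mobius_bounds c e u x Hx Bc Hq) as (D1 & Bwc & Bw); [fold t; lra|].
  fold w in Bwc, Bw. fold t in Bwc.
  assert (N1 : (1 - c * u)%C <> RtoC 0) by (eapply Cneq0_of_ge; [|exact D1]; lra).
  assert (Ew : w = ((c + e ^ 2 * u) / (1 - c * u))%C) by reflexivity.
  clearbody w.
  assert (Ba : Cmod a <= A) by apply Rle_refl.
  assert (B1 : Cmod (RtoC 1) <= 1) by (rewrite Cmod_1; lra).
  assert (B2 : Cmod (RtoC 2) <= 2) by (rewrite Cmod_R, Rabs_right; lra).
  assert (Bx : Cmod (RtoC x) <= x) by (rewrite Cmod_R, Rabs_right; lra).
  assert (Bu : Cmod u <= t) by (unfold t; lra).
  assert (Hx2 : x ^ 2 <= x) by nra.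
  assert (Hx0 : 0 <= x ^ 2) by nra.
  assert (Hx3 : 0 <= x ^ 3) by (apply pow_le; lra).
  assert (Hx4 : 0 <= x ^ 4) by (apply pow_le; lra).
  assert (Hx54 : x ^ 5 <= x ^ 4) by (replace (x ^ 5) with (x ^ 4 * x) by ring; nra).
  assert (Hx43 : x ^ 4 <= x ^ 3) by (replace (x ^ 4) with (x ^ 3 * x) by ring; nra).
  assert (Htau : Cmod tau <= 2).
  { replace tau with (1 - (1 - tau))%C by ring. eapply Rle_trans; [cbound|]. nra. }
  assert (D2 : 1 / 2 <= Cmod (1 - c * tau)%C).
  { eapply Rle_trans; [|apply one_minus_ge; cbound]. lra. }
  assert (N2 : (1 - c * tau)%C <> RtoC 0) by (eapply Cneq0_of_ge; [|exact D2]; lra).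
  assert (D3 : 1 / 2 <= Cmod (1 - w * tau)%C).
  { eapply Rle_trans; [|apply one_minus_ge; cbound]. lra. }
  assert (N3 : (1 - w * tau)%C <> RtoC 0) by (eapply Cneq0_of_ge; [|exact D3]; lra).
  assert (Ec' : c' = ((c + e ^ 2 * tau) / (1 - c * tau))%C).
  { rewrite <- Hc'. field. exact N2. }
  assert (Bc' : Cmod c' <= 4 * x).
  { rewrite Ec'. eapply Rle_trans; [apply Cmod_div_le with (b := 1 / 2); [lra|cbound|exact D2]|].
    nra. }
  assert (Bc'u : Cmod (c' * u)%C <= 4 * x * t) by cbound.
  assert (D4 : 1 / 2 <= Cmod (1 - c' * u)%C).
  { eapply Rle_trans; [|apply one_minus_ge; exact Bc'u]. nra. }
  assert (N4 : (1 - c' * u)%C <> RtoC 0) by (eapply Cneq0_of_ge; [|exact D4]; lra).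
  (* [num / (1 - w * tau)] is [w + w^2 + a w^3 + e^2] minus [(w + e^2 tau) / (1 - w tau)]. *)
  set (num := ((1 - tau) * (w ^ 2 + e ^ 2) + (a - tau) * w ^ 3
                - a * tau * w ^ 4 - e ^ 2 * w * tau)%C).
  set (g := (num / (1 - w * tau) + rho + kappa)%C).
  (* The leading part of [g]: set [tau = 1], replace [w] by [c] and keep the terms of order
     three. *)
  set (g0 := ((a - 1) * c ^ 3 - e ^ 2 * c + kappa)%C).
  assert (Bnum : Cmod num <= Kn * x ^ 3).
  { unfold num. eapply Rle_trans; [cbound|]. unfold Kn.
    replace (x ^ 2 * ((2 * x) ^ 2 + x ^ 2) + (A + 2) * (2 * x) ^ 3 + A * 2 * (2 * x) ^ 4
      + x ^ 2 * (2 * x) * 2) with (5 * x ^ 4 + (A + 2) * 8 * x ^ 3 + 32 * (A * x ^ 4) + 4 * x ^ 3)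
      by ring.
    assert (A * x ^ 4 <= A * x ^ 3) by (apply Rmult_le_compat_l; lra). nra. }
  assert (BA4 : A * x ^ 5 <= A * x ^ 4) by (apply Rmult_le_compat_l; lra).
  assert (Bg : Cmod (g - g0)%C <= Kg * t * x ^ 4).
  { set (r1 := (num * (w * tau) / (1 - w * tau))%C).
    set (r2 := ((1 - tau) * (w ^ 2 + e ^ 2) + (1 - tau) * w ^ 3 - a * tau * w ^ 4
                 + (1 - tau) * e ^ 2 * w)%C).
    set (r3 := ((w - c) * ((a - 1) * (w ^ 2 + w * c + c ^ 2) - e ^ 2))%C).
    replace (g - g0)%C with (r1 + r2 + r3 + rho)%C
      by (unfold g, g0, r1, r2, r3, num; field; exact N3).
    assert (R1 : Cmod r1 <= 8 * Kn * x ^ 4).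
    { unfold r1. eapply Rle_trans; [apply Cmod_div_le with (b := 1 / 2); [lra|cbound|exact D3]|].
      right. field. }
    assert (R2 : Cmod r2 <= (15 + 32 * A) * x ^ 4).
    { unfold r2. eapply Rle_trans; [cbound|]. nra. }
    (* Replacing [w] by [c] costs [|w - c| <= 2 t x^2]; hence the factor [t = 1 + |u|]. *)
    assert (R3 : Cmod r3 <= (14 * A + 16) * t * x ^ 4).
    { unfold r3. eapply Rle_trans; [cbound|]. right. ring. }
    assert (R4 : Cmod rho <= 16 * Kf * x ^ 4).
    { eapply Rle_trans; [exact Brho|].
      assert (P := pow_incr (Cmod w) (2 * x) 4 (conj (Cmod_ge_0 w) Bw)).
      replace (16 * Kf * x ^ 4) with (Kf * (2 * x) ^ 4) by ring.
      now apply Rmult_le_compat_l. }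
    eapply Rle_trans; [cbound|]. unfold Kg.
    assert (T : forall k, 0 <= k -> k * x ^ 4 <= k * t * x ^ 4).
    { intros k Hk. assert (0 <= k * x ^ 4) by nra. nra. }
    assert (T1 := T (8 * Kn) ltac:(lra)). assert (T2 := T (15 + 32 * A) ltac:(lra)).
    assert (T3 := T (16 * Kf) ltac:(lra)). lra. }
  assert (Bg0 : Cmod g0 <= K0 * x ^ 3).
  { unfold g0, K0. eapply Rle_trans; [cbound|]. right. ring. }
  assert (Bgg : Cmod g <= K1 * x ^ 3).
  { replace g with (g - g0 + g0)%C by ring. eapply Rle_trans; [cbound|]. unfold K1.
    replace (Kg * t * x ^ 4) with (Kg * x ^ 3 * (t * x)) by ring.
    assert (0 <= Kg * x ^ 3) by (apply Rmult_le_pos; lra). nra. }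
  set (q' := (c' ^ 2 + e ^ 2)%C).
  assert (Eq' : (q' - RtoC x ^ 2)%C =
    (RtoC x ^ 2 * (e ^ 2 * tau ^ 2 + 2 * (c * tau) - c ^ 2 * tau ^ 2) / (1 - c * tau) ^ 2)%C).
  { unfold q'. rewrite Ec', <- Hq. field. exact N2. }
  assert (Bq' : Cmod (q' - RtoC x ^ 2)%C <= 48 * x ^ 3).
  { rewrite Eq'.
    eapply Rle_trans; [apply Cmod_div_le with (b := 1 / 4); [lra|cbound|]|].
    - rewrite Cmod_pow. nra.
    - assert (8 * x ^ 4 <= 8 * x ^ 3) by lra. nra. }
  set (den := (q' + g * c' * (1 - c' * u))%C).
  assert (Bden : Cmod (den - RtoC x ^ 2)%C <= (48 + 8 * K1) * x ^ 3).
  { replace (den - RtoC x ^ 2)%C with (q' - RtoC x ^ 2 + g * c' * (1 - c' * u))%C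
      by (unfold den; ring).
    eapply Rle_trans; [cbound|].
    assert (4 * x * t <= 1) by nra.
    assert (0 <= K1 * x ^ 3) by (apply Rmult_le_pos; lra).
    assert (K1 * x ^ 3 * (4 * x) * (1 + 4 * x * t) <= K1 * x ^ 3 * 8).
    { rewrite !Rmult_assoc. rewrite <- !(Rmult_assoc K1). apply Rmult_le_compat_l; [assumption|].
      nra. }
    lra. }
  assert (Dden : x ^ 2 / 2 <= Cmod den).
  { assert (T := Cmod_sub_ge (RtoC x ^ 2) (RtoC x ^ 2 - den)).
    rewrite (Cmod_minus_sym (RtoC x ^ 2) den), Cmod_pow, Cmod_R, Rabs_right in T by lra.
    replace (RtoC x ^ 2 - (RtoC x ^ 2 - den))%C with den in T by ring.
    assert ((48 + 8 * K1) * x ^ 3 <= x ^ 2 / 2).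
    { replace ((48 + 8 * K1) * x ^ 3) with ((48 + 8 * K1) * x * x ^ 2) by ring. nra. }
    lra. }
  assert (Hx2p : 0 < x ^ 2) by nra.
  assert (Nden : den <> RtoC 0) by (eapply Cneq0_of_ge; [|exact Dden]; lra).
  assert (Nx : RtoC x <> RtoC 0) by (intros E; injection E; lra).
  assert (Nq' : q' <> RtoC 0).
  { apply Cmod_gt_0. assert (T := Cmod_sub_ge (RtoC x ^ 2) (RtoC x ^ 2 - q')).
    rewrite (Cmod_minus_sym (RtoC x ^ 2) q'), Cmod_pow, Cmod_R, Rabs_right in T by lra.
    replace (RtoC x ^ 2 - (RtoC x ^ 2 - q'))%C with q' in T by ring. nra. }
  (* [u' = u + g * D] is the exact solution of [mobius c' e u' = mobius c' e u + g]. For [g = 0],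
     [D] is the reciprocal of the derivative of [mobius c' e] at [u]. *)
  set (D := ((1 - c' * u) ^ 2 / den)%C).
  exists (u + g * D)%C. split.
  - (* [mobius c' e u] is the image of [w] under the exact time-one flow *)
    assert (Ephi : mobius c' e u = ((w + e ^ 2 * tau) / (1 - w * tau))%C).
    { unfold mobius.
      assert (N3' : (1 - c * u - (c + e ^ 2 * u) * tau)%C <> RtoC 0).
      { intros E. apply N3. rewrite Ew.
        replace (1 - (c + e ^ 2 * u) / (1 - c * u) * tau)%C with
          ((1 - c * u - (c + e ^ 2 * u) * tau) / (1 - c * u))%C by (field; exact N1).
        rewrite E. unfold Cdiv. ring. }
      assert (N4' : (1 - c * tau - (c + e ^ 2 * tau) * u)%C <> RtoC 0).
      { replace (1 - c * tau - (c + e ^ 2 * tau) * u)%C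
          with (1 - c * u - (c + e ^ 2 * u) * tau)%C by ring. exact N3'. }
      rewrite Ec', Ew. field. repeat split; assumption. }
    assert (Elhs : (w + w ^ 2 + a * w ^ 3 + rho + e ^ 2 + kappa)%C = (mobius c' e u + g)%C).
    { rewrite Ephi. unfold g, num. field. exact N3. }
    rewrite Elhs. unfold mobius.
    assert (E1 : (1 - c' * (u + g * D))%C = ((1 - c' * u) * q' / den)%C).
    { unfold D. unfold den. field. exact Nden. }
    rewrite E1.
    assert (E2 : (c' + e ^ 2 * (u + g * D))%C =
      ((c' + e ^ 2 * u + g * (1 - c' * u)) * q' / den)%C).
    { unfold D.
      replace (c' + e ^ 2 * (u + g * ((1 - c' * u) ^ 2 / den)))%C with
        (((c' + e ^ 2 * u) * den + e ^ 2 * g * (1 - c' * u) ^ 2) / den)%C by (field; exact Nden).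
      unfold Cdiv. f_equal. unfold den, q'. ring. }
    rewrite E2. field. repeat split; assumption.
  - replace (u + g * D - u - ((a - 1) * c - a * c * (e ^ 2 / RtoC x ^ 2) + kappa / RtoC x ^ 2))%C
      with ((g - g0) * D + g0 * (D - / RtoC x ^ 2))%C.
    2: { replace ((a - 1) * c - a * c * (e ^ 2 / RtoC x ^ 2) + kappa / RtoC x ^ 2)%C
           with (g0 / RtoC x ^ 2)%C.
         - unfold Cdiv. ring.
         - unfold g0.
           replace (e ^ 2)%C with (RtoC x ^ 2 - c ^ 2)%C by (rewrite <- Hq; ring).
           field. exact Nx. }
    assert (BD : Cmod D <= 8 / x ^ 2).
    { unfold D. eapply Rle_trans; [apply Cmod_div_le with (b := x ^ 2 / 2); [lra|cbound|exact Dden]|].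
      replace (8 / x ^ 2) with (4 / (x ^ 2 / 2)) by (field; lra).
      apply Rmult_le_compat_r; [apply Rlt_le, Rinv_0_lt_compat; lra|].
      assert (4 * x * t <= 1) by nra. assert (0 <= 4 * x * t) by nra. nra. }
    assert (BD2 : Cmod (D - / RtoC x ^ 2)%C <= 2 * (72 + 8 * K1) * t / x).
    { replace (D - / RtoC x ^ 2)%C with
        ((RtoC x ^ 2 * ((c' * u) ^ 2 - 2 * (c' * u)) - (den - RtoC x ^ 2)) / (den * RtoC x ^ 2))%C.
      2: { unfold D. field. split; assumption. }
      eapply Rle_trans; [apply Cmod_div_le with (b := x ^ 2 / 2 * x ^ 2); [nra|cbound|]|].
      - rewrite Cmod_mult, Cmod_pow, Cmod_R, Rabs_right by lra. nra.
      - apply Rle_div_l; [nra|].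
        replace (2 * (72 + 8 * K1) * t / x * (x ^ 2 / 2 * x ^ 2)) with
          ((72 + 8 * K1) * t * x ^ 3) by (field; lra).
        replace (x ^ 2 * ((4 * x * t) ^ 2 + 2 * (4 * x * t))) with
          (8 * t * x ^ 3 * (2 * (t * x) + 1)) by ring.
        assert (0 <= 8 * t * x ^ 3) by nra.
        assert (8 * t * x ^ 3 * (2 * (t * x) + 1) <= 8 * t * x ^ 3 * 2)
          by (apply Rmult_le_compat_l; lra).
        assert (0 <= (48 + 8 * K1) * x ^ 3) by (apply Rmult_le_pos; lra). nra. }
    eapply Rle_trans; [cbound|]. fold t. right. field. lra.
Qed.

(** * The reference orbit and the potential *)

Definition step_eps (n : nat) : R := PI / INR n.
Definition ref_angle (n k : nat) : R := step_eps n * INR k.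
Definition ref_sin (n k : nat) : R := sin (ref_angle n k).
Definition ref_size (n k : nat) : R := step_eps n / ref_sin n k.
(* [ref_point n 1, ..., ref_point n (n - 1)] is an orbit of the time-one map of the flow of
   [w' = w^2 + eps^2], [eps = PI / n]. *)
Definition ref_point (n k : nat) : R := - (step_eps n * cos (ref_angle n k) / ref_sin n k).

Lemma INR_ge_1 (n : nat) : (1 <= n)%nat -> 1 <= INR n.
Proof. intros H. apply le_INR in H. exact H. Qed.

Lemma step_eps_pos (n : nat) : (1 <= n)%nat -> 0 < step_eps n.
Proof.
  intros H. apply INR_ge_1 in H. apply Rdiv_lt_0_compat; [apply PI_RGT_0|lra].
Qed.

Lemma step_eps_ge (n : nat) : (1 <= n)%nat -> / INR n <= step_eps n.
Proof.
  intros H. apply INR_ge_1 in H. assert (T := PI2_3_2). unfold step_eps, Rdiv.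
  assert (0 < / INR n) by (apply Rinv_0_lt_compat; lra). nra.
Qed.

Lemma step_eps_le (n : nat) : (1 <= n)%nat -> step_eps n <= 4 / INR n.
Proof.
  intros H. apply INR_ge_1 in H. assert (T := PI_4). unfold step_eps, Rdiv.
  assert (0 < / INR n) by (apply Rinv_0_lt_compat; lra). nra.
Qed.

Lemma step_eps_mult (n : nat) : (1 <= n)%nat -> step_eps n * INR n = PI.
Proof. intros H. apply INR_ge_1 in H. unfold step_eps. field. lra. Qed.

Lemma ref_sin_sym (n k : nat) : (k <= n)%nat -> (1 <= n)%nat -> ref_sin n (n - k) = ref_sin n k.
Proof.
  intros Hk Hn. unfold ref_sin, ref_angle. rewrite minus_INR by assumption.
  rewrite Rmult_minus_distr_l, step_eps_mult by assumption. apply sin_PI_x.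
Qed.

Lemma ref_size_sym (n k : nat) : (k <= n)%nat -> (1 <= n)%nat -> ref_size n (n - k) = ref_size n k.
Proof. intros. unfold ref_size. now rewrite ref_sin_sym. Qed.

Lemma sin_ge_cubic (x : R) : 0 <= x <= 2 -> x - x ^ 3 / 6 <= sin x.
Proof.
  intros Hx. assert (T := PI2_3_2).
  destruct (SIN x ltac:(lra) ltac:(lra)) as [H _].
  eapply Rle_trans; [|exact H]. unfold sin_lb, sin_approx, sin_term. simpl.
  assert (0 <= x ^ 5) by (apply pow_le; lra).
  assert (x ^ 2 <= 4) by nra.
  assert (x ^ 7 = x ^ 5 * x ^ 2) by ring.
  replace (x * (x * (x * 1)))%R with (x ^ 3) by ring.
  match goal with |- _ <= ?r =>
    replace r with (x - x ^ 3 / 6 + x ^ 5 / 120 - x ^ 7 / 5040) by field end.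
  nra.
Qed.

Lemma sin_ge_third (x : R) : 0 <= x <= 2 -> x / 3 <= sin x.
Proof. intros Hx. assert (H := sin_ge_cubic x Hx). assert (x ^ 2 <= 4) by nra. nra. Qed.

Lemma sin_le_self (x : R) : 0 <= x -> sin x <= x.
Proof.
  intros [H|<-]; [apply Rlt_le, sin_lt_x, H|rewrite sin_0; lra].
Qed.

Lemma cos_ge_quadratic (x : R) : 0 <= x <= 2 -> 1 - x ^ 2 / 2 <= cos x.
Proof.
  intros Hx. replace x with (2 * (x / 2)) at 2 by field. rewrite cos_2a_sin.
  assert (H1 := sin_le_self (x / 2) ltac:(lra)).
  assert (H2 := sin_ge_third (x / 2) ltac:(lra)). nra.
Qed.

(** [j] is a lower bound for the distance of [k] to the nearer end, 0 or [n]. Up to [n / 2] the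
    angle stays where [sin x >= x / 3]; the other half follows by [k -> n - k]. *)
Lemma ref_sin_ge (n k j : nat) : (1 <= j)%nat -> (j <= k)%nat -> (j + k <= n)%nat ->
  step_eps n * INR j / 3 <= ref_sin n k.
Proof.
  intros Hj Hk Hn.
  assert (half : forall i, (1 <= i)%nat -> (j <= i)%nat -> (2 * i <= n)%nat ->
            step_eps n * INR j / 3 <= ref_sin n i).
  { intros i Hi Hji Hin. assert (He := step_eps_pos n ltac:(lia)).
    assert (Hm := step_eps_mult n ltac:(lia)). apply le_INR in Hin, Hji.
    rewrite mult_INR in Hin. simpl in Hin. assert (T := PI_4). assert (T2 := pos_INR i).
    unfold ref_sin, ref_angle.
    eapply Rle_trans; [|apply sin_ge_third; split; nra]. nra. }
  destruct (Nat.le_gt_cases (2 * k) n) as [H|H].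
  - apply half; lia.
  - rewrite <- (ref_sin_sym n k) by lia. apply half; lia.
Qed.

Lemma ref_sin_pos (n k : nat) : (1 <= k)%nat -> (k + 1 <= n)%nat -> 0 < ref_sin n k.
Proof.
  intros H1 H2. eapply Rlt_le_trans; [|apply (ref_sin_ge n k 1); lia].
  assert (T := step_eps_pos n ltac:(lia)). simpl. lra.
Qed.

Lemma ref_size_pos (n k : nat) : (1 <= k)%nat -> (k + 1 <= n)%nat -> 0 < ref_size n k.
Proof.
  intros. apply Rdiv_lt_0_compat; [apply step_eps_pos; lia|now apply ref_sin_pos].
Qed.

Lemma ref_size_le (n k j : nat) : (1 <= j)%nat -> (j <= k)%nat -> (j + k <= n)%nat ->
  ref_size n k <= 3 / INR j.
Proof.
  intros H1 H2 H3. assert (H := ref_sin_ge n k j H1 H2 H3).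
  assert (Hs := ref_sin_pos n k ltac:(lia) ltac:(lia)).
  apply INR_ge_1 in H1. unfold ref_size.
  apply Rle_div_l; [assumption|].
  apply Rmult_le_reg_r with (INR j / 3); [lra|].
  replace (3 / INR j * ref_sin n k * (INR j / 3)) with (ref_sin n k) by (field; lra). lra.
Qed.

Lemma ref_size_ge (n k : nat) : (1 <= k)%nat -> (k + 1 <= n)%nat -> / INR k <= ref_size n k.
Proof.
  intros H1 H2. assert (Hs := ref_sin_pos n k H1 H2).
  assert (He := step_eps_pos n ltac:(lia)). apply INR_ge_1 in H1.
  assert (Hl : ref_sin n k <= step_eps n * INR k) by (apply sin_le_self; nra).
  unfold ref_size. apply Rle_div_r; [assumption|].
  apply Rmult_le_reg_l with (INR k); [lra|].
  replace (INR k * (/ INR k * ref_sin n k)) with (ref_sin n k) by (field; lra). lra.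
Qed.

Lemma ref_point_sqr (n k : nat) : (1 <= k)%nat -> (k + 1 <= n)%nat ->
  ref_point n k ^ 2 + step_eps n ^ 2 = ref_size n k ^ 2.
Proof.
  intros H1 H2. assert (Hs := ref_sin_pos n k H1 H2).
  assert (T := sin2_cos2 (ref_angle n k)). unfold Rsqr in T.
  unfold ref_point, ref_size. unfold ref_sin in *.
  set (s := sin (ref_angle n k)) in *. set (c := cos (ref_angle n k)) in *.
  replace ((step_eps n / s) ^ 2) with (step_eps n ^ 2 * (s * s + c * c) / s ^ 2)
    by (rewrite T; field; lra).
  field. lra.
Qed.

Lemma ref_point_abs_le (n k : nat) : (1 <= k)%nat -> (k + 1 <= n)%nat ->
  Rabs (ref_point n k) <= ref_size n k.
Proof.
  intros H1 H2. assert (H := ref_point_sqr n k H1 H2). assert (Hp := ref_size_pos n k H1 H2).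
  apply Rabs_le. assert (0 <= step_eps n ^ 2) by apply pow2_ge_0. split; nra.
Qed.

Lemma step_eps_le_ref_size (n k : nat) : (1 <= k)%nat -> (k + 1 <= n)%nat ->
  step_eps n <= ref_size n k.
Proof.
  intros H1 H2. assert (H := ref_point_sqr n k H1 H2). assert (Hp := ref_size_pos n k H1 H2).
  assert (0 <= ref_point n k ^ 2) by apply pow2_ge_0.
  assert (He := step_eps_pos n ltac:(lia)). nra.
Qed.

Lemma ref_angle_S (n k : nat) : ref_angle n (S k) = ref_angle n k + step_eps n.
Proof. unfold ref_angle. rewrite S_INR. ring. Qed.

Lemma step_eps_le_1 (n : nat) : (4 <= n)%nat -> step_eps n <= 1.
Proof.
  intros H. eapply Rle_trans; [apply step_eps_le; lia|]. apply le_INR in H.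
  replace (INR 4) with 4 in H by (simpl; ring). apply Rle_div_l; lra.
Qed.

(** tan(eps) / eps, for which [w -> (w + eps^2 tau) / (1 - w tau)] is the time-one map of the
    flow. *)
Definition flow_tau (n : nat) : R := sin (step_eps n) / (step_eps n * cos (step_eps n)).

Lemma flow_tau_bound (n : nat) : (4 <= n)%nat -> Rabs (1 - flow_tau n) <= step_eps n ^ 2.
Proof.
  intros Hn. assert (He := step_eps_pos n ltac:(lia)). assert (He1 := step_eps_le_1 n Hn).
  unfold flow_tau. set (e := step_eps n) in *.
  assert (S1 := sin_ge_cubic e ltac:(lra)). assert (S2 := sin_le_self e ltac:(lra)).
  assert (C1 := cos_ge_quadratic e ltac:(lra)). assert (C2 := COS_bound e).
  assert (Hc : 1 / 2 <= cos e) by nra.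
  replace (1 - sin e / (e * cos e)) with ((e * cos e - sin e) / (e * cos e)) by (field; lra).
  assert (He3 : 0 < e ^ 3) by (apply pow_lt; lra).
  assert (Hec : 0 < e * cos e) by nra.
  unfold Rdiv. rewrite Rabs_mult, (Rabs_right (/ _)) by (apply Rle_ge, Rlt_le, Rinv_0_lt_compat; lra).
  apply Rle_div_l; [lra|]. apply Rabs_le.
  replace (e ^ 2 * (e * cos e)) with (e ^ 3 * cos e) by ring.
  assert (e * (1 - e ^ 2 / 2) <= e * cos e) by nra.
  assert (e * (1 - e ^ 2 / 2) = e - e ^ 3 / 2) by field.
  assert (e * cos e <= e) by nra. split; nra.
Qed.

(** The addition theorem of the cotangent, cleared of denominators; [4 <= n] keeps [cos eps] away
    from 0. *)
Lemma ref_point_S (n k : nat) : (4 <= n)%nat -> (1 <= k)%nat -> (k + 2 <= n)%nat ->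
  ref_point n (S k) * (1 - ref_point n k * flow_tau n) =
  ref_point n k + step_eps n ^ 2 * flow_tau n.
Proof.
  intros Hn H1 H2. assert (He := step_eps_pos n ltac:(lia)). assert (He1 := step_eps_le_1 n Hn).
  assert (C1 := cos_ge_quadratic (step_eps n) ltac:(lra)).
  assert (Hs := ref_sin_pos n k ltac:(lia) ltac:(lia)).
  assert (Hs' := ref_sin_pos n (S k) ltac:(lia) ltac:(lia)).
  assert (Hc : 1 / 2 <= cos (step_eps n)) by nra.
  unfold ref_point, flow_tau, ref_sin in *. rewrite ref_angle_S in *.
  assert (T := sin2_cos2 (step_eps n)). unfold Rsqr in T.
  rewrite sin_plus, cos_plus in *.
  set (s := sin (ref_angle n k)) in *. set (c := cos (ref_angle n k)) in *.
  set (se := sin (step_eps n)) in *. set (ce := cos (step_eps n)) in *.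
  set (e := step_eps n) in *.
  assert (D1 : s * ce + c * se <> 0) by lra.
  field. repeat split; lra.
Qed.

(** [sin(t + e) / sin t = cos e + cot t sin e], and [e cot t] is minus the reference point [c], so
    this quotient is [1 - c + O(x^2)]; the logarithm of the size changes by minus its logarithm. *)
Lemma ln_ref_size_S (n k : nat) : (4 <= n)%nat -> (1 <= k)%nat -> (k + 2 <= n)%nat ->
  ref_size n k <= 1 / 8 ->
  Rabs (ln (ref_size n (S k)) - ln (ref_size n k) - ref_point n k) <= 9 * ref_size n k ^ 2.
Proof.
  intros Hn H1 H2 Hx. assert (He := step_eps_pos n ltac:(lia)).
  assert (Hs := ref_sin_pos n k ltac:(lia) ltac:(lia)).
  assert (Hs' := ref_sin_pos n (S k) ltac:(lia) ltac:(lia)).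
  assert (Hex := step_eps_le_ref_size n k ltac:(lia) ltac:(lia)).
  assert (Hcx := ref_point_abs_le n k ltac:(lia) ltac:(lia)).
  assert (Hxp := ref_size_pos n k ltac:(lia) ltac:(lia)).
  set (x := ref_size n k) in *. set (c := ref_point n k) in *. set (e := step_eps n) in *.
  set (y := (cos e - 1) - c * (sin e / e)).
  assert (S1 := sin_ge_cubic e ltac:(lra)). assert (S2 := sin_le_self e ltac:(lra)).
  assert (C1 := cos_ge_quadratic e ltac:(lra)). assert (C2 := COS_bound e).
  assert (Ey : ref_sin n (S k) / ref_sin n k = 1 + y).
  { unfold y, c, ref_point. unfold ref_sin in *. rewrite ref_angle_S. fold e.
    rewrite sin_plus. field. split; lra. }
  assert (Hse : - (e ^ 2 / 6) <= sin e / e - 1 <= 0).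
  { replace (sin e / e - 1) with ((sin e - e) / e) by (field; lra). split.
    - apply Rle_div_r; [lra|]. nra.
    - apply Rle_div_l; lra. }
  assert (Hxx : e ^ 2 <= x ^ 2) by nra.
  assert (Hyc : Rabs (y + c) <= x ^ 2).
  { replace (y + c) with ((cos e - 1) + - c * (sin e / e - 1)) by (unfold y; ring).
    eapply Rle_trans; [apply Rabs_triang|]. rewrite Rabs_mult, Rabs_Ropp.
    assert (Rabs (cos e - 1) <= e ^ 2 / 2) by (apply Rabs_le; lra).
    assert (Rabs (sin e / e - 1) <= e ^ 2 / 6) by (apply Rabs_le; lra).
    assert (T := Rmult_le_compat _ _ _ _ (Rabs_pos c) (Rabs_pos (sin e / e - 1)) Hcx H0).
    assert (0 <= e ^ 2) by apply pow2_ge_0. nra. }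
  apply Rabs_le_between in Hcx. apply Rabs_le_between in Hyc.
  assert (Hx2 : x ^ 2 <= x / 8) by nra.
  assert (Hy : Rabs y <= 2 * x) by (apply Rabs_le; lra).
  assert (L := ln_1p_approx y ltac:(lra)).
  assert (Hy2 : y ^ 2 <= 4 * x ^ 2).
  { rewrite <- (pow2_abs y). assert (0 <= Rabs y) by apply Rabs_pos. nra. }
  assert (EL : ln (ref_size n (S k)) - ln x = - ln (1 + y)).
  { rewrite <- Ey. unfold x, ref_size. rewrite !ln_div by assumption. ring. }
  rewrite EL. apply Rabs_le_between in L. apply Rabs_le.
  assert (0 <= x ^ 2) by apply pow2_ge_0. split; lra.
Qed.

(** To first order [sin^2 t] changes by [2 e sin t cos t], which is [-2 c sin^2 t] for
    [c = -e cot t]. *)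
Lemma ref_sin_sqr_S (n k : nat) : (4 <= n)%nat -> (1 <= k)%nat -> (k + 2 <= n)%nat ->
  Rabs (ref_sin n (S k) ^ 2 - ref_sin n k ^ 2 + 2 * (ref_point n k * ref_sin n k ^ 2))
    <= 5 * step_eps n ^ 2.
Proof.
  intros Hn H1 H2. assert (He := step_eps_pos n ltac:(lia)). assert (He1 := step_eps_le_1 n Hn).
  assert (Hs := ref_sin_pos n k ltac:(lia) ltac:(lia)).
  unfold ref_point, ref_sin in *. rewrite ref_angle_S, sin_plus.
  set (e := step_eps n) in *.
  assert (S1 := sin_ge_cubic e ltac:(lra)). assert (S2 := sin_le_self e ltac:(lra)).
  assert (C1 := cos_ge_quadratic e ltac:(lra)). assert (C2 := COS_bound e).
  assert (T := sin2_cos2 e). unfold Rsqr in T.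
  assert (S3 := SIN_bound (ref_angle n k)). assert (C3 := COS_bound (ref_angle n k)).
  set (s := sin (ref_angle n k)) in *. set (c := cos (ref_angle n k)) in *.
  set (se := sin e) in *. set (ce := cos e) in *.
  assert (Hse : 0 <= se) by nra.
  assert (Hse2 : se ^ 2 <= e ^ 2) by nra.
  assert (E : (s * ce + c * se) ^ 2 - s ^ 2 + 2 * (- (e * c / s) * s ^ 2) =
    (c ^ 2 - s ^ 2) * se ^ 2 + 2 * (s * c) * (se * ce - e)).
  { replace (- (e * c / s) * s ^ 2) with (- (e * c * s)) by (field; lra).
    replace ((s * ce + c * se) ^ 2) with (s ^ 2 * (ce * ce) + 2 * (s * c) * (se * ce) + c ^ 2 * se ^ 2)
      by ring.
    replace (ce * ce) with (1 - se * se) by lra. ring. }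
  rewrite E. eapply Rle_trans; [apply Rabs_triang|]. rewrite !Rabs_mult.
  assert (B1 : Rabs (c ^ 2 - s ^ 2) <= 1) by (apply Rabs_le; split; nra).
  assert (B2 : Rabs (se ^ 2) <= e ^ 2) by (rewrite Rabs_right; nra).
  assert (B3 : Rabs 2 = 2) by (apply Rabs_right; lra).
  assert (B4 : Rabs s <= 1) by (apply Rabs_le; lra).
  assert (B5 : Rabs c <= 1) by (apply Rabs_le; lra).
  assert (B6 : Rabs (se * ce - e) <= 2 * e ^ 2).
  { apply Rabs_le. assert (e ^ 3 <= e ^ 2) by nra.
    assert (se * (1 - ce) <= e * (e ^ 2 / 2)) by (apply Rmult_le_compat; lra).
    assert (0 <= se * (1 - ce)) by (apply Rmult_le_pos; lra). split; nra. }
  rewrite B3.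
  assert (Rabs s * Rabs c <= 1).
  { replace 1 with (1 * 1) by ring. apply Rmult_le_compat; auto using Rabs_pos. }
  assert (Rabs (c ^ 2 - s ^ 2) * Rabs (se ^ 2) <= 1 * e ^ 2)
    by (apply Rmult_le_compat; auto using Rabs_pos).
  assert (2 * (Rabs s * Rabs c) * Rabs (se * ce - e) <= 2 * 1 * (2 * e ^ 2)).
  { apply Rmult_le_compat; auto using Rabs_pos; [|lra].
    assert (0 <= Rabs s * Rabs c) by (apply Rmult_le_pos; apply Rabs_pos). lra. }
  lra.
Qed.

(* The increments of [potential] reproduce the cubic terms of the perturbed dynamics; being a
   function of [ref_size] it takes the same value at [m] and [n - m]. *)
Definition potential (a : C) (n k : nat) : C :=
  ((a - 1) * ln (ref_size n k) + a / 2 * ref_sin n k ^ 2)%C.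

Lemma potential_sym (a : C) (n k : nat) : (k <= n)%nat -> (1 <= n)%nat ->
  potential a n (n - k) = potential a n k.
Proof. intros. unfold potential. now rewrite ref_size_sym, ref_sin_sym. Qed.

Lemma potential_S (a : C) (n k : nat) : (4 <= n)%nat -> (1 <= k)%nat -> (k + 2 <= n)%nat ->
  ref_size n k <= 1 / 8 ->
  Cmod (potential a n (S k) - potential a n k -
    ((a - 1) * ref_point n k - a * ref_point n k * (step_eps n ^ 2 / ref_size n k ^ 2)))%C
  <= (9 * (Cmod a + 1) + 5 * Cmod a) * ref_size n k ^ 2.
Proof.
  intros Hn H1 H2 Hx.
  assert (L1 := ln_ref_size_S n k Hn H1 H2 Hx). assert (L2 := ref_sin_sqr_S n k Hn H1 H2).
  assert (He := step_eps_pos n ltac:(lia)).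
  assert (Hs := ref_sin_pos n k ltac:(lia) ltac:(lia)).
  assert (Hex := step_eps_le_ref_size n k ltac:(lia) ltac:(lia)).
  assert (Er : step_eps n ^ 2 / ref_size n k ^ 2 = ref_sin n k ^ 2).
  { unfold ref_size. field. split; lra. }
  assert (Ec : (step_eps n ^ 2 / ref_size n k ^ 2)%C = RtoC (ref_sin n k ^ 2)).
  { rewrite <- Er, <- !RtoC_pow, <- RtoC_div; [reflexivity|].
    apply pow_nonzero. assert (T := ref_size_pos n k ltac:(lia) ltac:(lia)). lra. }
  rewrite Ec. unfold potential. rewrite <- !RtoC_pow.
  set (d1 := ln (ref_size n (S k)) - ln (ref_size n k) - ref_point n k) in *.
  set (d2 := ref_sin n (S k) ^ 2 - ref_sin n k ^ 2 + 2 * (ref_point n k * ref_sin n k ^ 2)) in *.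
  match goal with |- Cmod ?z <= _ =>
    replace z with ((a - 1) * RtoC d1 + a * RtoC (d2 / 2))%C end.
  2: { unfold d1, d2. rewrite RtoC_div, !RtoC_minus, RtoC_plus, RtoC_minus, !RtoC_mult by lra.
       field. }
  assert (Ba : Cmod a <= Cmod a) by apply Rle_refl.
  assert (B1 : Cmod (RtoC 1) <= 1) by (rewrite Cmod_1; lra).
  assert (Bd1 : Cmod (RtoC d1) <= 9 * ref_size n k ^ 2) by (rewrite Cmod_R; exact L1).
  assert (Bd2 : Cmod (RtoC (d2 / 2)) <= 5 * ref_size n k ^ 2).
  { rewrite Cmod_R. unfold Rdiv. rewrite Rabs_mult, (Rabs_right (/ 2)) by lra.
    assert (step_eps n ^ 2 <= ref_size n k ^ 2) by (apply pow_incr; lra).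
    assert (0 <= step_eps n ^ 2) by apply pow2_ge_0. lra. }
  eapply Rle_trans; [cbound|]. right. ring.
Qed.

Lemma ln_le_sqrt (y : R) : 0 < y -> ln y <= 2 * sqrt y.
Proof.
  intros Hy. assert (Hs := sqrt_lt_R0 y Hy).
  rewrite <- (sqrt_sqrt y) at 1 by lra. rewrite ln_mult by assumption.
  assert (T : ln (sqrt y) <= sqrt y).
  { rewrite <- (ln_exp (sqrt y)) at 2. apply ln_le; [assumption|].
    apply Rle_trans with (1 + sqrt y); [lra|]. apply Rlt_le, exp_ineq1. lra. }
  lra.
Qed.

Lemma sqrt_ge_1 (j : nat) : (1 <= j)%nat -> 1 <= sqrt (INR j).
Proof. intros H. rewrite <- sqrt_1. apply sqrt_le_1_alt. now apply INR_ge_1. Qed.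

(** [j] is the distance of [k] to the nearer end. The quotient of the sizes at [k] and [m] lies
    between [1 / (3 j)] and 3, and its logarithm is bounded by a multiple of [sqrt j]. *)
Lemma potential_diff_le (a : C) (n m k j : nat) : (1 <= m)%nat -> (m <= j)%nat ->
  (j <= k)%nat -> (j + k <= n)%nat -> (j = k \/ j + k = n)%nat ->
  Cmod (potential a n k - potential a n m)%C <= 6 * (Cmod a + 1) * sqrt (INR j) + Cmod a.
Proof.
  intros Hm Hj Hk Hn Hor.
  assert (Hxk := ref_size_pos n k ltac:(lia) ltac:(lia)).
  assert (Hxm := ref_size_pos n m ltac:(lia) ltac:(lia)).
  assert (U1 := ref_size_le n k m ltac:(lia) ltac:(lia) ltac:(lia)).
  assert (U2 := ref_size_le n m m ltac:(lia) ltac:(lia) ltac:(lia)).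
  assert (G1 := ref_size_ge n m ltac:(lia) ltac:(lia)).
  assert (G2 : / INR j <= ref_size n k).
  { destruct Hor as [->|E]; [apply ref_size_ge; lia|].
    rewrite <- (ref_size_sym n k) by lia. replace (n - k)%nat with j by lia.
    apply ref_size_ge; lia. }
  assert (Im := INR_ge_1 m Hm). assert (Ij := INR_ge_1 j ltac:(lia)).
  assert (Sj := sqrt_ge_1 j ltac:(lia)).
  assert (Sq3 : sqrt 3 <= 2).
  { replace 2 with (sqrt (2 * 2)) by (apply sqrt_square; lra). apply sqrt_le_1_alt. lra. }
  assert (HL : Rabs (ln (ref_size n k) - ln (ref_size n m)) <= 4 * sqrt (INR j)).
  { apply Rabs_le. split.
    - assert (H : ln (ref_size n m / ref_size n k) <= ln (3 * INR j)).
      { apply ln_le; [now apply Rdiv_lt_0_compat|]. apply Rle_div_l; [assumption|].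
        apply Rle_trans with 3.
        - eapply Rle_trans; [exact U2|]. apply Rle_div_l; lra.
        - apply Rmult_le_compat_l with (r := 3 * INR j) in G2; [|lra].
          replace (3 * INR j * / INR j) with 3 in G2 by (field; lra). exact G2. }
      rewrite ln_div in H by assumption.
      assert (H2 := ln_le_sqrt (3 * INR j) ltac:(lra)). rewrite sqrt_mult in H2 by lra. nra.
    - assert (H : ln (ref_size n k / ref_size n m) <= ln 3).
      { apply ln_le; [now apply Rdiv_lt_0_compat|]. apply Rle_div_l; [assumption|].
        unfold Rdiv in U1. lra. }
      rewrite ln_div in H by assumption.
      assert (H2 := ln_le_sqrt 3 ltac:(lra)). nra. }
  unfold potential. rewrite <- !RtoC_pow.
  match goal with |- Cmod ?z <= _ =>
    replace z with ((a - 1) * RtoC (ln (ref_size n k) - ln (ref_size n m))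
       + a * RtoC ((ref_sin n k ^ 2 - ref_sin n m ^ 2) / 2))%C end.
  2: { rewrite RtoC_div, !RtoC_minus by lra. field. }
  assert (Ba : Cmod a <= Cmod a) by apply Rle_refl.
  assert (B1 : Cmod (RtoC 1) <= 1) by (rewrite Cmod_1; lra).
  assert (Bd1 : Cmod (RtoC (ln (ref_size n k) - ln (ref_size n m))) <= 4 * sqrt (INR j))
    by (rewrite Cmod_R; exact HL).
  assert (Bd2 : Cmod (RtoC ((ref_sin n k ^ 2 - ref_sin n m ^ 2) / 2)) <= 1).
  { rewrite Cmod_R. apply Rabs_le.
    assert (T1 := SIN_bound (ref_angle n k)). assert (T2 := SIN_bound (ref_angle n m)).
    fold (ref_sin n k) in T1. fold (ref_sin n m) in T2. split; nra. }
  eapply Rle_trans; [cbound|]. assert (T := Cmod_ge_0 a). nra.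
Qed.

(** * Finite complex sums *)

Fixpoint csum (g : nat -> C) (n : nat) : C :=
  match n with O => RtoC 0 | S k => (csum g k + g k)%C end.

Lemma csum_diff_le (g : nat -> C) (b : R) (m k : nat) : (m <= k)%nat ->
  (forall i, (m <= i < k)%nat -> Cmod (g i) <= b) ->
  Cmod (csum g k - csum g m)%C <= b * (INR k - INR m).
Proof.
  intros Hmk. induction Hmk as [|k Hmk IH]; intros H.
  - replace (csum g m - csum g m)%C with (RtoC 0) by ring. rewrite Cmod_0. lra.
  - simpl csum. replace (csum g k + g k - csum g m)%C with (csum g k - csum g m + g k)%C by ring.
    eapply Rle_trans; [apply Cmod_triangle|]. rewrite S_INR.
    assert (T := IH ltac:(intros; apply H; lia)). assert (T2 := H k ltac:(lia)). lra.
Qed.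

Lemma csum_ext (g h : nat -> C) (n : nat) :
  (forall i, (i < n)%nat -> g i = h i) -> csum g n = csum h n.
Proof.
  induction n as [|n IH]; intros H; [reflexivity|]. simpl.
  rewrite IH, H by (try intros; try apply H; lia). reflexivity.
Qed.

Lemma csum_plus (g h : nat -> C) (n : nat) :
  csum (fun i => g i + h i)%C n = (csum g n + csum h n)%C.
Proof. induction n as [|n IH]; simpl; [ring|rewrite IH; ring]. Qed.

Lemma csum_shift (g : nat -> C) (n : nat) :
  csum g (S n) = (g 0%nat + csum (fun i => g (S i)) n)%C.
Proof.
  induction n as [|n IH]; [simpl; ring|].
  change (csum g (S (S n))) with (csum g (S n) + g (S n))%C. rewrite IH. simpl. ring.
Qed.

Lemma csum_reverse (g : nat -> C) (n : nat) : csum (fun i => g (n - 1 - i)%nat) n = csum g n.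
Proof.
  induction n as [|n IH]; [reflexivity|].
  rewrite csum_shift. simpl csum at 2. rewrite <- IH.
  replace (S n - 1 - 0)%nat with n by lia.
  rewrite Cplus_comm. f_equal. apply csum_ext. intros i Hi. f_equal. lia.
Qed.

(** * Passage through the gate *)

(** The quotient of the kick by the square of [ref_size n i], with the sine in the numerator so that
    it is meaningful, and equal to 0, also at the pole [i = 0]. *)
Definition kick_coef (kap : nat -> C) (n i : nat) : C :=
  (kap i * (ref_sin n i ^ 2 / step_eps n ^ 2))%C.

Lemma kick_coef_le (kap : nat -> C) (b : R) (n i : nat) : (1 <= n)%nat ->
  Cmod (kap i) <= b / INR n ^ 3 -> Cmod (kick_coef kap n i) <= b / INR n.
Proof.
  intros Hn H. assert (He := step_eps_pos n Hn). assert (Hg := step_eps_ge n Hn).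
  apply INR_ge_1 in Hn. unfold kick_coef.
  rewrite <- !RtoC_pow, <- RtoC_div by (apply pow_nonzero; lra).
  assert (B : Cmod (RtoC (ref_sin n i ^ 2 / step_eps n ^ 2)) <= INR n ^ 2).
  { assert (S := SIN_bound (ref_angle n i)). fold (ref_sin n i) in S.
    rewrite Cmod_R, Rabs_right.
    - apply Rle_div_l; [nra|].
      assert (1 <= INR n * step_eps n).
      { apply Rmult_le_compat_l with (r := INR n) in Hg; [|lra]. now rewrite Rinv_r in Hg by lra. }
      replace (INR n ^ 2 * step_eps n ^ 2) with ((INR n * step_eps n) ^ 2) by ring. nra.
    - apply Rle_ge, Rle_div_r; [nra|]. nra. }
  eapply Rle_trans; [cbound|]. right. field. lra.
Qed.

(** Makes sums of [j^(-3/2)] telescope. *)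
Lemma inv_sqrt_decr (y : R) : 1 <= y ->
  / (y * sqrt y) <= 6 * (/ sqrt y - / sqrt (y + 1)).
Proof.
  intros Hy. assert (H1 := sqrt_lt_R0 y ltac:(lra)). assert (H2 := sqrt_lt_R0 (y + 1) ltac:(lra)).
  assert (E1 := sqrt_sqrt y ltac:(lra)). assert (E2 := sqrt_sqrt (y + 1) ltac:(lra)).
  set (s := sqrt y) in *. set (t := sqrt (y + 1)) in *. rewrite <- E1.
  assert (Hst : s <= t) by (apply sqrt_le_1_alt; lra).
  assert (Ht : t <= 3 / 2 * s) by (apply Rsqr_incr_0; unfold Rsqr; nra).
  assert (Ed : (t - s) * (t + s) = 1) by nra.
  assert (Hd : 2 / 5 <= (t - s) * s) by nra.
  apply Rmult_le_reg_r with (s * s * s * t); [repeat apply Rmult_lt_0_compat; lra|].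
  replace (/ (s * s * s) * (s * s * s * t)) with t by (field; lra).
  replace (6 * (/ s - / t) * (s * s * s * t)) with (6 * ((t - s) * s) * s) by (field; lra).
  nra.
Qed.

Lemma inv_sqrt_antimono (x y : R) : 0 < x -> x <= y -> / sqrt y <= / sqrt x.
Proof.
  intros. apply Rinv_le_contravar; [now apply sqrt_lt_R0|]. now apply sqrt_le_1_alt.
Qed.

Lemma INR_sub_S (n k : nat) : (S k <= n)%nat -> INR (n - k) = INR (n - S k) + 1.
Proof. intros H. rewrite <- S_INR. f_equal. lia. Qed.

(** A bootstrap in [k]. While the accumulated error is at most 1, the coordinate is [O(sqrt j)] with
    [j = min(k, n - k)]; then [mobius_step] applies and adds an error [O(j^(-3/2))], and these sum
    to a multiple of [m^(-1/2)], again at most 1 for [m >= m1]. [K] and [m1] depend neither on [n]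
    nor on the kicks or [u0]. *)
Lemma passage (f : C -> C) (a : C) (B C0 : R) : parabolic_expansion f a -> 0 <= B -> 0 <= C0 ->
  exists (K : R) (m1 : nat), 0 <= K /\ (1 <= m1)%nat /\
  forall n m : nat, (m1 <= m)%nat -> (2 * m <= n)%nat ->
  forall (kap w : nat -> C) (u0 : C),
    (forall k, (k < n)%nat -> Cmod (kap k) <= B / INR n ^ 3) ->
    (forall k, (m <= k < n - m)%nat -> w (S k) = (f (w k) + step_eps n ^ 2 + kap k)%C) ->
    w m = mobius (ref_point n m) (step_eps n) u0 -> Cmod u0 <= C0 * sqrt (INR m) ->
    Cmod (csum (kick_coef kap n) (n - m) - csum (kick_coef kap n) m)%C <= / sqrt (INR m) ->
    exists u1 : C, w (n - m)%nat = mobius (ref_point n (n - m)) (step_eps n) u1 /\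
      Cmod (u1 - u0)%C <= K / sqrt (INR m).
Proof.
  intros (K0 & d & Hd & Hf) HB HC0.
  set (Kf := Rabs K0). assert (HKf : 0 <= Kf) by apply Rabs_pos.
  destruct (mobius_step a Kf B HKf HB) as (Ks & del & HKs & [Hdel Hdel8] & Hstep).
  set (A := Cmod a). assert (HA : 0 <= A) by apply Cmod_ge_0.
  (* Bounds [1 + |v|] in units of [sqrt j]: [C0] for the initial coordinate, the next terms for the
     potential, [B] for the kicks, 1 for the accumulated error and 1 for the constant. *)
  set (C1 := C0 + 6 * (A + 1) + A + B + 2).
  assert (HC1 : 2 <= C1) by (unfold C1; lra).
  set (Kp := 9 * (A + 1) + 5 * A). assert (HKp : 0 <= Kp) by (unfold Kp; lra).
  set (K' := 9 * C1 * (Ks + Kp)).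
  assert (HK' : 0 <= K') by (unfold K'; apply Rmult_le_pos; lra).
  (* [sqrt m] must exceed [12 K'], so that the accumulated error is at most 1, [3 C1 / del], so that
     [mobius_step] applies, and [7 / d], so that the orbit stays where the expansion of [f] is
     valid. *)
  destruct (archimed_cor1 (/ (12 * K' + 3 * C1 / del + 7 / d + 1) ^ 2)) as [m1 [Hm1 Hm1p]].
  { apply Rinv_0_lt_compat, pow_lt.
    assert (0 < 3 * C1 / del) by (apply Rdiv_lt_0_compat; lra).
    assert (0 < 7 / d) by (apply Rdiv_lt_0_compat; lra). lra. }
  exists (12 * K' + 1), m1. split; [lra|]. split; [lia|].
  intros n m Hm Hn kap w u0 Hkap Hw Hw0 Hu0 Hsum.
  assert (Hm1' : (1 <= m)%nat) by lia.
  assert (Im1 := INR_ge_1 m1 ltac:(lia)). assert (Im := INR_ge_1 m Hm1').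
  assert (P1 : 0 < 3 * C1 / del) by (apply Rdiv_lt_0_compat; lra).
  assert (P2 : 0 < 7 / d) by (apply Rdiv_lt_0_compat; lra).
  assert (Hsm : 12 * K' + 3 * C1 / del + 7 / d + 1 <= sqrt (INR m)).
  { apply Rle_trans with (sqrt (INR m1)).
    - rewrite <- (sqrt_pow2 (12 * K' + 3 * C1 / del + 7 / d + 1)) by lra.
      apply sqrt_le_1_alt.
      apply Rinv_lt_cancel in Hm1; [lra|lra].
    - apply sqrt_le_1_alt. now apply le_INR. }
  set (s := sqrt (INR m)) in *.
  assert (Hs1 : 1 <= s) by lra.
  set (Q := csum (kick_coef kap n)) in *.
  (* Majorant of the accumulated error, up to the factor [K']. The first part telescopes [k^(-3/2)]
     from the entrance, the second [(n - k)^(-3/2)] towards the exit; the whole starts at 0 and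
     stays below [12 / s]. *)
  set (Psi := fun k => 6 * (/ s - / sqrt (INR k)) + 6 * (/ sqrt (INR (n - k)) - / sqrt (INR (n - m)))).
  assert (main : forall k, (m <= k)%nat -> (k <= n - m)%nat ->
    exists v, w k = mobius (ref_point n k) (step_eps n) v /\
      Cmod (v - u0 - (potential a n k - potential a n m) - (Q k - Q m))%C <= K' * Psi k).
  { intros k Hmk. induction Hmk as [|k Hmk IH]; intros Hk.
    - exists u0. split; [exact Hw0|].
      replace (u0 - u0 - (potential a n m - potential a n m) - (Q m - Q m))%C with (RtoC 0) by ring.
      rewrite Cmod_0. unfold Psi. fold s. right. ring.
    - destruct (IH ltac:(lia)) as (v & Ev & Bv). clear IH.
      set (j := Nat.min k (n - k)).
      assert (Hj : (m <= j)%nat /\ (j <= k)%nat /\ (j + k <= n)%nat /\ (j = k \/ j + k = n)%nat /\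
                   (1 <= j)%nat) by (unfold j; lia).
      destruct Hj as (J1 & J2 & J3 & J4 & J5).
      assert (Ij := INR_ge_1 j J5).
      set (sj := sqrt (INR j)).
      assert (Hsj : s <= sj) by (apply sqrt_le_1_alt; now apply le_INR).
      assert (Esj : sj * sj = INR j) by (apply sqrt_sqrt; lra).
      set (x := ref_size n k).
      assert (Hx : 0 < x) by (apply ref_size_pos; lia).
      assert (Hxj : x <= 3 / INR j) by (apply ref_size_le; lia).
      assert (HPsi : K' * Psi k <= 1).
      { assert (T1 : / sqrt (INR (n - k)) <= / s)
          by (apply inv_sqrt_antimono; [lra|]; apply le_INR; lia).
        assert (T2 : 0 < / sqrt (INR k))
          by (apply Rinv_0_lt_compat, sqrt_lt_R0; apply lt_0_INR; lia).
        assert (T3 : 0 < / sqrt (INR (n - m)))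
          by (apply Rinv_0_lt_compat, sqrt_lt_R0; apply lt_0_INR; lia).
        assert (T4 : Psi k <= 12 / s) by (unfold Psi; lra).
        apply Rle_trans with (K' * (12 / s)); [now apply Rmult_le_compat_l|].
        replace (K' * (12 / s)) with (12 * K' / s) by (field; lra).
        apply Rle_div_l; lra. }
      assert (HQ : Cmod (Q k - Q m)%C <= B).
      { eapply Rle_trans; [apply (csum_diff_le _ (B / INR n)); [assumption|]|].
        - intros i Hi. apply kick_coef_le; [lia|]. apply Hkap. lia.
        - assert (INR k - INR m <= INR n).
          { assert (T := le_INR k n ltac:(lia)). lra. }
          assert (In := INR_ge_1 n ltac:(lia)).
          assert (0 <= B / INR n) by (apply Rle_div_r; lra).
          apply Rle_trans with (B / INR n * INR n); [now apply Rmult_le_compat_l|].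
          right. field. lra. }
      assert (Hv : 1 + Cmod v <= C1 * sj).
      { assert (HP := potential_diff_le a n m k j Hm1' J1 J2 J3 J4). fold A sj in HP.
        replace v with ((v - u0 - (potential a n k - potential a n m) - (Q k - Q m)) + u0
          + (potential a n k - potential a n m) + (Q k - Q m))%C by ring.
        assert (Bv' := Rle_trans _ _ _ Bv HPsi).
        assert (T : forall z1 z2 z3 z4 : C, Cmod (z1 + z2 + z3 + z4)%C
           <= Cmod z1 + Cmod z2 + Cmod z3 + Cmod z4) by (intros; cbound).
        eapply Rle_trans; [apply Rplus_le_compat_l, T|]. unfold C1.
        assert (C0 * s <= C0 * sj) by (apply Rmult_le_compat_l; lra). nra. }
      assert (Hx3 : x <= 3 / (sj * sj)) by (rewrite Esj; exact Hxj).
      assert (Hsj1 : 1 <= sj) by lra.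
      assert (Hvx : (1 + Cmod v) * x <= del).
      { apply Rle_trans with (C1 * sj * (3 / (sj * sj))).
        - apply Rmult_le_compat; try lra. assert (T := Cmod_ge_0 v). lra.
        - replace (C1 * sj * (3 / (sj * sj))) with (3 * C1 / sj) by (field; lra).
          apply Rle_div_l; [lra|].
          assert (3 * C1 / del <= sj) by lra.
          apply Rle_div_l in H; lra. }
      assert (Hvx8 : (1 + Cmod v) * x <= 1 / 8) by lra.
      assert (Hx8 : x <= 1 / 8) by (assert (T := Cmod_ge_0 v); nra).
      assert (Hn4 : (4 <= n)%nat).
      { destruct (Nat.le_gt_cases 4 n) as [|Hlt]; [assumption|exfalso].
        assert (In3 : INR n <= 3).
        { replace 3 with (INR 3) by (simpl; ring). apply le_INR. lia. }
        assert (T := step_eps_le_ref_size n k ltac:(lia) ltac:(lia)). fold x in T.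
        assert (T2 := step_eps_ge n ltac:(lia)).
        assert (/ 3 <= / INR n) by (apply Rinv_le_contravar; [apply lt_0_INR; lia|lra]). lra. }
      assert (He := step_eps_pos n ltac:(lia)).
      assert (Hex : step_eps n <= x) by (apply step_eps_le_ref_size; lia).
      assert (Hq := ref_point_sqr n k ltac:(lia) ltac:(lia)). fold x in Hq.
      assert (Hq' : (ref_point n k ^ 2 + step_eps n ^ 2)%C = (RtoC x ^ 2)%C).
      { rewrite <- !RtoC_pow, <- RtoC_plus. now rewrite Hq. }
      assert (Hc : Cmod (RtoC (ref_point n k)) <= x).
      { rewrite Cmod_R. apply ref_point_abs_le; lia. }
      destruct (mobius_bounds _ _ v x Hx Hc Hq' Hvx8) as (_ & _ & Bw).
      set (rho := (f (w k) - (w k + w k ^ 2 + a * w k ^ 3))%C).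
      assert (Bw' : Cmod (w k) < d).
      { rewrite Ev. eapply Rle_lt_trans; [exact Bw|].
        apply Rle_lt_trans with (2 * (3 / (sj * sj))); [lra|].
        assert (7 / d <= sj) by lra. apply Rle_div_l in H; [|lra].
        apply Rmult_lt_reg_r with (sj * sj); [nra|].
        replace (2 * (3 / (sj * sj)) * (sj * sj)) with 6 by (field; lra). nra. }
      destruct (Hstep (ref_point n k) (step_eps n) (flow_tau n) (ref_point n (S k)) v rho (kap k) x)
        as (v' & Ev' & Bv'); try assumption.
      + rewrite Cmod_R, Rabs_right; lra.
      + rewrite <- RtoC_minus, Cmod_R. eapply Rle_trans; [apply flow_tau_bound; lia|].
        apply pow_incr; lra.
      + rewrite <- RtoC_pow, <- !RtoC_mult, <- RtoC_minus, <- RtoC_plus, <- RtoC_mult.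
        f_equal. apply ref_point_S; lia.
      + rewrite <- Ev. eapply Rle_trans; [exact (Hf _ Bw')|].
        apply Rmult_le_compat_r; [apply pow_le, Cmod_ge_0|apply Rle_abs].
      + eapply Rle_trans; [apply Hkap; lia|]. unfold Rdiv.
        apply Rmult_le_compat_l; [exact HB|]. rewrite <- pow_inv. apply pow_incr.
        assert (In := INR_ge_1 n ltac:(lia)).
        split; [apply Rlt_le, Rinv_0_lt_compat; lra|].
        eapply Rle_trans; [apply step_eps_ge; lia|exact Hex].
      + exists v'. split.
        { rewrite <- Ev'. rewrite (Hw k ltac:(lia)). rewrite <- Ev. unfold rho. ring. }
        assert (HPS := potential_S a n k Hn4 ltac:(lia) ltac:(lia) Hx8).
        fold A Kp x in HPS.
        assert (Ekick : (kap k / RtoC x ^ 2)%C = kick_coef kap n k).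
        { unfold kick_coef, x, ref_size. unfold Cdiv. f_equal.
          assert (Hsin := ref_sin_pos n k ltac:(lia) ltac:(lia)).
          rewrite <- !RtoC_pow, <- !RtoC_inv, <- RtoC_mult by (apply pow_nonzero; try lra;
             apply Rgt_not_eq, Rdiv_lt_0_compat; lra).
          f_equal. field. split; lra. }
        rewrite Ekick in Bv'.
        set (dP := ((a - 1) * ref_point n k - a * ref_point n k * (step_eps n ^ 2 / RtoC x ^ 2))%C) in *.
        change (Q (S k)) with (Q k + kick_coef kap n k)%C.
        replace (v' - u0 - (potential a n (S k) - potential a n m)
           - (Q k + kick_coef kap n k - Q m))%C with
          ((v - u0 - (potential a n k - potential a n m) - (Q k - Q m))
           + (v' - v - (dP + kick_coef kap n k))
           - (potential a n (S k) - potential a n k - dP))%C by ring.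
        eapply Rle_trans; [cbound|].
        assert (Hx2 : x ^ 2 <= 9 / (sj * sj) ^ 2).
        { replace (9 / (sj * sj) ^ 2) with ((3 / (sj * sj)) ^ 2) by (field; lra).
          apply pow_incr. lra. }
        assert (Hx20 : 0 <= x ^ 2) by nra.
        assert (Hinc : Ks * (1 + Cmod v) * x ^ 2 + Kp * x ^ 2 <= K' * / (INR j * sj)).
        { assert (T := Cmod_ge_0 v).
          apply Rle_trans with ((Ks + Kp) * ((C1 * sj) * (9 / (sj * sj) ^ 2))).
          - apply Rle_trans with ((Ks + Kp) * ((1 + Cmod v) * x ^ 2)).
            + assert (0 <= Cmod v * x ^ 2) by nra.
              assert (0 <= Kp * (Cmod v * x ^ 2)) by now apply Rmult_le_pos. lra.
            + apply Rmult_le_compat_l; [lra|]. apply Rmult_le_compat; lra.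
          - unfold K'. rewrite <- Esj. right. field. lra. }
        (* Both parts of [Psi] are nondecreasing, and the one that belongs to the nearer end grows
           enough. *)
        assert (HPsiS : / (INR j * sj) <= Psi (S k) - Psi k).
        { assert (Ik := INR_ge_1 k ltac:(lia)).
          assert (Ink := INR_ge_1 (n - S k) ltac:(lia)).
          assert (M1 : / sqrt (INR k + 1) <= / sqrt (INR k)) by (apply inv_sqrt_antimono; lra).
          assert (M2 : / sqrt (INR (n - S k) + 1) <= / sqrt (INR (n - S k)))
            by (apply inv_sqrt_antimono; lra).
          unfold Psi. rewrite (INR_sub_S n k) by lia. rewrite S_INR.
          destruct J4 as [J4|J4].
          - assert (T := inv_sqrt_decr (INR k) Ik). unfold sj. rewrite J4. lra.
          - assert (Ej : INR j = INR (n - S k) + 1).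
            { rewrite <- INR_sub_S by lia. f_equal. lia. }
            assert (T := inv_sqrt_decr (INR (n - S k)) Ink).
            apply Rle_trans with (/ (INR (n - S k) * sqrt (INR (n - S k)))).
            + apply Rinv_le_contravar.
              * apply Rmult_lt_0_compat; [lra|]. apply sqrt_lt_R0; lra.
              * unfold sj. rewrite Ej. apply Rmult_le_compat; try lra.
                -- apply sqrt_pos.
                -- apply sqrt_le_1_alt; lra.
            + lra. }
        assert (K' * / (INR j * sj) <= K' * (Psi (S k) - Psi k)) by now apply Rmult_le_compat_l.
        lra. }
  destruct (main (n - m)%nat ltac:(lia) ltac:(lia)) as (u1 & E1 & B1).
  exists u1. split; [exact E1|].
  (* The potential takes equal values at the two ends, so only the kicks and the accumulated error
     remain. *)
  rewrite potential_sym in B1 by lia.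
  replace (u1 - u0)%C with ((u1 - u0 - (potential a n m - potential a n m) - (Q (n - m)%nat - Q m))
    + (Q (n - m)%nat - Q m))%C by ring.
  eapply Rle_trans; [apply Cmod_triangle|].
  assert (HP : Psi (n - m)%nat <= 12 / s).
  { unfold Psi. replace (n - (n - m))%nat with m by lia. fold s.
    assert (0 < / sqrt (INR (n - m)))
      by (apply Rinv_0_lt_compat, sqrt_lt_R0; apply lt_0_INR; lia). lra. }
  assert (K' * Psi (n - m)%nat <= K' * (12 / s)) by now apply Rmult_le_compat_l.
  replace ((12 * K' + 1) / s) with (K' * (12 / s) + / s) by (field; lra). lra.
Qed.

(** * The perturbations eps_{k,n}^2 - (PI/n)^2 *)

Lemma Rpower_large (alpha X : R) : 0 < alpha ->
  exists N : nat, forall n : nat, (N <= n)%nat -> X <= Rpower (INR n) alpha.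
Proof.
  intros Ha. set (Y := exp (Rmax X 0 / alpha)).
  assert (HY : 0 < Y) by apply exp_pos.
  destruct (INR_unbounded Y) as [N HN]. exists N. intros n Hn.
  apply le_INR in Hn. unfold Rpower.
  assert (HL : Rmax X 0 / alpha <= ln (INR n)).
  { rewrite <- (ln_exp (Rmax X 0 / alpha)). apply ln_le; [exact HY|]. fold Y. lra. }
  apply Rle_div_l in HL; [|assumption].
  assert (H0 := Rmax_l X 0). assert (H1 := Rmax_r X 0).
  destruct (Req_dec (alpha * ln (INR n)) 0) as [E|E].
  - rewrite E, exp_0. lra.
  - assert (T := exp_ineq1 _ E). lra.
Qed.

Lemma inv_INR_small (b e : R) : 0 < e -> exists N : nat, (1 <= N)%nat /\
  forall n : nat, (N <= n)%nat -> b / INR n <= e.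
Proof.
  intros He. destruct (INR_unbounded (Rabs b / e + 1)) as [N HN].
  assert (H0 : 0 <= Rabs b / e) by (apply Rle_div_r; [assumption|]; assert (T := Rabs_pos b); lra).
  exists N. split.
  - apply INR_lt. simpl. lra.
  - intros n Hn. apply le_INR in Hn. apply Rle_div_l; [lra|].
    assert (T : Rabs b / e <= INR n) by lra. apply Rle_div_l in T; [|assumption].
    assert (T2 := Rle_abs b). lra.
Qed.

Lemma sin_Lipschitz (x y : R) : Rabs (sin x - sin y) <= Rabs (x - y).
Proof.
  rewrite form4, !Rabs_mult, (Rabs_right 2) by lra.
  assert (H1 : Rabs (cos ((x + y) / 2)) <= 1) by (apply Rabs_le, COS_bound).
  assert (H2 : forall t, Rabs (sin t) <= Rabs t).
  { assert (P : forall t, 0 <= t -> Rabs (sin t) <= t).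
    { intros t Ht. destruct (Rle_dec t 1) as [L|L].
      - rewrite Rabs_right; [now apply sin_le_self|].
        apply Rle_ge. assert (T := sin_ge_third t ltac:(lra)). lra.
      - apply Rle_trans with 1; [apply Rabs_le, SIN_bound|lra]. }
    intros t. destruct (Rle_dec 0 t) as [L|L].
    - rewrite (Rabs_right t) by lra. auto.
    - rewrite (Rabs_left t) by lra. assert (T := P (- t) ltac:(lra)).
      rewrite sin_neg, Rabs_Ropp in T. exact T. }
  assert (H3 := H2 ((x - y) / 2)).
  replace (Rabs (x - y)) with (2 * Rabs ((x - y) / 2)).
  - assert (0 <= Rabs (sin ((x - y) / 2))) by apply Rabs_pos. nra.
  - unfold Rdiv. rewrite Rabs_mult, (Rabs_right (/ 2)) by lra. field.
Qed.

Definition kick (eps : nat -> nat -> C) (n k : nat) : C := (eps k n ^ 2 - step_eps n ^ 2)%C.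

Section Kicks.
Variables (alpha M S K : R) (eps sigma : nat -> nat -> C).
Hypothesis Halpha : 0 < alpha < 1.
Hypothesis Heps : forall n k : nat, (k < n)%nat ->
  Cmod (eps k n - (PI / INR n + PI / INR n ^ 2 * sigma k n))%C <= M / Rpower (INR n) (2 + alpha).
Hypothesis Hsigma : forall n k : nat, (k < n)%nat -> Cmod (sigma k n) <= S.
Hypothesis Hpair : forall n k : nat, (k + 2 <= n)%nat ->
  Cmod (sigma k n + sigma (n - 2 - k)%nat n)%C <= K / INR n.
Hypothesis (HM : 0 <= M) (HS : 0 <= S) (HK : 0 <= K).

Let D := 4 * S + M.
Let omega (n : nat) := 8 * M / Rpower (INR n) alpha + D ^ 2 / INR n.

(** Squaring [e + (e / n) sigma + r] leaves, besides the main term, [2 e r], bounded by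
    [8 M n^(-3 - alpha)], and the square of the deviation from [e], bounded by [D^2 / n^4]. [omega]
    collects both after the factor [n^(-3)] and tends to 0 because [alpha > 0]. *)
Lemma kick_expansion (n k : nat) : (k < n)%nat ->
  Cmod (kick eps n k - 2 * step_eps n ^ 2 / INR n * sigma k n)%C <= omega n / INR n ^ 3.
Proof.
  intros Hk. assert (In := INR_ge_1 n ltac:(lia)).
  assert (He := step_eps_pos n ltac:(lia)). assert (He4 := step_eps_le n ltac:(lia)).
  assert (Hn0 : RtoC (INR n) <> RtoC 0) by (intros E; injection E; lra).
  set (p := / Rpower (INR n) alpha).
  assert (Hp : 0 < p) by apply Rinv_0_lt_compat, exp_pos.
  assert (Hp1 : p <= 1).
  { unfold p. rewrite <- Rinv_1. apply Rinv_le_contravar; [lra|].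
    rewrite <- (Rpower_O (INR n)) by lra. apply Rle_Rpower; lra. }
  assert (He1 := Heps n k Hk).
  rewrite Rpower_plus in He1. replace (Rpower (INR n) 2) with (INR n ^ 2) in He1
    by (rewrite <- Rpower_pow by lra; reflexivity).
  assert (HP0 : 0 < Rpower (INR n) alpha) by apply exp_pos.
  replace (M / (INR n ^ 2 * Rpower (INR n) alpha)) with (M * p / INR n ^ 2) in He1
    by (unfold p; field; lra).
  assert (E1 : (PI / INR n)%C = RtoC (step_eps n)).
  { unfold step_eps. rewrite RtoC_div; [reflexivity|lra]. }
  replace (PI / INR n ^ 2 * sigma k n)%C with (PI / INR n / INR n * sigma k n)%C in He1
    by (field; assumption).
  rewrite E1 in He1.
  set (e := step_eps n) in *. set (s := sigma k n) in *.
  set (r := (eps k n - (e + e / INR n * s))%C) in *.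
  set (del := (e / INR n * s + r)%C).
  assert (Bs : Cmod s <= S) by (apply Hsigma; lia).
  assert (Ben : Cmod (e / INR n)%C <= 4 / INR n ^ 2).
  { rewrite <- RtoC_div, Cmod_R, Rabs_right by (try lra; apply Rle_ge, Rlt_le, Rdiv_lt_0_compat; lra).
    apply Rle_div_l; [lra|]. replace (4 / INR n ^ 2 * INR n) with (4 / INR n) by (field; lra). lra. }
  assert (Be : Cmod (RtoC e) <= 4 / INR n) by (rewrite Cmod_R, Rabs_right; lra).
  assert (B2 : Cmod (RtoC 2) <= 2) by (rewrite Cmod_R, Rabs_right; lra).
  assert (Bdel : Cmod del <= D / INR n ^ 2).
  { unfold del. eapply Rle_trans; [cbound|]. unfold D.
    replace ((4 * S + M) / INR n ^ 2) with (4 / INR n ^ 2 * S + M * 1 / INR n ^ 2) by (field; lra).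
    apply Rplus_le_compat_l. apply Rmult_le_compat_r.
    - apply Rlt_le, Rinv_0_lt_compat. nra.
    - now apply Rmult_le_compat_l. }
  replace (kick eps n k - 2 * e ^ 2 / INR n * s)%C with (2 * e * r + del ^ 2)%C.
  2: { unfold kick, del. fold e. replace (eps k n) with (e + e / INR n * s + r)%C by (unfold r; ring).
       field. assumption. }
  eapply Rle_trans; [cbound|]. unfold omega. fold p. right.
  replace (8 * M / Rpower (INR n) alpha) with (8 * M * p) by reflexivity.
  field. lra.
Qed.

Lemma omega_nonneg (n : nat) : (1 <= n)%nat -> 0 <= omega n.
Proof.
  intros Hn. apply INR_ge_1 in Hn.
  assert (0 < Rpower (INR n) alpha) by apply exp_pos.
  unfold omega. apply Rplus_le_le_0_compat; apply Rle_div_r; try lra.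
  assert (T := pow2_ge_0 D). lra.
Qed.

Lemma kick_bound : exists B, 0 <= B /\
  forall n k, (k < n)%nat -> Cmod (kick eps n k) <= B / INR n ^ 3.
Proof.
  exists (8 * M + D ^ 2 + 32 * S). split.
  { assert (T := pow2_ge_0 D). lra. }
  intros n k Hk. assert (In := INR_ge_1 n ltac:(lia)).
  assert (H := kick_expansion n k Hk).
  assert (He := step_eps_pos n ltac:(lia)). assert (He4 := step_eps_le n ltac:(lia)).
  assert (Hn3 : 0 < INR n ^ 3) by (apply pow_lt; lra).
  assert (Bs : Cmod (sigma k n) <= S) by (apply Hsigma; lia).
  assert (Bq : Cmod (2 * step_eps n ^ 2 / INR n)%C <= 32 / INR n ^ 3).
  { rewrite <- RtoC_pow, <- RtoC_mult, <- RtoC_div, Cmod_R by lra.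
    assert (0 <= step_eps n ^ 2) by apply pow2_ge_0.
    rewrite Rabs_right by (apply Rle_ge, Rle_div_r; lra).
    apply Rle_div_l; [lra|].
    replace (32 / INR n ^ 3 * INR n) with (2 * (4 / INR n) ^ 2) by (field; lra).
    assert (step_eps n ^ 2 <= (4 / INR n) ^ 2) by (apply pow_incr; lra). lra. }
  replace (kick eps n k) with ((kick eps n k - 2 * step_eps n ^ 2 / INR n * sigma k n)
    + 2 * step_eps n ^ 2 / INR n * sigma k n)%C by ring.
  eapply Rle_trans; [cbound|].
  replace (32 / INR n ^ 3 * S) with (32 * S / INR n ^ 3) by (field; lra).
  rewrite <- Rdiv_plus_distr. apply Rmult_le_compat_r; [apply Rlt_le, Rinv_0_lt_compat; lra|].
  apply Rplus_le_compat_r. unfold omega. apply Rplus_le_compat.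
  - apply Rle_div_l; [apply exp_pos|].
    assert (1 <= Rpower (INR n) alpha)
      by (rewrite <- (Rpower_O (INR n)) by lra; apply Rle_Rpower; lra). nra.
  - apply Rle_div_l; [lra|]. assert (T := pow2_ge_0 D). nra.
Qed.

(** The weights [sin^2] are symmetric under [k -> n - k], but the hypothesis pairs [k] with
    [n - 2 - k]. The weight of the partner is therefore that of [k + 2], and the shift by two steps
    changes it by [O(1/n)] only. *)
Lemma kick_coef_pair_le (n k : nat) : (k + 2 <= n)%nat ->
  Cmod (kick_coef (kick eps n) n k + kick_coef (kick eps n) n (n - 2 - k))%C <=
    (2 * (K + 16 * S) / INR n + 2 * omega n) / INR n.
Proof.
  intros Hk. assert (In := INR_ge_1 n ltac:(lia)).
  assert (He := step_eps_pos n ltac:(lia)). assert (He4 := step_eps_le n ltac:(lia)).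
  assert (Hn0 : RtoC (INR n) <> RtoC 0) by (intros E; injection E; lra).
  assert (He0 : RtoC (step_eps n) <> RtoC 0) by (intros E; injection E; lra).
  set (main := fun i => (2 * step_eps n ^ 2 / INR n * sigma i n)%C).
  assert (Herr : forall i, (i < n)%nat ->
    Cmod (kick_coef (kick eps n) n i - 2 / INR n * (sigma i n * ref_sin n i ^ 2))%C
      <= omega n / INR n).
  { intros i Hi.
    replace (kick_coef (kick eps n) n i - 2 / INR n * (sigma i n * ref_sin n i ^ 2))%C with
      (kick_coef (fun j => kick eps n j - main j)%C n i).
    - apply kick_coef_le; [lia|]. now apply kick_expansion.
    - unfold kick_coef, main. field. split; assumption. }
  assert (E1 := Herr k ltac:(lia)). assert (E2 := Herr (n - 2 - k)%nat ltac:(lia)).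
  assert (Es : ref_sin n (n - 2 - k) = ref_sin n (k + 2)).
  { rewrite <- (ref_sin_sym n (k + 2)) by lia. f_equal. lia. }
  rewrite Es in E2.
  set (s1 := sigma k n) in *. set (s2 := sigma (n - 2 - k)%nat n) in *.
  set (g1 := kick_coef (kick eps n) n k) in *.
  set (g2 := kick_coef (kick eps n) n (n - 2 - k)) in *.
  set (x := ref_sin n k) in *. set (y := ref_sin n (k + 2)) in *.
  replace (g1 + g2)%C with ((g1 - 2 / INR n * (s1 * x ^ 2)) + (g2 - 2 / INR n * (s2 * y ^ 2))
    + 2 / INR n * ((s1 + s2) * RtoC (x ^ 2) + s2 * RtoC (y ^ 2 - x ^ 2)))%C
    by (rewrite RtoC_minus, !RtoC_pow; ring).
  assert (Bs2 : Cmod s2 <= S) by (apply Hsigma; lia).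
  assert (Bs12 : Cmod (s1 + s2)%C <= K / INR n) by (apply Hpair; lia).
  assert (Sx := SIN_bound (ref_angle n k)). fold (ref_sin n k) x in Sx.
  assert (Sy := SIN_bound (ref_angle n (k + 2))). fold (ref_sin n (k + 2)) y in Sy.
  assert (Bx : Cmod (RtoC (x ^ 2)) <= 1).
  { rewrite Cmod_R. apply Rabs_le. split; nra. }
  assert (Bxy : Cmod (RtoC (y ^ 2 - x ^ 2)) <= 16 / INR n).
  { rewrite Cmod_R. replace (y ^ 2 - x ^ 2) with ((y - x) * (y + x)) by ring.
    rewrite Rabs_mult.
    assert (L := sin_Lipschitz (ref_angle n (k + 2)) (ref_angle n k)).
    fold (ref_sin n k) (ref_sin n (k + 2)) x y in L.
    replace (ref_angle n (k + 2) - ref_angle n k) with (2 * step_eps n) in L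
      by (unfold ref_angle; rewrite plus_INR; simpl; ring).
    rewrite (Rabs_right (2 * _)) in L by lra.
    assert (L2 : Rabs (y + x) <= 2) by (apply Rabs_le; lra).
    apply Rle_trans with (2 * step_eps n * 2).
    - apply Rmult_le_compat; auto using Rabs_pos.
    - replace (16 / INR n) with (4 * (4 / INR n)) by (field; lra). lra. }
  assert (B2n : Cmod (2 / INR n)%C <= 2 / INR n).
  { rewrite <- RtoC_div, Cmod_R, Rabs_right by (try lra; apply Rle_ge, Rle_div_r; lra). lra. }
  eapply Rle_trans; [cbound|]. right. field. lra.
Qed.

(** [k -> n - 2 - k] is an involution of the indices below [n - 1], so twice the sum over them is a
    sum of [n - 1] pairs, each [o(1/n)]. Dropping the indices below [m] and those from [n - m] to
    [n - 2] costs [O(m / n)]. *)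
Lemma kick_coef_sum_small (m : nat) (h : R) : (1 <= m)%nat -> 0 < h ->
  exists N : nat, forall n : nat, (N <= n)%nat ->
    Cmod (csum (kick_coef (kick eps n) n) (n - m) - csum (kick_coef (kick eps n) n) m)%C <= h.
Proof.
  intros Hm Hh. destruct kick_bound as (B & HB & HkB).
  set (Tc := K + 16 * S + D ^ 2 + 2 * INR m * B).
  destruct (inv_INR_small Tc (h / 2) ltac:(lra)) as (N1 & HN1 & H1).
  destruct (Rpower_large alpha (16 * M / h) ltac:(lra)) as (N2 & H2).
  exists (N1 + N2 + m + 2)%nat. intros n Hn.
  assert (In := INR_ge_1 n ltac:(lia)).
  set (g := kick_coef (kick eps n) n).
  assert (Hg : forall i, (i < n)%nat -> Cmod (g i) <= B / INR n).
  { intros i Hi. apply kick_coef_le; [lia|]. now apply HkB. }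
  assert (HBn : 0 <= B / INR n) by (apply Rle_div_r; lra).
  assert (L1 : Cmod (csum g m - csum g 0)%C <= B / INR n * INR m).
  { eapply Rle_trans; [apply (csum_diff_le g (B / INR n)); [lia|]|].
    - intros i Hi. apply Hg. lia.
    - simpl INR at 3. right. ring. }
  assert (L2 : Cmod (csum g (n - 1) - csum g (n - m))%C <= B / INR n * INR m).
  { eapply Rle_trans; [apply (csum_diff_le g (B / INR n)); [lia|]|].
    - intros i Hi. apply Hg. lia.
    - apply Rmult_le_compat_l; [assumption|]. rewrite !minus_INR by lia. simpl. lra. }
  assert (L3 : Cmod (csum g (n - 1))%C <= (K + 16 * S) / INR n + omega n).
  { assert (E : (2 * csum g (n - 1))%C
      = (csum (fun i => g i + g (n - 2 - i)%nat)%C (n - 1) - csum (fun i => g i + g (n - 2 - i)%nat)%C 0)%C).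
    { rewrite csum_plus. rewrite <- (csum_reverse g (n - 1)) at 2.
      rewrite (csum_ext (fun i => g (n - 2 - i)%nat) (fun i => g (n - 1 - 1 - i)%nat))
        by (intros; f_equal; lia).
      rewrite csum_reverse. simpl. ring. }
    assert (T := csum_diff_le (fun i => g i + g (n - 2 - i)%nat)%C
      ((2 * (K + 16 * S) / INR n + 2 * omega n) / INR n) 0 (n - 1) ltac:(lia)).
    rewrite <- E, Cmod_mult, Cmod_R, Rabs_right in T by lra.
    assert (T' := T ltac:(intros; apply kick_coef_pair_le; lia)).
    rewrite minus_INR in T' by lia. simpl INR in T'.
    assert (Hw := omega_nonneg n ltac:(lia)).
    assert (HX : 0 <= 2 * (K + 16 * S) / INR n + 2 * omega n).
    { assert (0 <= 2 * (K + 16 * S) / INR n) by (apply Rle_div_r; lra). lra. }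
    apply Rmult_le_reg_l with 2; [lra|]. eapply Rle_trans; [exact T'|].
    apply Rle_trans with (2 * (K + 16 * S) / INR n + 2 * omega n).
    - unfold Rdiv at 1. rewrite Rmult_assoc.
      rewrite <- (Rmult_1_r (2 * (K + 16 * S) / INR n + 2 * omega n)) at 2.
      apply Rmult_le_compat_l; [assumption|].
      apply Rmult_le_reg_l with (INR n); [lra|]. rewrite <- Rmult_assoc, Rinv_r by lra. lra.
    - right. field. lra. }
  replace (csum g (n - m) - csum g m)%C with (csum g (n - 1) - (csum g (n - 1) - csum g (n - m))
    - (csum g m - csum g 0))%C by (simpl; ring).
  eapply Rle_trans; [cbound|].
  assert (T1 := H1 n ltac:(lia)). assert (T2 := H2 n ltac:(lia)).
  assert (T3 : 8 * M / Rpower (INR n) alpha <= h / 2).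
  { apply Rle_div_l; [apply exp_pos|]. apply Rle_div_l in T2; [|assumption]. lra. }
  unfold omega.
  replace (Tc / INR n) with ((K + 16 * S) / INR n + D ^ 2 / INR n + B / INR n * INR m + B / INR n * INR m)
    in T1 by (unfold Tc; field; lra).
  lra.
Qed.

End Kicks.

(** * Entering and leaving the gate *)

Lemma Ccont_comp (g h : C -> C) (z : C) : Ccont h z -> Ccont g (h z) -> Ccont (fun y => g (h y)) z.
Proof.
  intros Hh Hg e He. destruct (Hg e He) as (d & Hd & H1). destruct (Hh d Hd) as (d' & Hd' & H2).
  exists d'. split; [assumption|]. intros y Hy. now apply H1, H2.
Qed.

Lemma Ccont_opp_inv (Z : C) : Z <> RtoC 0 -> Ccont (fun y => (- / y)%C) Z.
Proof.
  intros HZ e He. assert (Hm : 0 < Cmod Z) by now apply Cmod_gt_0.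
  set (t := Cmod Z) in *.
  assert (Ht2 : 0 < e * t ^ 2) by (apply Rmult_lt_0_compat; [assumption|nra]).
  assert (Hp : 0 < e * t ^ 2 / 2) by lra.
  exists (Rmin (t / 2) (e * t ^ 2 / 2)). split; [apply Rmin_glb_lt; lra|].
  intros y Hy. assert (H1 := Rlt_le_trans _ _ _ Hy (Rmin_l _ _)).
  assert (H2 := Rlt_le_trans _ _ _ Hy (Rmin_r _ _)).
  assert (Hyt : t / 2 < Cmod y).
  { assert (T := Cmod_sub_ge Z (Z - y)). rewrite (Cmod_minus_sym Z y) in T.
    replace (Z - (Z - y))%C with y in T by ring. fold t in T. lra. }
  assert (Hy0 : y <> RtoC 0) by (apply Cmod_gt_0; lra).
  replace (- / y - - / Z)%C with ((y - Z) / (y * Z))%C by (field; split; assumption).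
  rewrite Cmod_div, Cmod_mult by (intros E; apply Cmult_neq_0 in E; assumption).
  fold t. apply Rlt_div_l; [nra|].
  assert (e * (t / 2 * t) <= e * (Cmod y * t)) by (apply Rmult_le_compat_l; nra). nra.
Qed.

Lemma limit_on_petal (D : C -> Prop) (F : C -> C) :
  filterlim F (within D (locally (RtoC 0))) (locally (RtoC 0)) ->
  forall e, 0 < e -> exists d, 0 < d /\ forall w, D w -> Cmod w < d -> Cmod (F w) < e.
Proof.
  intros H e He.
  assert (HP : locally (T := C_UniformSpace) (RtoC 0) (fun y => Cmod y < e)).
  { apply locally_Cmod. exists e. split; [assumption|]. intros y Hy.
    now replace (y - 0)%C with y in Hy by ring. }
  specialize (H _ HP). unfold filtermap, within in H.
  apply locally_Cmod in H. destruct H as (d & Hd & H). exists d. split; [assumption|].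
  intros w Hw Hwd. apply H; [|assumption]. now replace (w - 0)%C with w by ring.
Qed.

(** The region [|Z| >= 1/(2r)] contains the images of both petals under [-1/w]. The bound 1/4 makes
    the real part of [Z] grow by at least 3/4 per step. *)
Definition near_translation (f : C -> C) (U : C -> Prop) (K r : R) : Prop :=
  forall Z : C, / (2 * r) <= Cmod Z ->
    U (- / Z)%C /\ f (- / Z)%C <> RtoC 0 /\
    Cmod (- / f (- / Z) - (Z + 1))%C <= K / Cmod Z /\ K / Cmod Z <= 1 / 4.

Lemma petal_step (f : C -> C) (U : C -> Prop) (a : C) :
  open U -> U (RtoC 0) -> parabolic_expansion f a ->
  exists K r0 : R, 0 <= K /\ 0 < r0 /\ forall r, 0 < r < r0 -> 4 < / (2 * r) /\
    near_translation f U K r.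
Proof.
  intros HU HU0 Hf. destruct (inv_coordinate_step f a Hf) as (K & rho & HK & Hrho & H).
  destruct (proj1 (locally_Cmod _ _) (HU _ HU0)) as (d & Hd & HdU).
  assert (Hdi : 0 < / d) by now apply Rinv_0_lt_compat.
  set (R0 := rho + 4 * K + / d + 4).
  assert (HR0 : 0 < R0) by (unfold R0; lra).
  exists K, (/ (2 * R0)). split; [assumption|].
  assert (Hi : 0 < / (2 * R0)) by (apply Rinv_0_lt_compat; lra).
  split; [assumption|]. intros r [Hr Hr0].
  assert (HR : R0 < / (2 * r)).
  { rewrite <- (Rinv_inv R0). apply Rinv_lt_contravar.
    - apply Rmult_lt_0_compat; [lra|apply Rinv_0_lt_compat; lra].
    - rewrite Rinv_mult in Hr0. lra. }
  split; [unfold R0 in HR; lra|]. intros Z HZ.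
  assert (HZ' : R0 < Cmod Z) by lra. unfold R0 in HZ'.
  assert (HZ0 : Z <> RtoC 0) by (apply Cmod_gt_0; lra).
  destruct (H Z ltac:(lra)) as [H1 H2]. repeat split; [|assumption..|].
  - apply HdU. replace (- / Z - 0)%C with (- / Z)%C by ring. rewrite Cmod_opp_inv by assumption.
    rewrite <- (Rinv_inv d). apply Rinv_lt_contravar; [|lra].
    apply Rmult_lt_0_compat; lra.
  - apply Rle_div_l; lra.
Qed.

Lemma fst_le_Cmod (z : C) : fst z <= Cmod z.
Proof. eapply Rle_trans; [apply Rle_abs|apply Rabs_fst_le]. Qed.

Lemma fst_ge_opp_Cmod (z : C) : - Cmod z <= fst z.
Proof. assert (H := Rabs_fst_le z). apply Rabs_le_between in H. lra. Qed.

Lemma fst_dist (z w : C) (b : R) : Cmod (z - w)%C <= b -> fst w - b <= fst z <= fst w + b.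
Proof.
  intros H. assert (T := Rabs_fst_le (z - w)). simpl in T.
  apply Rabs_le_between in T. lra.
Qed.

Lemma iterate_add (f : C -> C) (i j : nat) (w : C) :
  iterate f (i + j) w = iterate f i (iterate f j w).
Proof. unfold iterate. induction i as [|i IH]; simpl; [reflexivity|now rewrite IH]. Qed.

(** A window of size [sqrt m] around [m] is small compared with [m], so the logarithm in the
    normalization is [- ln m + o(1)] uniformly over it. *)
Lemma attracting_asymptotics (f : C -> C) (a : C) (r : R) (phi : C -> C) : 0 < r ->
  attracting_Fatou_coordinate f a r phi ->
  forall K e : R, 0 < e -> exists m1 : nat, forall (m : nat) (Z : C), (m1 <= m)%nat ->
    Cmod (Z - INR m)%C <= K * sqrt (INR m) ->
    Cmod (phi (- / Z) - (Z - (1 - a) * ln (INR m)))%C < e.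
Proof.
  intros Hr (_ & _ & Hlim) K e He.
  assert (Ha : 0 <= Cmod (1 - a)%C) by apply Cmod_ge_0.
  destruct (limit_on_petal _ _ Hlim (e / 2) ltac:(lra)) as (d & Hd & H).
  destruct (Clog_inv_near (e / 2 / (Cmod (1 - a)%C + 1))) as (d' & Hd' & HL).
  { apply Rdiv_lt_0_compat; lra. }
  set (b := Rmin d' (1 / 2)).
  assert (Hb : 0 < b) by (apply Rmin_glb_lt; lra).
  assert (Hb1 : b <= d') by apply Rmin_l. assert (Hb2 : b <= 1 / 2) by apply Rmin_r.
  destruct (INR_unbounded ((Rabs K / b) ^ 2 + 2 / d + 2 * / (2 * r) + 1)) as [m1 Hm1].
  assert (Hdd : 0 < 2 / d) by (apply Rdiv_lt_0_compat; lra).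
  assert (Hrr : 0 < / (2 * r)) by (apply Rinv_0_lt_compat; lra).
  assert (HKb : 0 <= Rabs K / b) by (apply Rle_div_r; [assumption|]; assert (T := Rabs_pos K); lra).
  exists m1. intros m Z Hm HZ. apply le_INR in Hm.
  assert (Hq : 0 <= (Rabs K / b) ^ 2) by apply pow2_ge_0.
  assert (Hmp : 1 < INR m) by lra.
  assert (Hs : Rabs K / b <= sqrt (INR m)).
  { rewrite <- (sqrt_pow2 (Rabs K / b)) by assumption. apply sqrt_le_1_alt. lra. }
  assert (Hs0 := sqrt_sqrt (INR m) ltac:(lra)). assert (Hsp := sqrt_lt_R0 (INR m) ltac:(lra)).
  assert (HZb : Cmod (Z - INR m)%C <= b * INR m).
  { eapply Rle_trans; [exact HZ|]. apply Rle_div_l in Hs; [|assumption].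
    assert (T := Rle_abs K).
    assert (T2 : K * sqrt (INR m) <= sqrt (INR m) * b * sqrt (INR m))
      by (apply Rmult_le_compat_r; lra).
    assert (T3 : b * (sqrt (INR m) * sqrt (INR m)) = b * INR m) by (now rewrite Hs0). lra. }
  assert (HZ' : INR m / 2 <= fst Z).
  { assert (T := fst_dist _ _ _ HZb). simpl in T. nra. }
  assert (HZm : INR m / 2 <= Cmod Z) by (assert (T := fst_le_Cmod Z); lra).
  assert (HZ0 : Z <> RtoC 0) by (apply Cmod_gt_0; lra).
  assert (Hw : attracting_petal r (- / Z)%C) by (apply attracting_petal_inv; try assumption; lra).
  assert (Hwd : Cmod (- / Z)%C < d).
  { rewrite Cmod_opp_inv by assumption. rewrite <- (Rinv_inv d).
    apply Rinv_lt_contravar; [apply Rmult_lt_0_compat; [apply Rinv_0_lt_compat|]; lra|].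
    unfold Rdiv in Hm1. lra. }
  specialize (H _ Hw Hwd). rewrite opp_inv_invol in H by assumption.
  replace (- - / Z)%C with (/ Z)%C in H by ring.
  specialize (HL (INR m) Z ltac:(lra)).
  assert (HZd : Cmod (Z - INR m)%C <= d' * INR m) by nra.
  specialize (HL HZd).
  replace (phi (- / Z) - (Z - (1 - a) * ln (INR m)))%C with
    ((phi (- / Z) - (Z + (1 - a) * Clog (/ Z))) + (1 - a) * (Clog (/ Z) + ln (INR m)))%C by ring.
  eapply Rle_lt_trans; [apply Cmod_triangle|]. rewrite Cmod_mult.
  apply Rlt_div_r in HL; [|lra]. assert (T := Cmod_ge_0 (Clog (/ Z) + ln (INR m))%C). nra.
Qed.

(** The margin [2 * / (2 * r)], twice as far as the edge of the petal, leaves room for one more step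
    of [f] inside the petal, as the Abel equation demands. *)
Lemma repelling_asymptotics (f : C -> C) (a : C) (r : R) (phi : C -> C) : 0 < r ->
  repelling_Fatou_coordinate f a r phi ->
  forall K e : R, 0 < e -> exists m1 : nat, forall (m : nat) (Z : C), (m1 <= m)%nat ->
    Cmod (Z + INR m)%C <= K * sqrt (INR m) ->
    fst Z < - (2 * / (2 * r)) /\ repelling_petal r (- / Z)%C /\
    Cmod (phi (- / Z) - (Z - (1 - a) * ln (INR m)))%C < e.
Proof.
  intros Hr (_ & _ & Hlim) K e He.
  assert (Ha : 0 <= Cmod (1 - a)%C) by apply Cmod_ge_0.
  destruct (limit_on_petal _ _ Hlim (e / 2) ltac:(lra)) as (d & Hd & H).
  destruct (Clog_inv_near (e / 2 / (Cmod (1 - a)%C + 1))) as (d' & Hd' & HL).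
  { apply Rdiv_lt_0_compat; lra. }
  set (b := Rmin d' (1 / 2)).
  assert (Hb : 0 < b) by (apply Rmin_glb_lt; lra).
  assert (Hb1 : b <= d') by apply Rmin_l. assert (Hb2 : b <= 1 / 2) by apply Rmin_r.
  destruct (INR_unbounded ((Rabs K / b) ^ 2 + 2 / d + 4 * / (2 * r) + 1)) as [m1 Hm1].
  assert (Hdd : 0 < 2 / d) by (apply Rdiv_lt_0_compat; lra).
  assert (Hrr : 0 < / (2 * r)) by (apply Rinv_0_lt_compat; lra).
  assert (HKb : 0 <= Rabs K / b) by (apply Rle_div_r; [assumption|]; assert (T := Rabs_pos K); lra).
  exists m1. intros m Z Hm HZ. apply le_INR in Hm.
  assert (Hq : 0 <= (Rabs K / b) ^ 2) by apply pow2_ge_0.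
  assert (Hmp : 1 < INR m) by lra.
  assert (Hs : Rabs K / b <= sqrt (INR m)).
  { rewrite <- (sqrt_pow2 (Rabs K / b)) by assumption. apply sqrt_le_1_alt. lra. }
  assert (Hs0 := sqrt_sqrt (INR m) ltac:(lra)). assert (Hsp := sqrt_lt_R0 (INR m) ltac:(lra)).
  assert (HZb : Cmod (- Z - INR m)%C <= b * INR m).
  { replace (- Z - INR m)%C with (- (Z + INR m))%C by ring. rewrite Cmod_opp.
    eapply Rle_trans; [exact HZ|]. apply Rle_div_l in Hs; [|assumption].
    assert (T := Rle_abs K).
    assert (T2 : K * sqrt (INR m) <= sqrt (INR m) * b * sqrt (INR m))
      by (apply Rmult_le_compat_r; lra).
    assert (T3 : b * (sqrt (INR m) * sqrt (INR m)) = b * INR m) by (now rewrite Hs0). lra. }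
  assert (HZ' : fst Z <= - (INR m / 2)).
  { assert (T := fst_dist _ _ _ HZb). simpl in T. nra. }
  assert (HZm : INR m / 2 <= Cmod Z) by (assert (T := fst_ge_opp_Cmod Z); lra).
  assert (HZ0 : Z <> RtoC 0) by (apply Cmod_gt_0; lra).
  assert (Hw : repelling_petal r (- / Z)%C) by (apply repelling_petal_inv; try assumption; lra).
  assert (Hwd : Cmod (- / Z)%C < d).
  { rewrite Cmod_opp_inv by assumption. rewrite <- (Rinv_inv d).
    apply Rinv_lt_contravar; [apply Rmult_lt_0_compat; [apply Rinv_0_lt_compat|]; lra|].
    unfold Rdiv in Hm1. lra. }
  specialize (H _ Hw Hwd). rewrite opp_inv_invol in H by assumption.
  split; [lra|]. split; [assumption|].
  assert (Ei : (/ - Z)%C = (- / Z)%C).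
  { field. assumption. }
  assert (HZd : Cmod (- Z - INR m)%C <= d' * INR m) by nra.
  specialize (HL (INR m) (- Z)%C ltac:(lra) HZd). rewrite Ei in HL.
  replace (phi (- / Z) - (Z - (1 - a) * ln (INR m)))%C with
    ((phi (- / Z) - (Z + (1 - a) * Clog (- / Z))) + (1 - a) * (Clog (- / Z) + ln (INR m)))%C by ring.
  eapply Rle_lt_trans; [apply Cmod_triangle|]. rewrite Cmod_mult.
  apply Rlt_div_r in HL; [|lra]. assert (T := Cmod_ge_0 (Clog (- / Z) + ln (INR m))%C). nra.
Qed.

(** The real part of [Z] stays above [4 + i / 2], so the deviations [K / |Z|] from the unit
    translation are dominated by the telescoping terms [4 K (sqrt (i + 1) - sqrt i)]. *)
Lemma attracting_orbit (f : C -> C) (U : C -> Prop) (K r : R) (w0 : C) (m0 : nat) :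
  0 <= K -> 0 < r -> 4 < / (2 * r) ->
  near_translation f U K r ->
  attracting_petal r (iterate f m0 w0) ->
  forall i : nat, attracting_petal r (iterate f (m0 + i) w0) /\ U (iterate f (m0 + i) w0) /\
    4 + INR i / 2 <= fst (- / iterate f (m0 + i) w0)%C /\
    Cmod (- / iterate f (m0 + i) w0 - - / iterate f m0 w0 - INR i)%C <= 4 * K * sqrt (INR i).
Proof.
  intros HK Hr H4 Hstep Hm0 i.
  set (W := fun i => iterate f (m0 + i) w0).
  assert (HW0 : W 0%nat = iterate f m0 w0) by (unfold W; now rewrite Nat.add_0_r).
  assert (HWS : forall i, W (S i) = f (W i)) by (intros; unfold W; now rewrite Nat.add_succ_r).
  rewrite <- HW0 in *. change (iterate f (m0 + i) w0) with (W i). clearbody W. clear HW0.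
  cut (W i <> RtoC 0 /\ / (2 * r) < fst (- / W i)%C /\ 4 + INR i / 2 <= fst (- / W i)%C /\
       Cmod (- / W i - - / W 0%nat - INR i)%C <= 4 * K * sqrt (INR i)).
  { intros (A1 & A2 & A3 & A4). assert (A5 := opp_inv_neq0 _ A1).
    repeat split; try assumption.
    - rewrite <- (opp_inv_invol (W i)) by assumption. now apply attracting_petal_inv.
    - rewrite <- (opp_inv_invol (W i)) by assumption. apply Hstep.
      assert (T := fst_le_Cmod (- / W i)). lra. }
  induction i as [|i (A1 & A2 & A3 & A4)].
  - assert (A1 := attracting_petal_neq0 _ _ Hm0). assert (A5 := opp_inv_neq0 _ A1).
    assert (A2 : / (2 * r) < fst (- / W 0%nat)%C).
    { apply attracting_petal_inv; try assumption. now rewrite opp_inv_invol. }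
    split; [assumption|]. split; [assumption|]. simpl INR. split; [lra|].
    replace (- / W 0%nat - - / W 0%nat - 0)%C with (RtoC 0) by ring.
    rewrite Cmod_0, sqrt_0. lra.
  - set (Z := (- / W i)%C) in *.
    assert (HZ : fst Z <= Cmod Z) by apply fst_le_Cmod.
    destruct (Hstep Z ltac:(lra)) as (_ & B1 & B2 & B3).
    assert (EW : (- / Z)%C = W i) by now apply opp_inv_invol.
    rewrite EW, <- HWS in B1, B2.
    assert (B4 := Rle_trans _ _ _ B2 B3).
    assert (B5 := fst_dist _ _ _ B4). change (fst (Z + 1)%C) with (fst Z + 1) in B5.
    split; [assumption|]. rewrite S_INR.
    split; [lra|]. split; [lra|].
    rewrite RtoC_plus.
    replace (- / W (S i) - - / W 0%nat - (INR i + 1))%C with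
      ((- / W (S i) - (Z + 1)) + (Z - - / W 0%nat - INR i))%C by ring.
    eapply Rle_trans; [apply Cmod_triangle|].
    assert (HI := pos_INR i).
    assert (Hst : K / Cmod Z <= 4 * K * (sqrt (INR i + 1) - sqrt (INR i))).
    { assert (S1 := sqrt_pos (INR i)). assert (S2 := sqrt_sqrt (INR i) HI).
      assert (S3 := sqrt_sqrt (INR i + 1) ltac:(lra)).
      assert (S4 := sqrt_lt_R0 (INR i + 1) ltac:(lra)).
      assert (S5 : sqrt (INR i) <= sqrt (INR i + 1)) by (apply sqrt_le_1_alt; lra).
      assert (S6 : 1 <= sqrt (INR i + 1)) by (rewrite <- sqrt_1 at 1; apply sqrt_le_1_alt; lra).
      set (s := sqrt (INR i)) in *. set (t := sqrt (INR i + 1)) in *.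
      apply Rle_div_l; [lra|].
      replace (4 * K * (t - s) * Cmod Z) with (K * (4 * ((t - s) * Cmod Z))) by ring.
      rewrite <- (Rmult_1_r K) at 1. apply Rmult_le_compat_l; [assumption|].
      assert (Hts : (t - s) * (t + s) = 1) by nra.
      assert (t + s <= 2 * t) by lra.
      assert (HtZ : t * t <= 2 * Cmod Z) by lra.
      assert (t <= t * t) by nra.
      assert ((t - s) * (2 * t) >= 1) by nra.
      assert ((t - s) * (t * t) <= (t - s) * (2 * Cmod Z)) by (apply Rmult_le_compat_l; lra).
      assert ((t - s) * t <= (t - s) * (t * t)) by (apply Rmult_le_compat_l; lra). lra. }
    lra.
Qed.

(** The limit is the attracting asymptotics rewritten with [phi (f^m w0) = zeta + m]; the [sqrt m]
    window that it requires comes from [attracting_orbit]. *)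
Lemma entry (f : C -> C) (U : C -> Prop) (a : C) (K r : R) (phi : C -> C) (w0 : C) :
  holomorphic_on U f -> 0 <= K -> 0 < r -> 4 < / (2 * r) ->
  near_translation f U K r ->
  attracting_Fatou_coordinate f a r phi -> parabolic_basin f U r w0 ->
  (forall m, Ccont f (iterate f m w0)) /\
  exists (C0 : R) (m0 : nat), 0 <= C0 /\
    (forall m, (m0 <= m)%nat -> iterate f m w0 <> RtoC 0 /\
       Cmod (- / iterate f m w0 - INR m)%C <= C0 * sqrt (INR m)) /\
    forall e, 0 < e -> exists m1, forall m, (m1 <= m)%nat ->
      Cmod (- / iterate f m w0 - INR m - (1 - a) * ln (INR m)
            - extended_attracting_coordinate f phi w0)%C < e.
Proof.
  intros Hhol HK Hr H4 Hstep Hphi (m0 & Hiter & Hm0).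
  assert (Horb := attracting_orbit f U K r w0 m0 HK Hr H4 Hstep Hm0).
  split.
  { intros m. apply ex_derive_Ccont, Hhol.
    destruct (Nat.lt_ge_cases m m0) as [L|L]; [now apply Hiter|].
    replace m with (m0 + (m - m0))%nat by lia. apply Horb. }
  set (C0 := Cmod (- / iterate f m0 w0)%C + INR m0 + 4 * K).
  assert (HC0 : 0 <= C0).
  { assert (T1 := Cmod_ge_0 (- / iterate f m0 w0)%C). assert (T2 := pos_INR m0). unfold C0. lra. }
  assert (Hdist : forall m, (m0 + 1 <= m)%nat -> iterate f m w0 <> RtoC 0 /\
       Cmod (- / iterate f m w0 - INR m)%C <= C0 * sqrt (INR m)).
  { intros m Hm. destruct (Horb (m - m0)%nat) as (A1 & _ & _ & A4).
    replace (m0 + (m - m0))%nat with m in * by lia.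
    split; [now apply attracting_petal_neq0 with r|].
    rewrite minus_INR, RtoC_minus in A4 by lia.
    replace (- / iterate f m w0 - INR m)%C with
      ((- / iterate f m w0 - - / iterate f m0 w0 - (INR m - INR m0)) + - / iterate f m0 w0 - INR m0)%C
      by ring.
    eapply Rle_trans; [apply Cmod_minus_le; [apply Cmod_add_le; [exact A4|apply Rle_refl]|apply Rle_refl]|].
    rewrite (Cmod_R (INR m0)), (Rabs_right (INR m0)) by (apply Rle_ge, pos_INR).
    assert (S1 := sqrt_ge_1 m ltac:(lia)).
    assert (S2 : sqrt (INR m - INR m0) <= sqrt (INR m))
      by (apply sqrt_le_1_alt; assert (T := pos_INR m0); lra).
    assert (T1 := Cmod_ge_0 (- / iterate f m0 w0)%C). assert (T2 := pos_INR m0).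
    unfold C0. nra. }
  assert (Hfun : forall i, phi (iterate f (m0 + i) w0) = (phi (iterate f m0 w0) + INR i)%C).
  { induction i as [|i IH].
    - rewrite Nat.add_0_r. simpl. ring.
    - rewrite Nat.add_succ_r, S_INR, RtoC_plus. simpl.
      change (Nat.iter (m0 + i) f w0) with (iterate f (m0 + i) w0).
      destruct Hphi as (_ & Hphi & _). rewrite Hphi by apply Horb. rewrite IH. ring. }
  set (zeta := extended_attracting_coordinate f phi w0).
  assert (Hzeta : eventually (fun m : nat => zeta = (phi (iterate f m w0) - INR m)%C)).
  (* A stable value exists: by the Abel equation [phi (f^m w0) - m] is constant from [m0] on. *)
  { unfold zeta, extended_attracting_coordinate. apply epsilon_spec.
    exists (phi (iterate f m0 w0) - INR m0)%C. exists m0. intros m Hm.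
    replace m with (m0 + (m - m0))%nat at 1 by lia. rewrite Hfun, minus_INR, RtoC_minus by lia. ring. }
  destruct Hzeta as [N HN].
  exists C0, (m0 + 1)%nat. split; [assumption|]. split; [assumption|].
  intros e He. destruct (attracting_asymptotics f a r phi Hr Hphi C0 e He) as [m1 Hm1].
  exists (m1 + N + m0 + 1)%nat. intros m Hm.
  destruct (Hdist m ltac:(lia)) as [D1 D2].
  assert (T := Hm1 m _ ltac:(lia) D2). rewrite opp_inv_invol in T by assumption.
  rewrite (HN m) by lia. rewrite <- Cmod_opp.
  replace (- (- / iterate f m w0 - INR m - (1 - a) * ln (INR m) - (phi (iterate f m w0) - INR m)))%C
    with (phi (iterate f m w0) - (- / iterate f m w0 - (1 - a) * ln (INR m)))%C by ring.
  exact T.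
Qed.

(** Continuity over a fixed number of steps, uniform in the starting index [k]: it serves both for
    the first steps from [w0] and for the last steps before [n]. *)
Lemma perturbed_orbit_close (f : C -> C) (eps : nat -> nat -> C) (v : C) (m : nat) :
  (forall i, (i < m)%nat -> Ccont f (iterate f i v)) ->
  (forall h, 0 < h -> exists N, forall n k, (N <= n)%nat -> (k < n)%nat ->
     Cmod (eps k n ^ 2)%C <= h) ->
  forall e, 0 < e -> exists (d : R) (N : nat), 0 < d /\
    forall n k w0, (N <= n)%nat -> (k + m <= n)%nat ->
      Cmod (perturbed_orbit f eps n w0 k - v)%C < d ->
      Cmod (perturbed_orbit f eps n w0 (k + m) - iterate f m v)%C < e.
Proof.
  intros Hc Heps. induction m as [|m IH]; intros e He.
  - exists e, 0%nat. split; [assumption|]. intros n k w0 _ _ H. now rewrite Nat.add_0_r.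
  - destruct (Hc m ltac:(lia) (e / 2) ltac:(lra)) as (d1 & Hd1 & H1).
    destruct (IH ltac:(intros; apply Hc; lia) d1 Hd1) as (d & N1 & Hd & H2).
    destruct (Heps (e / 2) ltac:(lra)) as (N2 & H3).
    exists d, (N1 + N2)%nat. split; [assumption|]. intros n k w0 Hn Hk H.
    rewrite Nat.add_succ_r.
    change (perturbed_orbit f eps n w0 (S (k + m))) with
      (f (perturbed_orbit f eps n w0 (k + m)) + eps (k + m)%nat n ^ 2)%C.
    change (iterate f (S m) v) with (f (iterate f m v)).
    replace (f (perturbed_orbit f eps n w0 (k + m)) + eps (k + m)%nat n ^ 2 - f (iterate f m v))%C
      with ((f (perturbed_orbit f eps n w0 (k + m)) - f (iterate f m v)) + eps (k + m)%nat n ^ 2)%C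
      by ring.
    eapply Rle_lt_trans; [apply Cmod_triangle|].
    assert (T1 := H1 _ (H2 n k w0 ltac:(lia) ltac:(lia) H)).
    assert (T2 := H3 n (k + m)%nat ltac:(lia) ltac:(lia)). lra.
Qed.

(** * Limits of the Moebius coordinate at the two ends of the gate *)

Lemma ref_point_limit (n m : nat) : (1 <= m)%nat -> (m + 1 <= n)%nat -> step_eps n * INR m <= 1 ->
  Rabs (ref_point n m + / INR m) <= 2 * step_eps n ^ 2 * INR m.
Proof.
  intros Hm Hn H. assert (He := step_eps_pos n ltac:(lia)). assert (Im := INR_ge_1 m Hm).
  assert (Hs := ref_sin_pos n m Hm Hn).
  unfold ref_point, ref_sin, ref_angle in *. set (e := step_eps n) in *.
  set (t := e * INR m) in *. assert (Ht : 0 < t) by (unfold t; nra).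
  assert (S1 := sin_ge_cubic t ltac:(lra)). assert (S2 := sin_le_self t ltac:(lra)).
  assert (S3 := sin_ge_third t ltac:(lra)).
  assert (C1 := cos_ge_quadratic t ltac:(lra)). assert (C2 := COS_bound t).
  replace (- (e * cos t / sin t) + / INR m) with ((sin t - t * cos t) / (INR m * sin t))
    by (unfold t; field; fold t; lra).
  assert (Hms : 0 < INR m * sin t) by (apply Rmult_lt_0_compat; lra).
  unfold Rdiv. rewrite Rabs_mult, (Rabs_right (/ _)) by (apply Rle_ge, Rlt_le, Rinv_0_lt_compat; lra).
  apply Rle_div_l; [assumption|].
  replace (2 * e ^ 2 * INR m * (INR m * sin t)) with (2 * t ^ 2 * sin t) by (unfold t; ring).
  assert (t ^ 3 = t * t ^ 2) by ring. assert (0 < t ^ 2) by nra.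
  assert (t * cos t <= t) by nra.
  assert (t * (1 - t ^ 2 / 2) <= t * cos t) by (apply Rmult_le_compat_l; lra).
  assert (t ^ 2 * (t / 3) <= t ^ 2 * sin t) by (apply Rmult_le_compat_l; lra).
  apply Rabs_le. split; lra.
Qed.

Lemma ref_point_sym (n m : nat) : (m <= n)%nat -> (1 <= n)%nat ->
  ref_point n (n - m) = - ref_point n m.
Proof.
  intros Hm Hn. unfold ref_point. rewrite ref_sin_sym by assumption.
  replace (ref_angle n (n - m)) with (- (ref_angle n m - PI)).
  - rewrite cos_neg. rewrite <- (cos_neg (ref_angle n m - PI)).
    replace (- (ref_angle n m - PI)) with (- ref_angle n m + PI) by ring.
    rewrite neg_cos, cos_neg. unfold Rdiv. ring.
  - unfold ref_angle. rewrite minus_INR, Rmult_minus_distr_l, step_eps_mult by assumption. ring.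
Qed.

Lemma reference_small (m : nat) (h : R) : (1 <= m)%nat -> 0 < h -> exists N : nat, (m + 2 <= N)%nat /\
  forall n, (N <= n)%nat -> step_eps n ^ 2 <= h /\ Rabs (ref_point n m + / INR m) <= h.
Proof.
  intros Hm Hh. assert (Im := INR_ge_1 m Hm).
  set (h' := Rmin (h / (2 * INR m)) (/ INR m)).
  assert (Hh' : 0 < h').
  { apply Rmin_glb_lt; [apply Rdiv_lt_0_compat; lra|apply Rinv_0_lt_compat; lra]. }
  destruct (inv_INR_small 4 h' Hh') as (N & HN & H). exists (N + m + 2)%nat. split; [lia|].
  intros n Hn. specialize (H n ltac:(lia)).
  assert (He := step_eps_pos n ltac:(lia)). assert (He4 := step_eps_le n ltac:(lia)).
  assert (M1 : h' <= h / (2 * INR m)) by apply Rmin_l.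
  assert (M2 : h' <= / INR m) by apply Rmin_r.
  assert (E1 : step_eps n <= h / (2 * INR m)) by lra.
  assert (E2 : step_eps n <= / INR m) by lra.
  apply Rle_div_r in E1; [|lra].
  assert (E3 : step_eps n * INR m <= 1).
  { apply Rmult_le_compat_r with (r := INR m) in E2; [|lra]. now rewrite Rinv_l in E2 by lra. }
  split; [nra|]. eapply Rle_trans; [apply ref_point_limit; [lia|lia|assumption]|]. nra.
Qed.

(** For [c = -1/m] and [e = 0] the coordinate [(w - c) / (w c + e^2)] equals [-1/w - m]. Its
    denominator tends to [-W / m], which is not 0, and [eta] keeps it above [|W| / (2 m)] in
    modulus. *)
Lemma entry_coordinate (m : nat) (W : C) (h : R) : (1 <= m)%nat -> W <> RtoC 0 -> 0 < h ->
  exists (d : R) (N : nat), 0 < d /\ forall n w, (N <= n)%nat -> Cmod (w - W)%C < d ->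
    exists u, w = mobius (ref_point n m) (step_eps n) u /\ Cmod (u - (- / W - INR m))%C <= h.
Proof.
  intros Hm HW Hh. assert (Im := INR_ge_1 m Hm).
  assert (HWp : 0 < Cmod W) by now apply Cmod_gt_0.
  set (b := (- / W - INR m)%C). set (bb := Cmod b). set (t := Cmod W) in *.
  assert (Hbb : 0 <= bb) by apply Cmod_ge_0.
  assert (Htm : 0 < t / (2 * INR m)) by (apply Rdiv_lt_0_compat; lra).
  set (Cn := 2 + bb * (3 + t)).
  assert (HCn : 0 < Cn) by (unfold Cn; nra).
  set (eta := Rmin 1 (Rmin (t / (2 * INR m) / (3 + t)) (h * (t / (2 * INR m)) / Cn))).
  assert (Heta : 0 < eta).
  { repeat apply Rmin_glb_lt; [lra|apply Rdiv_lt_0_compat; lra|apply Rdiv_lt_0_compat; [nra|lra]]. }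
  assert (E1 : eta <= 1) by apply Rmin_l.
  assert (E2 : eta * (3 + t) <= t / (2 * INR m)).
  { apply Rle_div_r; [lra|]. unfold eta. eapply Rle_trans; [apply Rmin_r|apply Rmin_l]. }
  assert (E3 : eta * Cn <= h * (t / (2 * INR m))).
  { apply Rle_div_r; [lra|]. unfold eta. eapply Rle_trans; [apply Rmin_r|apply Rmin_r]. }
  destruct (reference_small m eta Hm Heta) as (N & HNm & HN).
  exists eta, N. split; [assumption|]. intros n w Hn Hw.
  destruct (HN n Hn) as [Be Bg].
  set (c := RtoC (ref_point n m)). set (e := RtoC (step_eps n)).
  assert (Hm0 : RtoC (INR m) <> RtoC 0) by (intros E; injection E; lra).
  set (g := (c + / INR m)%C).
  assert (Bg' : Cmod g <= eta).
  { unfold g, c. rewrite <- RtoC_inv, <- RtoC_plus, Cmod_R by lra. assumption. }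
  assert (Be' : Cmod (e ^ 2)%C <= eta).
  { unfold e. rewrite <- RtoC_pow, Cmod_R, Rabs_right; [assumption|apply Rle_ge, pow2_ge_0]. }
  assert (Bim : Cmod (/ INR m)%C <= 1).
  { rewrite <- RtoC_inv, Cmod_R by lra. rewrite Rabs_right by (apply Rle_ge, Rlt_le, Rinv_0_lt_compat; lra).
    rewrite <- Rinv_1. apply Rinv_le_contravar; lra. }
  assert (Bc : Cmod c <= 2).
  { replace c with (g - / INR m)%C by (unfold g; ring). eapply Rle_trans; [cbound|]. lra. }
  set (p := (w - W)%C) in *. assert (Bp : Cmod p <= eta) by lra.
  assert (BW : Cmod W <= t) by apply Rle_refl. assert (Bb : Cmod b <= bb) by apply Rle_refl.
  assert (Eden : (w * c + e ^ 2)%C = (- (W / INR m) + (p * c + W * g + e ^ 2))%C).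
  { unfold p, g. field. assumption. }
  assert (Dden : t / (2 * INR m) <= Cmod (w * c + e ^ 2)%C).
  { rewrite Eden. assert (T := Cmod_add_ge (- (W / INR m)) (p * c + W * g + e ^ 2)).
    rewrite Cmod_opp, Cmod_div, (Cmod_R (INR m)), Rabs_right in T by (try assumption; lra).
    fold t in T.
    assert (T2 : Cmod (p * c + W * g + e ^ 2)%C <= eta * 2 + t * eta + eta) by cbound.
    replace (t / INR m) with (2 * (t / (2 * INR m))) in T by (field; lra). lra. }
  assert (Nden : (w * c + e ^ 2)%C <> RtoC 0) by (eapply Cneq0_of_ge; [|exact Dden]; lra).
  exists ((w - c) / (w * c + e ^ 2))%C. split.
  - unfold mobius. fold c e.
    assert (Nq : (c ^ 2 + e ^ 2)%C <> RtoC 0).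
    { unfold c, e. rewrite <- !RtoC_pow, <- RtoC_plus. intros E. injection E.
      assert (T := step_eps_pos n ltac:(lia)). assert (T2 := pow2_ge_0 (ref_point n m)). nra. }
    replace (1 - c * ((w - c) / (w * c + e ^ 2)))%C with ((c ^ 2 + e ^ 2) / (w * c + e ^ 2))%C
      by (field; assumption).
    replace (c + e ^ 2 * ((w - c) / (w * c + e ^ 2)))%C with (w * (c ^ 2 + e ^ 2) / (w * c + e ^ 2))%C
      by (field; assumption).
    field. split; assumption.
  - replace ((w - c) / (w * c + e ^ 2) - b)%C with
      ((p - g - b * (p * c + W * g) - b * e ^ 2) / (w * c + e ^ 2))%C.
    2: { unfold b. unfold p, g. field. repeat split; assumption. }
    eapply Rle_trans; [apply Cmod_div_le with (b := t / (2 * INR m)); [lra|cbound|exact Dden]|].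
    apply Rle_div_l; [lra|]. eapply Rle_trans; [|exact E3]. unfold Cn. right. ring.
Qed.

(** For [c = 1/m] and [e = 0], [mobius c e u] is [1 / (m - u)]. [N] must not depend on [u], which
    itself varies with [n]; the bound [|u| <= m / 4] provides this uniformity and keeps [1 - c u]
    away from 0. *)
Lemma exit_coordinate (m : nat) (h : R) : (1 <= m)%nat -> 0 < h ->
  exists N : nat, forall n u, (N <= n)%nat -> Cmod u <= INR m / 4 ->
    mobius (ref_point n (n - m)) (step_eps n) u <> RtoC 0 /\
    Cmod (- / mobius (ref_point n (n - m)) (step_eps n) u - (u - INR m))%C <= h.
Proof.
  intros Hm Hh. assert (Im := INR_ge_1 m Hm).
  set (M := INR m) in *.
  set (eta := Rmin (/ (4 * M ^ 2)) (h / (2 * M * (M + 2 * M ^ 2)))).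
  assert (Heta : 0 < eta).
  { apply Rmin_glb_lt; [apply Rinv_0_lt_compat; nra|apply Rdiv_lt_0_compat; nra]. }
  assert (E1 : eta * (4 * M ^ 2) <= 1).
  { apply Rle_div_r; [nra|]. unfold Rdiv. rewrite Rmult_1_l. apply Rmin_l. }
  assert (E2 : eta * (2 * M * (M + 2 * M ^ 2)) <= h).
  { apply Rle_div_r; [nra|]. apply Rmin_r. }
  destruct (reference_small m eta Hm Heta) as (N & HNm & HN). fold M in HN.
  exists N. intros n u Hn Hu. destruct (HN n Hn) as [Be Bg].
  rewrite ref_point_sym by lia.
  set (c := RtoC (- ref_point n m)). set (e := RtoC (step_eps n)).
  assert (HM0 : RtoC M <> RtoC 0) by (intros E; injection E; lra).
  set (g := (c - / M)%C).
  assert (Bg' : Cmod g <= eta).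
  { unfold g, c. rewrite <- RtoC_inv, <- RtoC_minus, Cmod_R by lra.
    replace (- ref_point n m - / M) with (- (ref_point n m + / M)) by ring. now rewrite Rabs_Ropp. }
  assert (Be' : Cmod (e ^ 2)%C <= eta).
  { unfold e. rewrite <- RtoC_pow, Cmod_R, Rabs_right; [assumption|apply Rle_ge, pow2_ge_0]. }
  assert (HiM : 0 < / M) by (apply Rinv_0_lt_compat; lra).
  assert (Bim : Cmod (/ M)%C = / M).
  { rewrite <- RtoC_inv, Cmod_R, Rabs_right by lra. reflexivity. }
  assert (HiM2 : M * / M = 1) by (apply Rinv_r; lra).
  assert (HetaM : eta * (4 * M) <= / M).
  { apply Rmult_le_reg_l with M; [lra|]. lra. }
  assert (Heta1 : 4 * eta <= / M) by nra.
  assert (Bc : Cmod c <= 2 * / M).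
  { replace c with (g + / M)%C by (unfold g; ring).
    eapply Rle_trans; [apply Cmod_triangle|]. rewrite Bim. lra. }
  assert (D1 : 1 / 2 <= Cmod (1 - c * u)%C).
  { eapply Rle_trans; [|apply one_minus_ge; cbound].
    replace (2 * / M * (M / 4)) with (1 / 2) by (field; lra). lra. }
  assert (N1 : (1 - c * u)%C <> RtoC 0) by (eapply Cneq0_of_ge; [|exact D1]; lra).
  assert (D2 : / (2 * M) <= Cmod (c + e ^ 2 * u)%C).
  { replace (c + e ^ 2 * u)%C with (/ M + (g + e ^ 2 * u))%C by (unfold g; ring).
    assert (T := Cmod_add_ge (/ M) (g + e ^ 2 * u)). rewrite Bim in T.
    assert (T2 : Cmod (g + e ^ 2 * u)%C <= eta + eta * (M / 4)) by cbound.
    rewrite Rinv_mult. lra. }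
  assert (H2M : 0 < / (2 * M)) by (apply Rinv_0_lt_compat; lra).
  assert (N2 : (c + e ^ 2 * u)%C <> RtoC 0) by (eapply Cneq0_of_ge; [|exact D2]; assumption).
  unfold mobius. fold c e. split.
  - intros E. apply N2. replace (c + e ^ 2 * u)%C with ((c + e ^ 2 * u) / (1 - c * u) * (1 - c * u))%C
      by (field; assumption).
    rewrite E. ring.
  - replace (- / ((c + e ^ 2 * u) / (1 - c * u)) - (u - M))%C with
      ((M * g - e ^ 2 * (u * (u - M))) / (c + e ^ 2 * u))%C.
    2: { unfold g. field. repeat split; assumption. }
    assert (BM : Cmod (RtoC M) <= M) by (rewrite Cmod_R, Rabs_right; lra).
    eapply Rle_trans; [apply Cmod_div_le with (b := / (2 * M)); [assumption|cbound|exact D2]|].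
    unfold Rdiv. rewrite Rinv_inv. eapply Rle_trans; [|exact E2]. nra.
Qed.

(** * Convergence to the Lavaurs map *)

(** The shift by [2 * INR m] arises in two halves: the entrance coordinate is about [-1/w - m], and
    the exit subtracts [m] once more. *)
Lemma transit (f : C -> C) (a : C) (eps : nat -> nat -> C) (w0 : C) (B C0 : R) (m0 : nat) :
  parabolic_expansion f a -> 0 <= B -> 0 <= C0 ->
  (forall n k, (k < n)%nat -> Cmod (kick eps n k) <= B / INR n ^ 3) ->
  (forall m h, (1 <= m)%nat -> 0 < h -> exists N : nat, forall n : nat, (N <= n)%nat ->
    Cmod (csum (kick_coef (kick eps n) n) (n - m) - csum (kick_coef (kick eps n) n) m)%C <= h) ->
  (forall h, 0 < h -> exists N, forall n k, (N <= n)%nat -> (k < n)%nat ->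
     Cmod (eps k n ^ 2)%C <= h) ->
  (forall m, Ccont f (iterate f m w0)) ->
  (forall m, (m0 <= m)%nat -> iterate f m w0 <> RtoC 0 /\
     Cmod (- / iterate f m w0 - INR m)%C <= C0 * sqrt (INR m)) ->
  exists (C1 : R) (M1 : nat), 0 <= C1 /\ forall m, (M1 <= m)%nat ->
    exists N, forall n, (N <= n)%nat ->
      perturbed_orbit f eps n w0 (n - m) <> RtoC 0 /\
      Cmod (- / perturbed_orbit f eps n w0 (n - m) - (- / iterate f m w0 - 2 * INR m))%C
        <= C1 / sqrt (INR m).
Proof.
  intros Hf HB HC0 HkB Hsum Heps Hcont HW.
  destruct (passage f a B (C0 + 1) Hf HB ltac:(lra)) as (K & m1 & HK & Hm1 & Hpass).
  (* Makes [sqrt m] large enough for [|u1| <= m / 4], as [exit_coordinate] requires. *)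
  destruct (INR_unbounded ((4 * (C0 + 1 + K)) ^ 2)) as [m2 Hm2].
  (* The passage contributes [K / sqrt m], the two changes of coordinate [1 / sqrt m] each. *)
  exists (K + 2), (m0 + m1 + m2)%nat. split; [lra|]. intros m Hm.
  assert (Im := INR_ge_1 m ltac:(lia)). assert (Sm := sqrt_ge_1 m ltac:(lia)).
  destruct (HW m ltac:(lia)) as [HW0 HWb].
  assert (Hh : 0 < / sqrt (INR m)) by (apply Rinv_0_lt_compat; lra).
  destruct (entry_coordinate m (iterate f m w0) _ ltac:(lia) HW0 Hh) as (d & N1 & Hd & H1).
  destruct (perturbed_orbit_close f eps w0 m ltac:(intros; apply Hcont) Heps d Hd)
    as (d' & N2 & Hd' & H2).
  destruct (Hsum m _ ltac:(lia) Hh) as (N3 & H3).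
  destruct (exit_coordinate m _ ltac:(lia) Hh) as (N4 & H4).
  exists (N1 + N2 + N3 + N4 + 2 * m)%nat. intros n Hn.
  set (w := perturbed_orbit f eps n w0).
  assert (Hwm : Cmod (w m - iterate f m w0)%C < d).
  { apply (H2 n 0%nat w0); [lia|lia|]. simpl.
    replace (w0 - w0)%C with (RtoC 0) by ring. rewrite Cmod_0. assumption. }
  destruct (H1 n (w m) ltac:(lia) Hwm) as (u0 & Eu0 & Bu0).
  set (b := (- / iterate f m w0 - INR m)%C) in *.
  assert (Hinv1 : / sqrt (INR m) <= 1) by (rewrite <- Rinv_1; apply Rinv_le_contravar; lra).
  assert (Bu0' : Cmod u0 <= (C0 + 1) * sqrt (INR m)).
  { replace u0 with ((u0 - b) + b)%C by ring.
    eapply Rle_trans; [apply Cmod_triangle|]. nra. }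
  destruct (Hpass n m ltac:(lia) ltac:(lia) (kick eps n) w u0) as (u1 & Eu1 & Bu1).
  - intros k Hk. now apply HkB.
  - intros k Hk. unfold w, kick. simpl perturbed_orbit. ring.
  - assumption.
  - assumption.
  - apply H3. lia.
  - assert (Bu1' : Cmod u1 <= INR m / 4).
    { replace u1 with ((u1 - u0) + u0)%C by ring.
      eapply Rle_trans; [apply Cmod_triangle|].
      assert (HKm : K / sqrt (INR m) <= K * sqrt (INR m)).
      { unfold Rdiv. apply Rmult_le_compat_l; lra. }
      assert (Hs : 4 * (C0 + 1 + K) <= sqrt (INR m)).
      { rewrite <- (sqrt_pow2 (4 * (C0 + 1 + K))) by lra. apply sqrt_le_1_alt.
        assert (T := le_INR m2 m ltac:(lia)). lra. }
      assert (E := sqrt_sqrt (INR m) ltac:(lra)). nra. }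
    destruct (H4 n u1 ltac:(lia) Bu1') as [G1 G2]. rewrite <- Eu1 in G1, G2.
    split; [assumption|].
    replace (- / w (n - m)%nat - (- / iterate f m w0 - 2 * INR m))%C with
      ((- / w (n - m)%nat - (u1 - INR m)) + (u1 - u0) + (u0 - b))%C
      by (unfold b; ring).
    eapply Rle_trans; [cbound|]. right. field. lra.
Qed.

(** * Inversion of the repelling Fatou coordinate *)

Lemma repelling_preimage (f : C -> C) (a : C) (r : R) (phi : C -> C) (zeta : C) : 0 < r ->
  repelling_Fatou_coordinate f a r phi ->
  exists (K : R) (m1 : nat), forall m, (m1 <= m)%nat -> exists Z : C,
    Cmod (Z + INR m)%C <= K * sqrt (INR m) /\ phi (- / Z)%C = (zeta - INR m)%C.
Proof.
  intros Hr Hphi. set (A := Cmod (1 - a)%C). assert (HA : 0 <= A) by apply Cmod_ge_0.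
  assert (Hz := Cmod_ge_0 zeta).
  set (K := Cmod zeta + 2 * A + 2).
  destruct (repelling_asymptotics f a r phi Hr Hphi K 1 ltac:(lra)) as [m1 H1].
  exists K, (m1 + 1)%nat. intros m Hm.
  assert (Im := INR_ge_1 m ltac:(lia)). assert (Sm := sqrt_ge_1 m ltac:(lia)).
  (* [Zs] solves the asymptotic equation [Z - (1 - a) ln m = zeta - m]; it is the centre of the
     box. *)
  set (L := ln (INR m)). set (Zs := (- INR m + zeta + (1 - a) * L)%C).
  assert (HL : Cmod (RtoC L) <= 2 * sqrt (INR m)).
  { rewrite Cmod_R, Rabs_right; [apply ln_le_sqrt; lra|].
    apply Rle_ge. unfold L. rewrite <- ln_1. apply ln_le; lra. }
  assert (HZm : forall x y, Rabs (x - fst Zs) <= 1 -> Rabs (y - snd Zs) <= 1 ->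
     Cmod ((x, y) + INR m)%C <= K * sqrt (INR m)).
  { intros x y Hx Hy.
    assert (T : Cmod ((x, y) - Zs)%C <= 2).
    { eapply Rle_trans; [apply Cmod_le_sum|].
      change (Rabs (x - fst Zs) + Rabs (y - snd Zs) <= 2). lra. }
    replace ((x, y) + INR m)%C with (((x, y) - Zs) + zeta + (1 - a) * L)%C by (unfold Zs; ring).
    assert (B1 : Cmod (1 - a)%C <= A) by apply Rle_refl.
    eapply Rle_trans; [cbound|]. unfold K. nra. }
  set (G := fun Z : C => (phi (- / Z) - (zeta - INR m))%C).
  assert (HG : forall x y, Rabs (x - fst Zs) <= 1 -> Rabs (y - snd Zs) <= 1 ->
     Cmod (G (x, y) - ((x, y) - Zs))%C < 1).
  { intros x y Hx Hy. destruct (H1 m (x, y) ltac:(lia) (HZm x y Hx Hy)) as (_ & _ & T).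
    replace (G (x, y) - ((x, y) - Zs))%C with (phi (- / (x, y)) - ((x, y) - (1 - a) * L))%C
      by (unfold G, Zs; ring). exact T. }
  assert (HG1 : forall x y, Rabs (x - fst Zs) <= 1 -> Rabs (y - snd Zs) <= 1 ->
     Rabs (fst (G (x, y)) - (x - fst Zs)) < 1 /\ Rabs (snd (G (x, y)) - (y - snd Zs)) < 1).
  { intros x y Hx Hy. assert (T := HG x y Hx Hy). split.
    - exact (Rle_lt_trans _ _ _ (Rabs_fst_le _) T).
    - exact (Rle_lt_trans _ _ _ (Rabs_snd_le _) T). }
  assert (Rp : forall t, Rabs (t + 1 - t) <= 1) by (intros; apply Rabs_le; lra).
  assert (Rm : forall t, Rabs (t - 1 - t) <= 1) by (intros; apply Rabs_le; lra).
  destruct (Poincare_Miranda G (fst Zs) (snd Zs) 1 ltac:(lra)) as (x & y & Hx & Hy & E).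
  - intros x y Hx Hy. destruct (H1 m (x, y) ltac:(lia) (HZm x y Hx Hy)) as (T1 & T2 & _).
    assert (Hrr : 0 < / (2 * r)) by (apply Rinv_0_lt_compat; lra).
    assert (HZ0 : (x, y) <> RtoC 0) by (intros E; rewrite E in T1; simpl in T1; lra).
    destruct Hphi as ((Hhol & _) & _).
    assert (Hc := Ccont_comp phi _ _ (Ccont_opp_inv _ HZ0) (ex_derive_Ccont _ _ (Hhol _ T2))).
    intros e He. destruct (Hc e He) as (d & Hd & H). exists d. split; [assumption|].
    intros Z HZ. unfold G.
    replace (phi (- / Z) - (zeta - INR m) - (phi (- / (x, y)) - (zeta - INR m)))%C
      with (phi (- / Z) - phi (- / (x, y)))%C by ring. now apply H.
  - intros y Hy. destruct (HG1 (fst Zs - 1) y (Rm _) Hy) as [T _]. apply Rabs_def2 in T. lra.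
  - intros y Hy. destruct (HG1 (fst Zs + 1) y (Rp _) Hy) as [T _]. apply Rabs_def2 in T. lra.
  - intros x Hx. destruct (HG1 x (snd Zs - 1) Hx (Rm _)) as [_ T]. apply Rabs_def2 in T. lra.
  - intros x Hx. destruct (HG1 x (snd Zs + 1) Hx (Rp _)) as [_ T]. apply Rabs_def2 in T. lra.
  - exists (x, y). split; [now apply HZm|].
    replace (phi (- / (x, y)))%C with (G (x, y) + (zeta - INR m))%C by (unfold G; ring).
    rewrite E. ring.
Qed.

Lemma repelling_petal_forward (f : C -> C) (r K : R) (Z : C) : 0 < r -> 4 < / (2 * r) ->
  f (- / Z)%C <> RtoC 0 -> Cmod (- / f (- / Z) - (Z + 1))%C <= K / Cmod Z -> K / Cmod Z <= 1 / 4 ->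
  fst Z < - (2 * / (2 * r)) -> repelling_petal r (f (- / Z)%C).
Proof.
  intros Hr H4 H0 H1 H2 HZ.
  assert (T := fst_dist _ _ _ (Rle_trans _ _ _ H1 H2)).
  change (fst (Z + 1)%C) with (fst Z + 1) in T.
  rewrite <- (opp_inv_invol (f (- / Z)%C)) by assumption.
  apply repelling_petal_inv; [assumption|now apply opp_inv_neq0|]. lra.
Qed.

(** The property behind the choice operator must be shown satisfiable. By injectivity the preimage
    [u] of [zeta - m] is unique, and [f] carries the preimage of [zeta - (m + 1)] to that of
    [zeta - m]; hence [f^m u] does not depend on the large number [m]. *)
Lemma extended_repelling_inverse_eq (f : C -> C) (U : C -> Prop) (a : C) (K r : R)
    (phi : C -> C) (zeta : C) :
  0 < r -> 4 < / (2 * r) ->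
  near_translation f U K r ->
  repelling_Fatou_coordinate f a r phi ->
  exists m1 : nat, forall m, (m1 <= m)%nat -> exists u : C,
    repelling_petal r u /\ phi u = (zeta - INR m)%C /\
    extended_repelling_inverse f r phi zeta = iterate f m u.
Proof.
  intros Hr H4 Hstep Hphi.
  destruct (repelling_preimage f a r phi zeta Hr Hphi) as (K1 & m1 & H1).
  destruct (repelling_asymptotics f a r phi Hr Hphi K1 1 ltac:(lra)) as [m2 H2].
  set (M := (m1 + m2)%nat).
  assert (Hsol : forall m, (M <= m)%nat -> exists Z : C,
    fst Z < - (2 * / (2 * r)) /\ repelling_petal r (- / Z)%C /\ phi (- / Z)%C = (zeta - INR m)%C).
  { intros m Hm. unfold M in Hm. destruct (H1 m ltac:(lia)) as (Z & HZ & EZ). exists Z.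
    destruct (H2 m Z ltac:(lia) HZ) as (T1 & T2 & _). auto. }
  assert (Hinj := Hphi). destruct Hinj as ((_ & Hinj) & Habel & _).
  assert (Hpull : forall m u, (M <= m)%nat -> repelling_petal r u -> phi u = (zeta - INR (S m))%C ->
    repelling_petal r (f u) /\ phi (f u) = (zeta - INR m)%C).
  { intros m u Hm Hu Eu. destruct (Hsol (S m) ltac:(lia)) as (Z & T1 & T2 & T3).
    (* Injectivity identifies [u] with the preimage found deep in the petal, where one more step of
       [f] stays inside. *)
    assert (E : u = (- / Z)%C) by (apply Hinj; congruence). subst u.
    assert (HZ := fst_ge_opp_Cmod Z). assert (Hrr : 0 < / (2 * r)) by (apply Rinv_0_lt_compat; lra).
    destruct (Hstep Z ltac:(lra)) as (_ & S1 & S2 & S3).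
    assert (Hf := repelling_petal_forward f r K Z Hr H4 S1 S2 S3 T1).
    split; [assumption|]. rewrite Habel by assumption. rewrite Eu, S_INR, RtoC_plus. ring. }
  destruct (Hsol M (Nat.le_refl M)) as (Z0 & _ & T02 & T03).
  set (u0 := (- / Z0)%C) in *.
  assert (Hval : forall i u, repelling_petal r u -> phi u = (zeta - INR (M + i))%C ->
    iterate f (M + i) u = iterate f M u0).
  { induction i as [|i IH]; intros u Hu Eu.
    - rewrite Nat.add_0_r in *. replace u with u0; [reflexivity|]. apply Hinj; congruence.
    - rewrite Nat.add_succ_r in *. destruct (Hpull (M + i)%nat u ltac:(lia) Hu Eu) as [P1 P2].
      rewrite <- (IH (f u) P1 P2).
      replace (S (M + i)) with ((M + i) + 1)%nat by lia. now rewrite iterate_add. }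
  assert (Heps : eventually (fun m : nat => exists u : C,
      repelling_petal r u /\ phi u = (zeta - INR m)%C /\
      extended_repelling_inverse f r phi zeta = iterate f m u)).
  { unfold extended_repelling_inverse. apply epsilon_spec. exists (iterate f M u0). exists M.
    intros m Hm. destruct (Hsol m Hm) as (Z & _ & T2 & T3). exists (- / Z)%C.
    split; [assumption|]. split; [assumption|].
    replace m with (M + (m - M))%nat by lia. symmetry. apply Hval; [assumption|].
    now replace (M + (m - M))%nat with m by lia. }
  destruct Heps as [N HN]. now exists N.
Qed.

(** For fixed [m] the points to which the Abel equation is applied move with [n] and are only known
    to lie in a box, hence the uniformity of [d]. The point [x] stands for a perturbed image, which
    is off [f w] by the square of some eps_{k,n}. *)
Lemma box_increment (f : C -> C) (U : C -> Prop) (a : C) (K r : R) (phi : C -> C) (c h : R) :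
  holomorphic_on U f -> 0 < r -> 4 < / (2 * r) ->
  near_translation f U K r ->
  repelling_Fatou_coordinate f a r phi ->
  c + h < - (2 * / (2 * r)) ->
  forall e, 0 < e -> exists d, 0 < d /\ forall u v, c - h <= u <= c + h -> - h <= v <= h ->
    forall x : C, Cmod (x - f (- / (u, v)))%C < d ->
      Cmod (phi x - (phi (- / (u, v)) + 1))%C < e.
Proof.
  intros Hholf Hr H4 Hstep ((Hhol & _) & Habel & _) Hbox e He.
  assert (Hrr : 0 < / (2 * r)) by (apply Rinv_0_lt_compat; lra).
  apply (box_uniform (c - h) (c + h) (- h) h
    (fun Z d => forall x : C, Cmod (x - f (- / Z))%C < d -> Cmod (phi x - (phi (- / Z) + 1))%C < e)).
  - intros Z d d' Hdd H x Hx. apply H. lra.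
  - intros u v Hu Hv. set (Z0 := (u, v) : C).
    assert (HZ : fst Z0 < - (2 * / (2 * r))) by (simpl; lra).
    assert (HZC := fst_ge_opp_Cmod Z0).
    assert (HZ0 : Z0 <> RtoC 0) by (apply Cmod_gt_0; lra).
    destruct (Hstep Z0 ltac:(lra)) as (S0 & S1 & S2 & S3).
    assert (Hp : repelling_petal r (- / Z0)%C) by (apply repelling_petal_inv; try assumption; lra).
    assert (Hfp := repelling_petal_forward f r K Z0 Hr H4 S1 S2 S3 HZ).
    assert (Ci := Ccont_opp_inv Z0 HZ0).
    assert (C1 := Ccont_comp f _ _ Ci (ex_derive_Ccont _ _ (Hholf _ S0))).
    assert (C2 := Ccont_comp phi _ _ Ci (ex_derive_Ccont _ _ (Hhol _ Hp))).
    assert (C3 := ex_derive_Ccont _ _ (Hhol _ Hfp)).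
    destruct (C3 (e / 2) ltac:(lra)) as (d3 & Hd3 & D3).
    destruct (C2 (e / 2) ltac:(lra)) as (d2 & Hd2 & D2).
    destruct (C1 (d3 / 2) ltac:(lra)) as (d1 & Hd1 & D1).
    exists (Rmin (d3 / 2) (Rmin d2 d1)).
    split; [repeat apply Rmin_glb_lt; lra|]. intros Z HZd x Hx.
    assert (L1 := Rmin_l (d3 / 2) (Rmin d2 d1)). assert (L2 := Rmin_r (d3 / 2) (Rmin d2 d1)).
    assert (L3 := Rmin_l d2 d1). assert (L4 := Rmin_r d2 d1).
    assert (X1 := D1 Z ltac:(lra)). assert (X2 := D2 Z ltac:(lra)).
    assert (X3 : Cmod (x - f (- / Z0))%C < d3).
    { eapply Rle_lt_trans; [apply (Cmod_triangle3 x (f (- / Z)%C))|]. lra. }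
    apply D3 in X3. rewrite (Habel _ Hp Hfp) in X3.
    replace (phi x - (phi (- / Z) + 1))%C with
      ((phi x - (phi (- / Z0) + 1)) - (phi (- / Z) - phi (- / Z0)))%C by ring.
    eapply Rle_lt_trans; [apply Cmod_sub_le|]. lra.
Qed.

(** Continuity of the inverse of [phi] at [phi w], from injectivity and compactness: near a point of
    the box other than [w], [phi] stays away from [phi w], and near [w] itself the conclusion is
    immediate. *)
Lemma box_inverse (f : C -> C) (a : C) (r : R) (phi : C -> C) (c h : R) (w : C) :
  0 < r -> repelling_Fatou_coordinate f a r phi -> c + h < - (2 * / (2 * r)) ->
  repelling_petal r w ->
  forall e, 0 < e -> exists d, 0 < d /\ forall u v, c - h <= u <= c + h -> - h <= v <= h ->
    Cmod (phi (- / (u, v)) - phi w)%C < d -> Cmod (- / (u, v) - w)%C < e.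
Proof.
  intros Hr ((Hhol & Hinj) & _ & _) Hbox Hw e He.
  assert (Hrr : 0 < / (2 * r)) by (apply Rinv_0_lt_compat; lra).
  apply (box_uniform (c - h) (c + h) (- h) h
    (fun Z d => Cmod (phi (- / Z) - phi w)%C < d -> Cmod (- / Z - w)%C < e)).
  - intros Z d d' Hdd H x. apply H. lra.
  - intros u v Hu Hv. set (Z0 := (u, v) : C).
    assert (HZ : fst Z0 < - (2 * / (2 * r))) by (simpl; lra).
    assert (HZC := fst_ge_opp_Cmod Z0).
    assert (HZ0 : Z0 <> RtoC 0) by (apply Cmod_gt_0; lra).
    assert (Hp : repelling_petal r (- / Z0)%C) by (apply repelling_petal_inv; try assumption; lra).
    assert (Ci := Ccont_opp_inv Z0 HZ0).
    destruct (classic (- / Z0 = w)%C) as [E|NE].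
    + destruct (Ci e He) as (d & Hd & D). exists d. split; [assumption|].
      intros Z HZd _. rewrite <- E. now apply D.
    + assert (C2 := Ccont_comp phi _ _ Ci (ex_derive_Ccont _ _ (Hhol _ Hp))).
      set (q := Cmod (phi (- / Z0) - phi w)%C).
      assert (Hq : 0 < q).
      { apply Cmod_gt_0. intros E. apply NE, Hinj; try assumption.
        replace (phi (- / Z0)%C) with (phi (- / Z0) - phi w + phi w)%C by ring. rewrite E. ring. }
      destruct (C2 (q / 2) ltac:(lra)) as (d & Hd & D).
      exists (Rmin d (q / 2)). split; [apply Rmin_glb_lt; lra|]. intros Z HZd HZw.
      assert (L1 := Rmin_l d (q / 2)). assert (L2 := Rmin_r d (q / 2)).
      assert (X := D Z ltac:(lra)).
      assert (T := Cmod_triangle3 (phi (- / Z0)%C) (phi (- / Z)%C) (phi w)). fold q in T.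
      rewrite Cmod_minus_sym in X. lra.
Qed.

Theorem corollary1p3 :
  forall (f : C -> C) (U : C -> Prop) (a : C),
    open U -> U (RtoC 0) -> holomorphic_on U f -> parabolic_expansion f a ->
  exists r0 : R, 0 < r0 /\
  forall r : R, 0 < r < r0 ->
  forall phi_i phi_o : C -> C,
    attracting_Fatou_coordinate f a r phi_i ->
    repelling_Fatou_coordinate f a r phi_o ->
    repelling_inverse_extends f U r phi_o ->
  forall (alpha : R) (eps sigma : nat -> nat -> C),
    0 < alpha < 1 ->
    (exists M : R, forall n k : nat, (k < n)%nat ->
       Cmod (eps k n - (PI / INR n + PI / INR n ^ 2 * sigma k n))%C
         <= M / Rpower (INR n) (2 + alpha)) ->
    (exists B : R, forall n k : nat, (k < n)%nat -> Cmod (sigma k n) <= B) ->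
    (exists K : R, forall n k : nat, (k + 2 <= n)%nat ->
       Cmod (sigma k n + sigma (n - 2 - k)%nat n)%C <= K / INR n) ->
  forall w0 : C, parabolic_basin f U r w0 ->
    filterlim (fun n : nat => perturbed_orbit f eps n w0 n)
      eventually (locally (Lavaurs0 f r phi_i phi_o w0)).
Proof.
  intros f U a HU HU0 Hhol Hf.
  destruct (petal_step f U a HU HU0 Hf) as (K & r0 & HK & Hr0 & Hstep0).
  exists r0. split; [assumption|].
  intros r Hrr phi_i phi_o Hphi_i Hphi_o Hext alpha eps sigma Halpha [M0 HM0] [S0 HS0] [P0 HP0] w0 Hbasin.
  destruct (Hstep0 r Hrr) as (H4 & Hstep). assert (Hr : 0 < r) by lra.
  set (M := Rabs M0). set (S := Rabs S0). set (P := Rabs P0).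
  assert (HM : forall n k : nat, (k < n)%nat ->
       Cmod (eps k n - (PI / INR n + PI / INR n ^ 2 * sigma k n))%C
         <= M / Rpower (INR n) (2 + alpha)).
  { intros n k Hk. eapply Rle_trans; [now apply HM0|]. apply Rmult_le_compat_r; [|apply Rle_abs].
    apply Rlt_le, Rinv_0_lt_compat, exp_pos. }
  assert (HS : forall n k : nat, (k < n)%nat -> Cmod (sigma k n) <= S).
  { intros n k Hk. eapply Rle_trans; [now apply (HS0 n)|apply Rle_abs]. }
  assert (HP : forall n k : nat, (k + 2 <= n)%nat ->
       Cmod (sigma k n + sigma (n - 2 - k)%nat n)%C <= P / INR n).
  { intros n k Hk. eapply Rle_trans; [now apply HP0|]. apply Rmult_le_compat_r; [|apply Rle_abs].
    apply Rlt_le, Rinv_0_lt_compat, lt_0_INR. lia. }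
  assert (M_0 : 0 <= M) by apply Rabs_pos. assert (S_0 : 0 <= S) by apply Rabs_pos.
  assert (P_0 : 0 <= P) by apply Rabs_pos.
  destruct (kick_bound alpha M S eps sigma Halpha HM HS M_0 S_0) as (B & HB & HkB).
  assert (Hsum := kick_coef_sum_small alpha M S P eps sigma Halpha HM HS HP M_0 S_0 P_0).
  assert (Heps : forall h, 0 < h -> exists N, forall n k, (N <= n)%nat -> (k < n)%nat ->
     Cmod (eps k n ^ 2)%C <= h).
  { intros h Hh. destruct (inv_INR_small (B + 16) h Hh) as (N & HN & H). exists N.
    intros n k Hn Hk. specialize (H n Hn). assert (In := INR_ge_1 n ltac:(lia)).
    replace (eps k n ^ 2)%C with (kick eps n k + step_eps n ^ 2)%C by (unfold kick; ring).
    assert (T1 := HkB n k Hk). assert (T2 := step_eps_le n ltac:(lia)).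
    assert (T3 := step_eps_pos n ltac:(lia)).
    assert (Be : Cmod (RtoC (step_eps n)) <= 4 / INR n) by (rewrite Cmod_R, Rabs_right; lra).
    eapply Rle_trans; [cbound|]. eapply Rle_trans; [|exact H].
    apply Rle_div_r; [lra|].
    replace ((B / INR n ^ 3 + (4 / INR n) ^ 2) * INR n) with (B / INR n ^ 2 + 16 / INR n) by (field; lra).
    apply Rplus_le_compat.
    - apply Rle_div_l; [nra|]. assert (1 <= INR n ^ 2) by nra. nra.
    - apply Rle_div_l; lra. }
  destruct (entry f U a K r phi_i w0 Hhol HK Hr H4 Hstep Hphi_i Hbasin)
    as (Hcont & C0 & m0 & HC0 & HW & Hzeta).
  set (zeta := extended_attracting_coordinate f phi_i w0) in *.
  destruct (transit f a eps w0 B C0 m0 Hf HB HC0 HkB Hsum Heps Hcont HW) as (C1 & M1 & HC1 & Htr).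
  (* [w n j] lies [j] steps before the end, so that a fixed [j] refers to the exit for all [n]. *)
  set (w := fun n j => perturbed_orbit f eps n w0 (n - j)).
  assert (Hloc : forall m, (m0 + M1 + 1 <= m)%nat -> exists N, forall n, (N <= n)%nat ->
    w n m <> RtoC 0 /\ Cmod (- / w n m - (- / iterate f m w0 - 2 * INR m))%C <= C1 / sqrt (INR m) /\
    Cmod (- / w n m + INR m)%C <= (C0 + C1) * sqrt (INR m)).
  { intros m Hm. destruct (Htr m ltac:(lia)) as (N & HN). exists N. intros n Hn.
    destruct (HN n Hn) as [T1 T2]. destruct (HW m ltac:(lia)) as [T3 T4].
    split; [assumption|]. split; [assumption|].
    unfold w. replace (- / perturbed_orbit f eps n w0 (n - m) + INR m)%C with
      ((- / iterate f m w0 - INR m) +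
       (- / perturbed_orbit f eps n w0 (n - m) - (- / iterate f m w0 - 2 * INR m)))%C by ring.
    eapply Rle_trans; [cbound|].
    assert (Sm := sqrt_ge_1 m ltac:(lia)).
    assert (C1 / sqrt (INR m) <= C1 * sqrt (INR m)).
    { apply Rle_div_l; [lra|]. assert (1 <= sqrt (INR m) * sqrt (INR m)) by nra.
      assert (C1 * 1 <= C1 * (sqrt (INR m) * sqrt (INR m))) by (apply Rmult_le_compat_l; lra). lra. }
    lra. }
  set (Ct := C0 + C1) in *.
  destruct (repelling_asymptotics f a r phi_o Hr Hphi_o (2 * Ct) 1 ltac:(lra)) as [m2 Hbox].
  assert (HCt : 0 <= Ct) by (unfold Ct; lra).
  (* The right edge of the box around [-m] is located by applying the asymptotics to its real
     point. *)
  assert (Hedge : forall m, (m2 <= m)%nat ->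
    - INR m + Ct * sqrt (INR m) < - (2 * / (2 * r))).
  { intros m Hm. apply (Hbox m (RtoC (- INR m + Ct * sqrt (INR m))) Hm).
    rewrite <- RtoC_plus, Cmod_R. replace (- INR m + Ct * sqrt (INR m) + INR m)
      with (Ct * sqrt (INR m)) by ring.
    assert (T := sqrt_pos (INR m)). rewrite Rabs_right by (apply Rle_ge; nra). nra. }
  assert (Hin : forall m n, Cmod (- / w n m + INR m)%C <= Ct * sqrt (INR m) ->
    - INR m - Ct * sqrt (INR m) <= fst (- / w n m)%C <= - INR m + Ct * sqrt (INR m) /\
    - (Ct * sqrt (INR m)) <= snd (- / w n m)%C <= Ct * sqrt (INR m)).
  { intros m n H. assert (T1 := Rle_trans _ _ _ (Rabs_fst_le _) H).
    assert (T2 := Rle_trans _ _ _ (Rabs_snd_le _) H).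
    change (fst (- / w n m + INR m)%C) with (fst (- / w n m)%C + INR m) in T1.
    change (snd (- / w n m + INR m)%C) with (snd (- / w n m)%C + 0) in T2.
    apply Rabs_le_between in T1. apply Rabs_le_between in T2. lra. }
  (* The repelling asymptotics, the passage through the gate and the entrance limit cost [e / 4]
     each; the terms [(1 - a) ln m] cancel. *)
  assert (Hacc : forall e, 0 < e -> exists m3, forall m, (m3 <= m)%nat ->
    exists N, forall n, (N <= n)%nat -> Cmod (phi_o (w n m) - (zeta - INR m))%C < e).
  { intros e He.
    destruct (repelling_asymptotics f a r phi_o Hr Hphi_o Ct (e / 4) ltac:(lra)) as [m3 H3].
    destruct (Hzeta (e / 4) ltac:(lra)) as [m4 H5].
    destruct (INR_unbounded ((C1 / (e / 4)) ^ 2)) as [m5 H6].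
    exists (m0 + M1 + 1 + m3 + m4 + m5)%nat. intros m Hm.
    destruct (Hloc m ltac:(lia)) as (N & HN). exists N. intros n Hn.
    destruct (HN n Hn) as (T1 & T2 & T3).
    destruct (H3 m _ ltac:(lia) T3) as (_ & _ & T4). rewrite opp_inv_invol in T4 by assumption.
    assert (T5 := H5 m ltac:(lia)).
    assert (T6 : C1 / sqrt (INR m) <= e / 4).
    { assert (Sm := sqrt_ge_1 m ltac:(lia)). apply Rle_div_l; [lra|].
      assert (Hc : 0 <= C1 / (e / 4)) by (apply Rle_div_r; lra).
      assert (Hs : C1 / (e / 4) <= sqrt (INR m)).
      { rewrite <- (sqrt_pow2 (C1 / (e / 4))) by assumption. apply sqrt_le_1_alt.
        assert (T := le_INR m5 m ltac:(lia)). lra. }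
      apply Rle_div_l in Hs; lra. }
    replace (phi_o (w n m) - (zeta - INR m))%C with
      ((phi_o (w n m) - (- / w n m - (1 - a) * ln (INR m)))
       + (- / w n m - (- / iterate f m w0 - 2 * INR m))
       + (- / iterate f m w0 - INR m - (1 - a) * ln (INR m) - zeta))%C by ring.
    eapply Rle_lt_trans; [apply Cmod_triangle|].
    eapply Rle_lt_trans; [apply Rplus_le_compat_r, Cmod_triangle|]. lra. }
  destruct (extended_repelling_inverse_eq f U a K r phi_o zeta Hr H4 Hstep Hphi_o) as (m6 & Hval).
  destruct (Hext zeta) as [m7 Hiter].
  set (M2 := (m0 + M1 + 1 + m2 + m6 + m7)%nat).
  destruct (Hval M2 ltac:(lia)) as (v & Hv & Ev & EL).
  specialize (Hiter M2 ltac:(lia) v Hv Ev).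
  (* For a fixed [m] the defect of the Abel equation along the perturbed orbit is caused only by the
     added square of eps_{k,n}, which vanishes as [n] grows. *)
  assert (Hincr : forall m, (M2 <= m)%nat -> forall e, 0 < e -> exists N, forall n, (N <= n)%nat ->
    Cmod (phi_o (w n m) - (phi_o (w n (Datatypes.S m)) + 1))%C < e).
  { intros m Hm e He. set (j := Datatypes.S m).
    destruct (box_increment f U a K r phi_o (- INR j) (Ct * sqrt (INR j)) Hhol Hr H4 Hstep Hphi_o
      (Hedge j ltac:(lia)) e He) as (d & Hd & HD).
    destruct (Hloc j ltac:(lia)) as (N1 & HN1).
    destruct (Heps (d / 2) ltac:(lra)) as (N2 & HN2).
    exists (N1 + N2 + j + 1)%nat. intros n Hn.
    destruct (HN1 n ltac:(lia)) as (T1 & _ & T3).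
    destruct (Hin j n T3) as [B1 B2].
    assert (T := HD _ _ B1 B2). rewrite <- surjective_pairing in T.
    rewrite opp_inv_invol in T by assumption. apply T.
    assert (Estep : w n m = (f (w n j) + eps (n - j)%nat n ^ 2)%C).
    { unfold w. replace (n - m)%nat with (Datatypes.S (n - j)) by lia. reflexivity. }
    rewrite Estep.
    replace (f (w n j) + eps (n - j)%nat n ^ 2 - f (w n j))%C with (eps (n - j)%nat n ^ 2)%C by ring.
    assert (T4 := HN2 n (n - j)%nat ltac:(lia) ltac:(lia)). lra. }
  assert (Hincr' : forall i e, 0 < e -> exists N, forall n, (N <= n)%nat ->
    Cmod (phi_o (w n M2) - (phi_o (w n (M2 + i)%nat) + INR i))%C < e).
  { induction i as [|i IH]; intros e He.
    - exists 0%nat. intros n _. rewrite Nat.add_0_r.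
      replace (phi_o (w n M2) - (phi_o (w n M2) + INR 0))%C with (RtoC 0) by (simpl; ring).
      now rewrite Cmod_0.
    - destruct (IH (e / 2) ltac:(lra)) as (N1 & HN1).
      destruct (Hincr (M2 + i)%nat ltac:(lia) (e / 2) ltac:(lra)) as (N2 & HN2).
      exists (N1 + N2)%nat. intros n Hn. rewrite Nat.add_succ_r, S_INR, RtoC_plus.
      replace (phi_o (w n M2) - (phi_o (w n (Datatypes.S (M2 + i))) + (INR i + 1)))%C with
        ((phi_o (w n M2) - (phi_o (w n (M2 + i)%nat) + INR i))
         + (phi_o (w n (M2 + i)%nat) - (phi_o (w n (Datatypes.S (M2 + i))) + 1)))%C by ring.
      eapply Rle_lt_trans; [apply Cmod_triangle|].
      assert (T1 := HN1 n ltac:(lia)). assert (T2 := HN2 n ltac:(lia)). lra. }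
  assert (Hphi : forall e, 0 < e -> exists N, forall n, (N <= n)%nat ->
    Cmod (phi_o (w n M2) - phi_o v)%C < e).
  (* The accuracy [e / 2] dictates how far before the end, at [M2 + m3], the comparison is made; the
     [m3] Abel steps back to [M2], fixed in number, cost the other half for large [n]. *)
  { intros e He. destruct (Hacc (e / 2) ltac:(lra)) as (m3 & H3).
    destruct (H3 (M2 + m3)%nat ltac:(lia)) as (N1 & HN1).
    destruct (Hincr' m3 (e / 2) ltac:(lra)) as (N2 & HN2).
    exists (N1 + N2)%nat. intros n Hn. rewrite Ev.
    assert (T1 := HN1 n ltac:(lia)). assert (T2 := HN2 n ltac:(lia)).
    rewrite plus_INR, RtoC_plus in T1.
    replace (phi_o (w n M2) - (zeta - INR M2))%C with
      ((phi_o (w n M2) - (phi_o (w n (M2 + m3)%nat) + INR m3))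
       + (phi_o (w n (M2 + m3)%nat) - (zeta - (INR M2 + INR m3))))%C by ring.
    eapply Rle_lt_trans; [apply Cmod_triangle|]. lra. }
  assert (Hcv : forall i, (i < M2)%nat -> Ccont f (iterate f i v)).
  { intros i Hi. apply ex_derive_Ccont, Hhol, Hiter. assumption. }
  intros Q HQ. apply locally_Cmod in HQ. destruct HQ as (e & He & HQ).
  (* [box_inverse] brings [w n M2] close to [v], and the remaining [M2] steps follow the orbit of
     [v], whose endpoint is the Lavaurs value. [Hcv] holds because [repelling_inverse_extends] keeps
     this orbit in [U]. *)
  destruct (perturbed_orbit_close f eps v M2 Hcv Heps e He) as (d & N1 & Hd & H1).
  destruct (box_inverse f a r phi_o (- INR M2) (Ct * sqrt (INR M2)) v Hr Hphi_o
    (Hedge M2 ltac:(lia)) Hv d Hd) as (d' & Hd' & H2).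
  destruct (Hphi d' Hd') as (N2 & H3).
  destruct (Hloc M2 ltac:(lia)) as (N3 & H5).
  exists (N1 + N2 + N3 + M2)%nat. intros n Hn. apply HQ.
  unfold Lavaurs0. fold zeta. rewrite EL.
  destruct (H5 n ltac:(lia)) as (T1 & _ & T3). destruct (Hin M2 n T3) as [B1 B2].
  assert (T := H2 _ _ B1 B2). rewrite <- surjective_pairing in T.
  rewrite opp_inv_invol in T by assumption. specialize (T (H3 n ltac:(lia))).
  replace n with ((n - M2) + M2)%nat at 2 by lia.
  apply H1; [lia|lia|exact T].
Qed.
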